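(* Let $\Lambda,\Gamma\subset\mathbb{R}^n$ be lattices and let $\mathcal{P}$ and $\mathcal{Q}$ be periodic configurations in $\mathbb{R}^n$, where $\mathcal{P}$ is a union of $N$ distinct translates of $\Lambda$ and $\mathcal{Q}$ is a union of $M$ distinct translates of $\Gamma$. Assume $0\in\mathcal{P}$, $0\in\mathcal{Q}$, $\mathcal{P}-\mathcal{P}\subseteq\Gamma^*$ and $\mathcal{Q}-\mathcal{Q}\subseteq\Lambda^*$. Then $\Lambda\subseteq\mathcal{P}\subseteq\Gamma^*$ and $\Gamma\subseteq\mathcal{Q}\subseteq\Lambda^*$; let $G=\Gamma^*/\Lambda$, and identify $\widehat{G}=\Lambda^*/\Gamma$ via the pairing $\langle x+\Lambda,y+\Gamma\rangle=e^{2\pi i\langle x,y\rangle}$. Let $\mathcal{P}$ correspond to the translates of $\Lambda$ by the elements of $S=\{v_1,\dots,v_N\}\subseteq G$ and let $\mathcal{Q}$ correspond to the translates of $\Gamma$ by the elements of $T=\{w_1,\dots,w_M\}\subseteq\widehat{G}$. Then $\mathcal{P}$ and $\mathcal{Q}$ are formally dual if and only if the following equivalent conditions hold. (1) For every $y\in\widehat{G}$, $$\left|\frac1N\sum_{i=1}^N\langle v_i,y\rangle\right|^2=\frac1M\cdot\#\{(j,k) \mid 1\le j,k\le M \text{ and } y=w_j-w_k\}.$$ (2) For every function $f\colon G\to\mathbb{C}$, $$\frac{1}{N^{3/2}}\sum_{j,k=1}^N f(v_j-v_k)=\frac{1}{M^{3/2}}\sum_{j,k=1}^M\widehat{f}(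w_j-w_k).$$
   Context: A lattice in $\mathbb{R}^n$ is a full-rank discrete subgroup; its dual is $\Lambda^*=\{y\in\mathbb{R}^n \mid \langle x,y\rangle\in\mathbb{Z}\text{ for all }x\in\Lambda\}$, and $\operatorname{covol}(\Lambda)=\operatorname{vol}(\mathbb{R}^n/\Lambda)$. A periodic configuration is a union $\mathcal{P}=\bigcup_{j=1}^N(\Lambda+v_j)$ of finitely many ($N\ge1$) pairwise distinct translates of a lattice $\Lambda$ (called an underlying lattice of $\mathcal{P}$); its point density is $\delta(\mathcal{P})=N/\operatorname{covol}(\Lambda)$. For a set $A$ in an abelian group, $A-A=\{x-y \mid x,y\in A\}$. The Fourier transform of a Schwartz function $f\colon\mathbb{R}^n\to\mathbb{R}$ is $\widehat{f}(y)=\int_{\mathbb{R}^n}f(x)e^{-2\pi i\langle x,y\rangle}\,dx$. The average pair sum of a Schwartz function $f$ (real- or complex-valued) over $\mathcal{P}$ is $\Sigma_f(\mathcal{P})=\frac1N\sum_{j,k=1}^N\sum_{x\in\Lambda}f(x+v_j-v_k)$ (independent of the chosen decomposition). Two periodic configurations $\mathcal{P},\mathcal{Q}$ in $\mathbb{R}^n$ are formally dual if $\Sigma_f(\mathcal{P})=\delta(\mathcal{P})\,\Sigma_{\widehat f}(\mathcal{Q})$ for every Schwartz function $f\colon\mathbb{R}^n\to\mathbb{R}$. For a finite abelian group $G$ with character group $\widehat{G}$ and pairing $\langle\cdot,\cdot\rangle\colon G\times\widehat{G}\to S^1\subset\mathbb{C}^*$, the Fourier transform of $f\colon G\to\mathbb{C}$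 is $\widehat f\colon\widehat G\to\mathbb{C}$, $\widehat f(y)=\frac{1}{\sqrt{|G|}}\sum_{x\in G}f(x)\overline{\langle x,y\rangle}$. *)

(* Defs.v *)
From HB Require Import structures.
From mathcomp Require Import all_boot all_order all_algebra.
From mathcomp Require Import all_classical all_reals all_analysis.
From mathcomp Require Import finmap complex.

Set Implicit Arguments.
Unset Strict Implicit.
Unset Printing Implicit Defensive.

Import Order.TTheory GRing.Theory Num.Theory.
Import numFieldNormedType.Exports.

Local Open Scope classical_set_scope.
Local Open Scope ring_scope.
Local Open Scope complex_scope.
Local Open Scope quotient_scope.

Section borel_rV.
Context {R : realType} (n : nat).

(* The sigma-algebra on [R^n] generated by the coordinates, i.e. the Borel
   sigma-algebra. *)
Let coor (i : 'I_n) (x : 'rV[R]_n) : measurableTypeR R := x 0 i.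

Let rV_set0 : g_sigma_preimage coor set0.
Proof. exact: sigma_algebra0. Qed.

Let rV_setC A : g_sigma_preimage coor A -> g_sigma_preimage coor (~` A).
Proof. exact: sigma_algebraC. Qed.

Let rV_bigcup (F : (set 'rV[R]_n)^nat) :
  (forall i, g_sigma_preimage coor (F i)) ->
  g_sigma_preimage coor (\bigcup_i F i).
Proof. exact: sigma_algebra_bigcup. Qed.

HB.instance Definition _ := @isMeasurable.Build
  (measure_tuple_display (R.-ocitv.-measurable).-sigma)
  'rV[R]_n (g_sigma_preimage coor) rV_set0 rV_setC rV_bigcup.

Lemma measurable_coor (i : 'I_n) :
  measurable_fun [set: 'rV[R]_n] (fun x => x 0 i : measurableTypeR R).
Proof.
move=> _ Y mY; rewrite setTI; apply: sub_sigma_algebra => /=.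
rewrite -bigcup_seq/=; exists i => /=; first by rewrite mem_index_enum.
by exists Y => //; rewrite setTI.
Qed.

Lemma measurable_rVP d (T : measurableType d) (f : T -> 'rV[R]_n) :
  (forall i, measurable_fun setT (fun t => f t 0 i : measurableTypeR R)) ->
  measurable_fun setT f.
Proof.
move=> mf; apply: (@measurability _ _ _ _ _ _
  (\big[setU/set0]_(i < n) preimage_set_system setT (coor i) measurable)) => //.
move=> _ [B + <-]; rewrite -bigcup_seq/= => -[i _ [Y mY <-]].
by rewrite !setTI -comp_preimage -[X in measurable X]setTI; exact: mf.
Qed.

End borel_rV.

Section cons_rV.
Context {R : realType} (n : nat).

Definition cons_rV (p : measurableTypeR R * 'rV[R]_n) : 'rV[R]_n.+1 :=
  row_mx (p.1%:M : 'rV_1) p.2.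

Lemma cons_rV0 t x : cons_rV (t, x) 0 ord0 = t.
Proof.
have -> : (ord0 : 'I_n.+1) = lshift n (0 : 'I_1) by exact: val_inj.
by rewrite [LHS]row_mxEl mxE.
Qed.

Lemma cons_rVS t x i : cons_rV (t, x) 0 (lift ord0 i) = x 0 i.
Proof.
have -> : lift ord0 i = rshift 1 i by exact: val_inj.
by rewrite [LHS]row_mxEr.
Qed.

Lemma measurable_cons_rV : measurable_fun setT cons_rV.
Proof.
apply/measurable_rVP => i.
have -> : (fun p => cons_rV p 0 i : measurableTypeR R) =
    if unlift ord0 i is Some j then fun p => p.2 0 j else fst.
  by apply/funext => -[t x]; case: unliftP => [j|] ->;
    rewrite ?cons_rV0 ?cons_rVS.
case: (unlift ord0 i) => [j|]; last exact: measurable_fst.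
exact: (measurableT_comp (@measurable_coor R n j) measurable_snd).
Qed.

Variable mu : {sigma_finite_measure set 'rV[R]_n -> \bar R}.

Definition prod_rV : set 'rV[R]_n.+1 -> \bar R :=
  pushforward (@lebesgue_measure R \x mu)%E cons_rV.

Let prod_rV0 : prod_rV set0 = 0%E.
Proof. by rewrite /prod_rV /pushforward preimage_set0 measure0. Qed.

Let prod_rV_ge0 A : (0 <= prod_rV A)%E.
Proof. by rewrite /prod_rV /pushforward measure_ge0. Qed.

Let prod_rV_sigma_additive : semi_sigma_additive prod_rV.
Proof.
move=> F mF tF mUF; rewrite /prod_rV /pushforward preimage_bigcup.
apply: measure_semi_sigma_additive.
- by move=> k; rewrite -[X in measurable X]setTI; exact: measurable_cons_rV.
- apply/trivIsetP => /= i j _ _ ij; rewrite -preimage_setI.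
  by move/trivIsetP : tF => /(_ _ _ _ _ ij) ->//; rewrite preimage_set0.
- rewrite -preimage_bigcup -[X in measurable X]setTI.
  exact: measurable_cons_rV.
Qed.

HB.instance Definition _ := isMeasure.Build _ _ _
  prod_rV prod_rV0 prod_rV_ge0 prod_rV_sigma_additive.

Let prod_rV_sigma_finite : sigma_finite setT prod_rV.
Proof.
have /sigma_finiteP[F [TF ndF Foo]] := sigma_finiteT (@lebesgue_measure R).
have /sigma_finiteP[G [TG ndG Goo]] := sigma_finiteT mu.
pose uncons (x : 'rV[R]_n.+1) : measurableTypeR R * 'rV[R]_n :=
  (x 0 0, \row_j x 0 (lift ord0 j)).
have unconsK p : uncons (cons_rV p) = p.
  case: p => t x; rewrite /uncons cons_rV0; congr pair.
  by apply/rowP => j; rewrite mxE cons_rVS.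
have muncons : measurable_fun setT uncons.
  apply: measurable_fun_pair; first exact: measurable_coor.
  apply: measurable_rVP => j; rewrite (_ : (fun x => _) =
    fun x : 'rV[R]_n.+1 => x 0 (lift ord0 j) : measurableTypeR R).
    exact: measurable_coor.
  by apply/funext => x; rewrite mxE.
exists (fun k => uncons @^-1` (F k `*` G k)).
  apply/esym; rewrite -subTset => x _.
  have [i _ Fi] : (\bigcup_i F i) (uncons x).1 by rewrite -TF.
  have [j _ Gj] : (\bigcup_i G i) (uncons x).2 by rewrite -TG.
  exists (maxn i j) => //; split.
    by move: Fi; exact/subsetPset/ndF/leq_maxl.
  by move: Gj; exact/subsetPset/ndG/leq_maxr.
move=> k; have [mF Fk] := Foo k; have [mG Gk] := Goo k; split.
  by rewrite -[X in measurable X]setTI; apply: muncons => //; exact: measurableX.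
rewrite /prod_rV /pushforward -comp_preimage.
rewrite (_ : uncons \o cons_rV = id); last exact/funext.
by rewrite preimage_id product_measure1E// lte_mul_pinfty// ge0_fin_numE.
Qed.

HB.instance Definition _ := Measure_isSigmaFinite.Build _ _ _
  prod_rV prod_rV_sigma_finite.

End cons_rV.

(* Lebesgue measure on [R^n], as an iterated product of [lebesgue_measure]. *)
Fixpoint lebesgue_rV {R : realType} (n : nat) :
    {sigma_finite_measure set 'rV[R]_n -> \bar R} :=
  if n is n'.+1 then prod_rV (lebesgue_rV n') else \d_(0 : 'rV[R]_0).

Lemma lebesgue_rV_box {R : realType} (n : nat)
    (A : 'I_n -> set (measurableTypeR R)) : (forall i, measurable (A i)) ->
  lebesgue_rV n [set x : 'rV[R]_n | forall i, A i (x 0 i)] =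
  (\prod_(i < n) @lebesgue_measure R (A i))%E.
Proof.
elim: n A => [|n IHn] A mA.
  by rewrite big_ord0 /= diracE mem_set// => -[].
rewrite big_ord_recl -IHn; last by move=> i; exact: mA.
rewrite /= /prod_rV /pushforward -product_measure1E//; last first.
  rewrite (_ : mkset _ =
    \bigcap_(i in [set: 'I_n]) (fun x : 'rV[R]_n => x 0 i) @^-1` A (lift ord0 i)).
    apply: fin_bigcap_measurable => // i _.
    by rewrite -[X in measurable X]setTI; exact: measurable_coor.
  by apply/seteqP; split => [x Ax i _|x Ax i]; exact: Ax.
congr (_ _); apply/seteqP; split => [[t x] /= Atx|[t x] /= [At Ax] i].
  split => [|i]; first by have := Atx ord0; rewrite cons_rV0.
  by have := Atx (lift ord0 i); rewrite cons_rVS.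
by case: (unliftP ord0 i) => [j|] ->; rewrite ?cons_rV0 ?cons_rVS.
Qed.

Section fourier.
Context {R : realType} (n : nat).
Implicit Types (f : 'rV[R]_n -> R) (x y : 'rV[R]_n).

Definition dotp x y : R := \sum_(i < n) x 0 i * y 0 i.

Definition e2pi (t : R) : R[i] := cos (2 * pi * t) +i* sin (2 * pi * t).

Definition partials (s : seq 'I_n) f : 'rV[R]_n -> R :=
  foldr (fun i g => 'D_(delta_mx 0 i) g) f s.

Definition schwartz f : Prop :=
  (forall s x, differentiable (partials s f) x) /\
  (forall s (a : 'I_n -> nat), exists M : R, forall x,
     `|(\prod_(i < n) x 0 i ^+ a i) * partials s f x| <= M).

Definition Cintegral (g : 'rV[R]_n -> R[i]) : R[i] :=
  Rintegral (lebesgue_rV n) setT (fun x => complex.Re (g x)) +i*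
  Rintegral (lebesgue_rV n) setT (fun x => complex.Im (g x)).

Definition fourier f y : R[i] :=
  Cintegral (fun x => (f x)%:C * e2pi (- dotp x y)).

End fourier.

(* The sum over [A] of an absolutely summable family. *)
Definition Rsum {R : realType} {T : choiceType} (A : set T) (g : T -> R) : R :=
  fine (\esum_(x in A) (g^\+ x)%:E) - fine (\esum_(x in A) (g^\- x)%:E).

Definition Csum {R : realType} {T : choiceType} (A : set T) (g : T -> R[i]) :
    R[i] :=
  Rsum A (fun x => complex.Re (g x)) +i* Rsum A (fun x => complex.Im (g x)).

Section lattice.
Context {R : realType} (n : nat).

Record lattice := Lattice {
  lattice_set :> set 'rV[R]_n;
  lattice0 : lattice_set 0;
  latticeB : forall x y, lattice_set x -> lattice_set y -> lattice_set (x - y);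
  lattice_discrete : forall x, lattice_set x -> isolated lattice_set x;
  lattice_full_rank : exists B : 'M[R]_n,
    row_free B /\ forall i, lattice_set (row i B)
}.

Implicit Types L : lattice.

Definition dual (L : set 'rV[R]_n) : set 'rV[R]_n :=
  [set y | forall x, L x -> dotp x y \is a Num.int].

Definition fundamental_domain L (F : set 'rV[R]_n) : Prop :=
  measurable F /\ forall x, exists! y, F y /\ lattice_set L (x - y).

(* All fundamental domains have the same measure, so the choice made by [get]
   is immaterial. *)
Definition covol L : R :=
  fine (lebesgue_rV n (get [set F | fundamental_domain L F])).

Definition lattice_pred L : {pred 'rV[R]_n} := fun x => `[< lattice_set L x >].

Fact lattice_zmod_closed L : zmod_closed (lattice_pred L).
Proof.
split=> [|x y /asboolP Lx /asboolP Ly]; apply/asboolP; first exact: lattice0.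
exact: latticeB.
Qed.

HB.instance Definition _ L :=
  GRing.isZmodClosed.Build 'rV[R]_n (lattice_pred L) (lattice_zmod_closed L).

End lattice.
Arguments lattice R n : clear implicits.

(* The group [R^n / L]. *)
Notation torus L := (Quotient.quot (lattice_pred L)).

Section periodic.
Context {R : realType} (n : nat).

(* A periodic configuration together with a decomposition into translates of
   an underlying lattice; [avg_pair_sum] and [density] below depend only on the
   underlying set [config_set]. *)
Record periodic_config := PeriodicConfig {
  underlying : lattice R n;
  ntrans : nat;
  trans : 'I_ntrans -> 'rV[R]_n;
  ntrans_gt0 : (0 < ntrans)%N;
  trans_distinct : forall j k,
    lattice_set underlying (trans j - trans k) -> j = k
}.

Arguments trans : clear implicits.

Definition config_set (P : periodic_config) : set 'rV[R]_n :=
  [set x | exists j, lattice_set (underlying P) (x - trans P j)].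

Definition density (P : periodic_config) : R :=
  (ntrans P)%:R / covol (underlying P).

Definition avg_pair_sum (g : 'rV[R]_n -> R[i]) (P : periodic_config) : R[i] :=
  (ntrans P)%:R^-1 * \sum_(j < ntrans P) \sum_(k < ntrans P)
    Csum (underlying P) (fun x => g (x + trans P j - trans P k)).

Definition formally_dual (P Q : periodic_config) : Prop :=
  forall f : 'rV[R]_n -> R, schwartz f ->
    avg_pair_sum (fun x => (f x)%:C) P =
    (density P)%:C * avg_pair_sum (fourier f) Q.

End periodic.
Arguments periodic_config R n : clear implicits.
Arguments trans {R n} p j : rename.

(* A finite abelian group [G] is a finite subgroup of a [zmodType] [V]; a
   function on [G] is a function on [V] of which only the values on [G] are
   used. *)
Section finite_abelian.
Context {R : realType} (V W : zmodType).

Definition is_character (G : set V) (chi : V -> R[i]) : Prop :=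
  (forall x, G x -> `|chi x| = 1) /\
  (forall x y, G x -> G y -> chi (x + y) = chi x * chi y).

(* [y |-> <_, y>] is an isomorphism from [Gh] to the character group of [G]. *)
Definition identifies_dual (G : set V) (Gh : set W) (b : V -> W -> R[i]) : Prop :=
  [/\ forall y, Gh y -> is_character G (b ^~ y),
      forall x y z, G x -> Gh y -> Gh z -> b x (y + z) = b x y * b x z &
      forall chi, is_character G chi ->
        exists! y, Gh y /\ forall x, G x -> chi x = b x y].

Definition dft (G : set V) (b : V -> W -> R[i]) (f : V -> R[i]) (y : W) : R[i] :=
  (Num.sqrt #|` fset_set G|%:R)^-1%:C * \sum_(x \in G) f x * (b x y)^*.

End finite_abelian.

Section torus_pairing.
Context {R : realType} (n : nat) (L M : lattice R n).

(* The image of [A] in [R^n / L]. *)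
Definition torus_image (A : set 'rV[R]_n) : set (torus L) :=
  [set \pi_(torus L) x | x in A].

(* [<x + L, y + M> = e^(2 pi i <x, y>)] for [x] in the dual of [M] and [y] in
   the dual of [L]; elsewhere the value depends on the representatives. *)
Definition torus_pairing (x : torus L) (y : torus M) : R[i] :=
  e2pi (dotp (repr x) (repr y)).

End torus_pairing.
Arguments torus_image {R n} L A.
Arguments torus_pairing {R n} L M x y.

(* Main.v *)
(* Write (1') for the analogue of (1) with the roles of [P] and [Q] exchanged.

   Orthogonality of characters shows that [x |-> #{(j, k) | x = v_j - v_k}] and
   [y |-> |N^-1 sum_j <v_j, y>|^2] are Fourier transforms of each other up to
   scaling.  Hence (1) and (1') imply each other, and either of them forces
   [|G| = N M] (evaluate at the neutral element).  Condition (2) tested on delta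
   functions is (1') up to a constant, which its value at [0] determines.

   By Poisson summation on [Gamma], applied to the translates of the transform
   of [f], both sides of the definition of formal duality are sums of [f] over
   [Gamma^*] with bounded weights: on the left the number of representations as
   a difference [v_j - v_k], on the right a multiple of
   [sum_(j, k) e^(2 pi i <x, w_j - w_k>)].  Narrow Gaussians show that the
   sums agree for all Schwartz [f] only if the weights agree at each point of
   [Gamma^*].  This is (1') together with [|G| = N M], the latter coming from the
   weights at [0] and [covol Lambda = |G| covol Gamma^*]. *)

Require Import Defs.
From mathcomp Require Import all_boot all_order all_algebra.
From mathcomp Require Import all_classical all_reals all_analysis.
From mathcomp Require Import measurable_realfun finmap complex lra ring zify.

Set Implicit Arguments.
Unset Strict Implicit.
Unset Printing Implicit Defensive.

Import Order.TTheory GRing.Theory Num.Theory.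
Import numFieldNormedType.Exports.

Local Open Scope classical_set_scope.
Local Open Scope ring_scope.
Local Open Scope complex_scope.
Local Open Scope quotient_scope.

(** * Absolutely summable families *)

(** Both sides of formal duality are compared through values of [f] on [Gamma^*] only, so Fourier
    inversion never enters and the transform need not be shown to be Schwartz: decay of order [2 n]
    suffices for every sum. Lattices are given abstractly, as discrete subgroups, so bases have to
    be produced before anything can be computed; afterwards a lattice is a set of points with
    integer coordinates. The main property of Lebesgue measure used is translation invariance: the
    integral of a periodic function does not depend on the fundamental domain, which yields the
    well-definedness of [covol], the index formula and the vanishing integrals of nontrivial
    characters, all without a linear change of variables. Poisson summation is proved with a
    nonnegative trigonometric kernel instead of convergence of Fourier series: positivity and mean 1
    give an approximate identity on one side, coefficients in [0, 1] give dominated convergence on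
    the other. Gaussians serve as test functions because their derivatives are polynomial multiples
    of themselves. *)

Section sums.
Context {R : realType}.
Implicit Types (T : choiceType).

(* [Rsum] takes [fine] of possibly infinite sums, so it is meaningful only on
   families satisfying [absum]. *)
Definition absum T (A : set T) (g : T -> R) : Prop :=
  exists S : R, forall X : {fset T}, [set` X] `<=` A ->
    \sum_(x <- X) `|g x| <= S.

(** Convergence along finite subsets. [Rsum] splits a family into positive and negative parts, which
    additivity does not respect; its linearity is obtained by identifying it with this limit, which
    is unique and linear. *)
Definition has_sum T (A : set T) (g : T -> R) (s : R) : Prop :=
  forall e : R, 0 < e -> exists2 X0 : {fset T}, [set` X0] `<=` A &
    forall X : {fset T}, (X0 `<=` X)%fset -> [set` X] `<=` A ->
      `|\sum_(x <- X) g x - s| <= e.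

Lemma absum_le T (A : set T) (g h : T -> R) :
  (forall x, A x -> `|g x| <= h x) -> absum A h -> absum A g.
Proof.
move=> gh [S hS]; exists S => X XA; apply: le_trans (hS X XA).
rewrite big_seq [leRHS]big_seq; apply: ler_sum => x xX.
by apply: le_trans (gh x (XA _ xX)) (ler_norm _).
Qed.

Lemma absumD T (A : set T) (g h : T -> R) :
  absum A g -> absum A h -> absum A (fun x => g x + h x).
Proof.
move=> [S hS] [S' hS']; exists (S + S') => X XA.
apply: le_trans (lerD (hS X XA) (hS' X XA)); rewrite -big_split /=.
by apply: ler_sum => x _; exact: ler_normD.
Qed.

Lemma absumZ T (A : set T) (g : T -> R) c :
  absum A g -> absum A (fun x => c * g x).
Proof.
move=> [S hS]; exists (`|c| * S) => X XA.
under eq_bigr do rewrite normrM.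
by rewrite -mulr_sumr ler_wpM2l// hS.
Qed.

Lemma absum_norm T (A : set T) (g : T -> R) :
  absum A g -> absum A (fun x => `|g x|).
Proof.
by move=> [S hS]; exists S => X XA; under eq_bigr do rewrite normr_id; exact: hS.
Qed.

Lemma absum_big T (A : set T) (I : Type) (r : seq I) (g : I -> T -> R) :
  (forall i, absum A (g i)) -> absum A (fun x => \sum_(i <- r) g i x).
Proof.
move=> Ag; elim: r => [|i r IHr].
  by exists 0 => X _; rewrite big1// => x _; rewrite big_nil normr0.
have := absum_norm (absumD (Ag i) IHr); apply: absum_le => x _.
by rewrite big_cons; exact: lexx.
Qed.

Lemma absum_ext T (A : set T) (g h : T -> R) :
  (forall x, A x -> g x = h x) -> absum A g -> absum A h.
Proof. by move=> gh /absum_norm; apply: absum_le => x /gh ->. Qed.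

Lemma has_sum_unique T (A : set T) (g : T -> R) s t :
  has_sum A g s -> has_sum A g t -> s = t.
Proof.
move=> gs gt; apply/eqP; rewrite eq_sym -subr_eq0 -normr_eq0 eq_le normr_ge0 andbT.
apply/ler_addgt0Pr => e e0; rewrite add0r.
have e20 : 0 < e / 2 by rewrite divr_gt0.
have [X XA Xs] := gs _ e20; have [Y YA Yt] := gt _ e20.
have XYA : [set` (X `|` Y)%fset] `<=` A.
  by move=> x /=; rewrite in_fsetU => /orP[/XA|/YA].
have := lerD (Xs _ (fsubsetUl _ _) XYA) (Yt _ (fsubsetUr _ _) XYA).
rewrite -splitr; apply: le_trans.
set u := \sum_(_ <- _) _.
by rewrite [in leRHS]addrC [X in _ <= X + _]distrC ler_distD.
Qed.

Lemma has_sumD T (A : set T) (g h : T -> R) s t :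
  has_sum A g s -> has_sum A h t -> has_sum A (fun x => g x + h x) (s + t).
Proof.
move=> gs ht e e0.
have e20 : 0 < e / 2 by rewrite divr_gt0.
have [X XA Xs] := gs _ e20; have [Y YA Yt] := ht _ e20.
exists (X `|` Y)%fset; first by move=> x /=; rewrite in_fsetU => /orP[/XA|/YA].
move=> Z; rewrite fsubUset => /andP[XZ YZ] ZA.
have := lerD (Xs _ XZ ZA) (Yt _ YZ ZA); rewrite -splitr; apply: le_trans.
by rewrite big_split /= opprD addrACA ler_normD.
Qed.

Lemma has_sumZ T (A : set T) (g : T -> R) s c :
  has_sum A g s -> has_sum A (fun x => c * g x) (c * s).
Proof.
move=> gs e e0.
have e20 : 0 < e / (`|c| + 1) by rewrite divr_gt0// ltr_wpDl.
have [X XA Xs] := gs _ e20; exists X => // Y XY YA.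
rewrite -mulr_sumr -mulrBr normrM; have := Xs _ XY YA.
rewrite ler_pdivlMr ?ltr_wpDl// mulrC; apply: le_trans.
by rewrite ler_wpM2r// lerDl.
Qed.

Lemma has_sum_ext T (A : set T) (g h : T -> R) s :
  (forall x, A x -> g x = h x) -> has_sum A g s -> has_sum A h s.
Proof.
move=> gh gs e e0; have [X XA Xs] := gs _ e0; exists X => // Y XY YA.
have := Xs _ XY YA; rewrite (eq_big_seq h)// => x /YA; exact: gh.
Qed.

Lemma fsum_EFin T (X : {fset T}) (g : T -> R) :
  (\sum_(x \in [set` X]) (g x)%:E)%E = (\sum_(x <- X) g x)%:E.
Proof. by rewrite fsbig_finite//= set_fsetK sumEFin. Qed.

Lemma absum_esum T (A : set T) (g : T -> R) : (forall x, 0 <= g x) ->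
  absum A g -> \esum_(x in A) (g x)%:E \is a fin_num.
Proof.
move=> g0 [S hS]; rewrite ge0_fin_numE; last first.
  by apply: esum_ge0 => x _; rewrite lee_fin.
apply: (@le_lt_trans _ _ S%:E); last by rewrite ltry.
apply: ge_ereal_sup => _ [X [finX XA] <-].
rewrite -(fset_setK finX) fsum_EFin lee_fin.
have := hS (fset_set X); rewrite fset_setK// => /(_ XA); apply: le_trans.
by apply: ler_sum => x _; rewrite ger0_norm.
Qed.

Lemma ge0_has_sum T (A : set T) (g : T -> R) : (forall x, 0 <= g x) ->
  absum A g -> has_sum A g (fine (\esum_(x in A) (g x)%:E)).
Proof.
move=> g0 /(absum_esum g0) Afin e e0.
(* A finite set whose sum is within [e] of the supremum: enlarging it only moves the sum closer. *)
have [_ [X [finX XA] <-]] := ub_ereal_sup_adherent e0 Afin.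
rewrite -(fset_setK finX) fsum_EFin -/(esum _ _) => Xe.
exists (fset_set X); rewrite ?fset_setK// => Y XY YA.
have : ((\sum_(x <- Y) g x)%:E <= \esum_(x in A) (g x)%:E)%E.
  by apply: esum_ge; exists [set` Y]; [split|rewrite fsum_EFin].
have : \sum_(x <- fset_set X) g x <= \sum_(x <- Y) g x.
  rewrite (big_fsetID _ (mem (fset_set X)) Y)/=.
  rewrite (_ : [fset x in Y | x \in fset_set X]%fset = fset_set X); last first.
    apply/fsetP => x; rewrite !inE/=.
    by case: (boolP (x \in fset_set X)) => [/(fsubsetP XY) ->|_]//; rewrite andbF.
  by rewrite lerDl sumr_ge0.
move: Xe; rewrite -(fineK Afin) -EFinB !lte_fin !lee_fin ler_norml.
by move=> ? ? ?; apply/andP; split; lra.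
Qed.

Lemma Rsum_has_sum T (A : set T) (g : T -> R) :
  absum A g -> has_sum A g (Rsum A g).
Proof.
move=> Ag.
have pos := @ge0_has_sum T A g^\+ (funrpos_ge0 g).
have neg := @ge0_has_sum T A g^\- (funrneg_ge0 g).
have Apos : absum A g^\+.
  apply: absum_le (absum_norm Ag) => x _.
  rewrite ger0_norm ?funrpos_ge0// -[leRHS]/((Num.norm \o g) x) /=.
  by rewrite /funrpos ge_max normr_ge0 ler_norm.
have Aneg : absum A g^\-.
  apply: absum_le (absum_norm Ag) => x _.
  by rewrite ger0_norm ?funrneg_ge0// /funrneg ge_max normr_ge0 -normrN ler_norm.
have := has_sumD (pos Apos) (has_sumZ (-1) (neg Aneg)).
rewrite mulN1r; apply: has_sum_ext => x _; rewrite mulN1r.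
by have /(congr1 (@^~ x)) := funrposBneg g.
Qed.

Lemma has_sumE T (A : set T) (g : T -> R) s :
  absum A g -> has_sum A g s -> Rsum A g = s.
Proof. by move=> /Rsum_has_sum; exact: has_sum_unique. Qed.

Lemma RsumD T (A : set T) (g h : T -> R) : absum A g -> absum A h ->
  Rsum A (fun x => g x + h x) = Rsum A g + Rsum A h.
Proof.
by move=> Ag Ah; apply: has_sumE (absumD Ag Ah) _; apply: has_sumD; exact: Rsum_has_sum.
Qed.

Lemma RsumZ T (A : set T) (g : T -> R) c : absum A g ->
  Rsum A (fun x => c * g x) = c * Rsum A g.
Proof.
by move=> Ag; apply: has_sumE (absumZ c Ag) _; apply: has_sumZ; exact: Rsum_has_sum.
Qed.

Lemma eq_Rsum T (A : set T) (g h : T -> R) : (forall x, A x -> g x = h x) ->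
  Rsum A g = Rsum A h.
Proof.
move=> gh; rewrite /Rsum; congr (fine _ - fine _); apply: eq_esum => x Ax;
  by rewrite /funrpos /funrneg gh.
Qed.

Lemma Rsum0 T (A : set T) : Rsum A (fun=> 0) = 0 :> R.
Proof.
rewrite /Rsum !esum1//= ?subrr// => x _.
  by rewrite /funrneg oppr0 maxxx.
by rewrite /funrpos maxxx.
Qed.

Lemma Rsum_big T (A : set T) (I : Type) (r : seq I) (g : I -> T -> R) :
  (forall i, absum A (g i)) ->
  Rsum A (fun x => \sum_(i <- r) g i x) = \sum_(i <- r) Rsum A (g i).
Proof.
move=> Ag; elim: r => [|i r IHr].
  by rewrite big_nil -[RHS](Rsum0 A); apply: eq_Rsum => x _; rewrite big_nil.
rewrite big_cons -IHr -RsumD//; last exact: absum_big.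
by apply: eq_Rsum => x _; rewrite big_cons.
Qed.

Lemma Rsum_supp T (A B : set T) (g : T -> R) : B `<=` A ->
  (forall x, A x -> ~ B x -> g x = 0) -> Rsum A g = Rsum B g.
Proof.
move=> BA g0; rewrite /Rsum; congr (fine _ - fine _);
  rewrite esum_mkcond [RHS]esum_mkcond; apply: eq_esum => x _;
  case: (pselect (B x)) => Bx;
  rewrite ?(mem_set Bx) ?(mem_set (BA _ Bx)) ?(memNset Bx)//;
  case: (pselect (A x)) => Ax; rewrite ?(mem_set Ax) ?(memNset Ax)//.
  by rewrite /funrpos g0// maxxx.
by rewrite /funrneg g0// oppr0 maxxx.
Qed.

Lemma reindex_Rsum T T' (A : set T) (B : set T') (e : T -> T') (g : T' -> R) :
  set_bij A B e -> Rsum B g = Rsum A (fun x => g (e x)).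
Proof. by move=> eAB; rewrite /Rsum !(reindex_esum _ _ _ _ eAB). Qed.

Lemma Rsum_fset T (X : {fset T}) (g : T -> R) :
  Rsum [set` X] g = \sum_(x <- X) g x.
Proof.
apply: has_sumE.
  exists (\sum_(x <- X) `|g x|) => Y YX.
  rewrite (big_fsetID _ (mem Y) X)/=.
  rewrite (_ : [fset x in X | x \in Y]%fset = Y) ?lerDl ?sumr_ge0//.
  apply/fsetP => x; rewrite !inE/=.
  by case: (boolP (x \in Y)) => [/YX /= ->|_]//; rewrite andbF.
move=> e e0; exists X => // Y XY YX.
rewrite (_ : Y = X) ?subrr ?normr0 ?ltW//.
by apply/eqP; rewrite eqEfsubset XY andbT; apply/fsubsetP => x /YX.
Qed.

Lemma cvg_sumr (I : Type) (r : seq I) (P : pred I) (u_ : I -> nat -> R)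
    (l : I -> R) : (forall i, P i -> u_ i m @[m --> \oo] --> l i) ->
  \sum_(i <- r | P i) u_ i m @[m --> \oo] --> \sum_(i <- r | P i) l i.
Proof.
move=> ul; elim: r => [|i r IHr].
  rewrite big_nil (_ : (fun m => _) = cst 0); first exact: cvg_cst.
  by apply/funext => m; rewrite big_nil.
rewrite big_cons (_ : (fun m => _) = fun m =>
  if P i then u_ i m + \sum_(j <- r | P j) u_ j m else \sum_(j <- r | P j) u_ j m).
  by case: ifPn => // Pi; apply: cvgD => //; exact: ul.
by apply/funext => m; rewrite big_cons.
Qed.

(** One finite set outside which [h] has small sum serves all [g_ m] and the limit at once; on that
    set convergence is termwise. *)
Lemma Rsum_cvg T (A : set T) (g_ : nat -> T -> R) (g h : T -> R) :
  (forall m x, A x -> `|g_ m x| <= h x) -> absum A h ->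
  (forall x, A x -> (g_ m x @[m --> \oo] --> g x)) ->
  Rsum A (g_ m) @[m --> \oo] --> Rsum A g.
Proof.
move=> gh Ah gg.
have gh' x : A x -> `|g x| <= h x.
  move=> Ax.
  have cn : (`|g_ m x| @[m --> \oo] --> `|g x|) by apply: cvg_norm; exact: gg.
  rewrite -(cvg_lim _ cn)//; apply: limr_le; first by apply/cvg_ex; exists `|g x|.
  by near=> m; exact: gh.
(* The sum of [h] over the part of [Y] outside [X0] is at most [2 e], since two partial sums of [h]
   lie within [e] of the total; replacing [Rsum A f] by the partial sum over the union costs another
   [e]. *)
have tail (f : T -> R) (e : R) (X0 : {fset T}) : [set` X0] `<=` A ->
    (forall x, A x -> `|f x| <= h x) ->
    (forall X : {fset T}, (X0 `<=` X)%fset -> [set` X] `<=` A ->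
      `|\sum_(x <- X) h x - Rsum A h| <= e) ->
    0 < e -> `|Rsum A f - \sum_(x <- X0) f x| <= 3 * e.
  move=> X0A fh X0e e0.
  have [Y YA Ye] := Rsum_has_sum (absum_le fh Ah) e0.
  have YXA : [set` (Y `|` X0)%fset] `<=` A.
    by move=> x /=; rewrite in_fsetU => /orP[/YA|/X0A].
  have /= := Ye _ (fsubsetUl _ X0) YXA.
  have := X0e _ (fsubsetUr Y X0) YXA; have := X0e _ (fsubset_refl X0) X0A.
  have split_sum (k : T -> R) : \sum_(x <- (Y `|` X0)%fset) k x =
      \sum_(x <- X0) k x + \sum_(x <- (Y `\` X0)%fset) k x.
    rewrite (big_fsetID _ (mem X0))/=; congr (_ + _); apply: eq_fbigl => x.
      by rewrite !inE/=; case: (x \in X0); rewrite ?orbT ?andbF.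
    by rewrite !inE/=; case: (x \in X0); rewrite ?orbT ?andbF ?andbT ?orbF.
  rewrite !split_sum.
  have : `|\sum_(x <- (Y `\` X0)%fset) f x| <= \sum_(x <- (Y `\` X0)%fset) h x.
    apply: le_trans (ler_norm_sum _ _ _) _; rewrite big_seq [leRHS]big_seq.
    by apply: ler_sum => x; rewrite in_fsetD => /andP[_ /YA]/fh.
  rewrite !ler_norml => /andP[? ?] /andP[? ?] /andP[? ?] /andP[? ?].
  by apply/andP; split; lra.
apply/cvgrPdist_le => e e0.
(* Two tails cost three parts each, the finite sums one part. *)
have e7 : 0 < e / 7 by rewrite divr_gt0.
have [X0 X0A X0e] := Rsum_has_sum Ah e7.
have X0cvg : \sum_(x <- X0) g_ m x @[m --> \oo] --> \sum_(x <- X0) g x.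
  rewrite (_ : (fun m => _) = (fun m => \sum_(x <- X0 | x \in X0) g_ m x)); last first.
    by apply/funext => m; rewrite -big_seq.
  by rewrite big_seq; apply: cvg_sumr => x /X0A /gg.
have /cvgrPdist_le /(_ _ e7) := X0cvg; apply: filterS => m.
have := tail (g_ m) _ _ X0A (gh m) X0e e7.
have := tail g _ _ X0A gh' X0e e7.
rewrite !ler_norml => /andP[? ?] /andP[? ?] /andP[? ?].
by apply/andP; split; lra.
Unshelve. all: end_near. Qed.

End sums.

(** * Lattices and dual lattices *)

Section int_lattice.
Context {R : realType} (n : nat).
Implicit Types (x y z : 'rV[R]_n) (A B C : 'M[R]_n).

Lemma dotpE x y : dotp x y = (x *m y^T) 0 0.
Proof. by rewrite /dotp mxE; apply: eq_bigr => i _; rewrite mxE. Qed.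

Lemma dotpC x y : dotp x y = dotp y x.
Proof. by apply: eq_bigr => i _; rewrite mulrC. Qed.

Lemma dotpDl x y z : dotp (x + y) z = dotp x z + dotp y z.
Proof. by rewrite !dotpE mulmxDl mxE. Qed.

Lemma dotpNl x y : dotp (- x) y = - dotp x y.
Proof. by rewrite !dotpE mulNmx mxE. Qed.

Lemma dotpBl x y z : dotp (x - y) z = dotp x z - dotp y z.
Proof. by rewrite dotpDl dotpNl. Qed.

Lemma dotpDr x y z : dotp z (x + y) = dotp z x + dotp z y.
Proof. by rewrite dotpC dotpDl !(dotpC z). Qed.

Lemma dotpNr x y : dotp x (- y) = - dotp x y.
Proof. by rewrite dotpC dotpNl dotpC. Qed.

Lemma dotpBr x y z : dotp z (x - y) = dotp z x - dotp z y.
Proof. by rewrite dotpDr dotpNr. Qed.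

Lemma dotp0l x : dotp 0 x = 0.
Proof. by rewrite dotpE mul0mx mxE. Qed.

Lemma dotp0r x : dotp x 0 = 0.
Proof. by rewrite dotpC dotp0l. Qed.

(* The lattice spanned by the rows of [C^-1], described by coordinates. *)
Definition zlat C : set 'rV[R]_n :=
  [set x | forall i, (x *m C) 0 i \is a Num.int].

Lemma zlat0 C : zlat C 0.
Proof. by move=> i; rewrite mul0mx mxE. Qed.

Lemma zlatB C x y : zlat C x -> zlat C y -> zlat C (x - y).
Proof.
move=> Cx Cy i; rewrite mulmxBl mxE [X in _ + X]mxE.
by rewrite rpredB.
Qed.

Lemma zlatN C x : zlat C x -> zlat C (- x).
Proof. by move=> Cx; rewrite -sub0r; apply: zlatB => //; exact: zlat0. Qed.

Lemma dotp_coord C x y : C \in unitmx ->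
  dotp x y = dotp (x *m C) (y *m (invmx C)^T).
Proof.
move=> CU; rewrite !dotpE trmx_mul trmxK mulmxA -(mulmxA x) mulmxV//.
by rewrite mulmx1.
Qed.

(** [x *m C] and [y *m (invmx C)^T] are coordinates in dual bases; pairing [y] with the basis vector
    [delta_mx 0 i *m invmx C] reads off its [i]-th coordinate. *)
Lemma dual_zlat C : C \in unitmx -> dual (zlat C) = zlat (invmx C)^T.
Proof.
move=> CU; apply/seteqP; split=> [y yd i|y yC x xC].
  have := yd (delta_mx 0 i *m invmx C).
  rewrite (dotp_coord _ _ CU) mulmxKV// /dotp (bigD1 i)//= big1; last first.
    by move=> j ji; rewrite mxE/= (negPf ji) mul0r.
  rewrite addr0 mxE !eqxx mul1r; apply => j; rewrite mulmxKV// mxE.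
  by rewrite rpred_nat.
rewrite (dotp_coord _ _ CU) /dotp rpred_sum// => i _.
by apply: rpredM; [exact: xC|exact: yC].
Qed.

Lemma unitmx_invT C : C \in unitmx -> (invmx C)^T \in unitmx.
Proof. by move=> CU; rewrite unitmx_tr unitmx_inv. Qed.

Lemma dualK C : C \in unitmx -> dual (dual (zlat C)) = zlat C.
Proof.
move=> CU; rewrite dual_zlat// dual_zlat ?unitmx_invT//.
by rewrite -[in invmx _]trmx_inv invmxK trmxK.
Qed.

Lemma det_int A : (forall i j, A i j \is a Num.int) -> \det A \is a Num.int.
Proof.
move=> Ai; rewrite rpred_sum// => s _.
by rewrite rpredM ?rpredX ?rpredN ?rpred1// rpred_prod.
Qed.

Lemma lattice_inP (L : lattice R n) x :
  reflect (lattice_set L x) (x \in lattice_pred L).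
Proof. exact: asboolP. Qed.

Lemma latticeMz (L : lattice R n) x (k : int) :
  lattice_set L x -> lattice_set L (k%:~R *: x).
Proof.
by move=> /lattice_inP Lx; apply/lattice_inP; rewrite scaler_int rpredMz.
Qed.

Lemma lattice_comb (L : lattice R n) A z : (forall i, lattice_set L (row i A)) ->
  (forall i, z 0 i \is a Num.int) -> lattice_set L (z *m A).
Proof.
move=> LA zi; apply/lattice_inP; rewrite mulmx_sum_row rpred_sum// => i _.
by apply/lattice_inP; have /intrP[k ->] := zi i; exact: latticeMz.
Qed.

Lemma lattice_sep (L : lattice R n) : exists2 e : R, 0 < e &
  forall x, lattice_set L x -> (forall i, `|x 0 i| < e) -> x = 0.
Proof.
have [_ [V /nbhs_ballP[e /= e0 eV] VL]] := lattice_discrete (lattice0 L).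
exists e => // x Lx xe; have : (V `&` L) x.
  split=> //; apply: eV; split=> // i j.
  by rewrite (ord1 i) /ball/= mxE sub0r normrN.
by rewrite VL => ->.
Qed.

(** The cofactors along row [i] do not involve that row, so they are those of the identity matrix,
    read off from its adjugate. *)
Lemma det_set_row (i : 'I_n) (u : 'rV[R]_n) A :
  (forall j, j != i -> row j A = row j 1%:M) -> row i A = u -> \det A = u 0 i.
Proof.
move=> Aj Ai; have neqlift k : lift i k != i by rewrite eq_sym neq_lift.
rewrite (expand_det_row A i) (bigD1 i)//= big1 => [|j ji].
  rewrite addr0 -Ai mxE (_ : cofactor A i i = cofactor 1%:M i i).
    have := mul_mx_adj (1%:M : 'M[R]_n); rewrite mul1mx det1 => /matrixP/(_ i i).
    by rewrite !mxE eqxx => ->; rewrite mulr1.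
  rewrite /cofactor; congr (_ * \det _); apply/matrixP => k l.
  have /rowP/(_ (lift i l)) := Aj (lift i k) (neqlift k).
  by rewrite !mxE.
suff -> : cofactor A i j = 0 by rewrite mulr0.
rewrite (_ : cofactor A i j = cofactor 1%:M i j).
  have := mul_mx_adj (1%:M : 'M[R]_n); rewrite mul1mx det1 => /matrixP/(_ j i).
  by rewrite !mxE (negPf ji).
rewrite /cofactor; congr (_ * \det _); apply/matrixP => k l.
have /rowP/(_ (lift j l)) := Aj (lift i k) (neqlift k).
by rewrite !mxE.
Qed.

(* Dirichlet's pigeonhole argument: among the fractional parts of the first
   [m^n + 1] multiples of [x], two are so close that the corresponding lattice
   vector vanishes by discreteness. *)
Lemma lattice_denominator (L : lattice R n) B : B \in unitmx ->
  (forall i, lattice_set L (row i B)) ->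
  exists2 d : nat, (0 < d)%N & forall x, lattice_set L x ->
    forall i, d%:R * (x *m invmx B) 0 i \is a Num.int.
Proof.
move=> BU LB; have [e e0 Le] := lattice_sep L.
(* Coordinates of size at most [1 / m] give a vector with entries at most [K / m], which is below
   [e] for the [m] chosen later; the summand 1 keeps [K] positive. *)
pose K : R := \sum_i \sum_j `|B i j| + 1.
have K0 : 0 < K by rewrite ltr_wpDl// sumr_ge0// => i _; rewrite sumr_ge0.
have small (t : 'rV[R]_n) (m : nat) : K / e < m%:R ->
    (forall i, `|t 0 i| <= m%:R^-1) -> forall j, `|(t *m B) 0 j| < e.
  move=> Km tm j; have m0 : 0 < m%:R :> R by apply: lt_trans Km; rewrite divr_gt0.
  apply: (@lt_trans _ _ (m%:R^-1 * K)); last first.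
    by rewrite mulrC ltr_pdivrMr// mulrC -ltr_pdivrMr.
  rewrite mxE; apply: le_lt_trans (ler_norm_sum _ _ _) _.
  apply: (@le_lt_trans _ _ (\sum_i m%:R^-1 * `|B i j|)).
    by apply: ler_sum => i _; rewrite normrM ler_wpM2r.
  rewrite -mulr_sumr ltr_pM2l ?invr_gt0// /K ltr_pwDr//.
  by apply: ler_sum => i _; rewrite (bigD1 j)//= lerDl sumr_ge0.
pose m := (Num.truncn (K / e)).+1.
have Km : K / e < m%:R by rewrite truncnS_gt.
have m0 : 0 < m%:R :> R by rewrite ltr0n.
(* The multiplier [k - k'] found below depends on [x], but it lies between 1 and [m ^ n], so the
   factorial is a multiple of it for every [x]. *)
exists (m ^ n)`!; first exact: fact_gt0.
move=> x Lx i0; pose c i := (x *m invmx B) 0 i.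
pose fr (t : R) := t - (Num.floor t)%:~R.
have fr0 t : 0 <= fr t by rewrite subr_ge0 floor_le.
have fr1 t : fr t < 1.
  by rewrite ltrBlDl; have /andP[_] := floor_itv t; rewrite intrD.
have trm t : (Num.truncn (m%:R * fr t) < m)%N.
  rewrite truncn_lt_nat; last by rewrite mulr_ge0// ltW.
  by rewrite -[ltRHS]mulr1 ltr_pM2l.
pose f (k : 'I_(m ^ n).+1) : {ffun 'I_n -> 'I_m} :=
  [ffun i => Ordinal (trm (k%:R * c i))].
have /injectivePn[k [k' kk' fkk']] : ~~ injectiveb f.
  apply/negP => /injectiveP /leq_card; rewrite card_ord card_ffun !card_ord.
  by rewrite ltnn.
wlog lekk' : k k' kk' fkk' / (k' < k)%N.
  move=> wl; have [kltk'|//|kk] := ltngtP k k'.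
  - by apply: (wl k' k) => //; rewrite eq_sym.
  - by apply: (wl k k').
  - by move/val_inj : kk kk' => ->; rewrite eqxx.
pose u : 'rV[R]_n := \row_i ((Num.floor (k%:R * c i))%:~R -
  (Num.floor (k'%:R * c i))%:~R).
(* Removing the integer parts leaves a vector of [L] whose coordinates are differences of fractional
   parts in the same box, hence at most [1 / m]. *)
pose y := x *+ (k - k') - u *m B.
have Ly : lattice_set L y.
  apply: latticeB; last first.
    by apply: lattice_comb => // i; rewrite mxE rpredB ?intr_int.
  by move: Lx => /lattice_inP Lx; apply/lattice_inP; rewrite rpredMn.
pose t : 'rV[R]_n := \row_i (fr (k%:R * c i) - fr (k'%:R * c i)).
have yE : y = t *m B.
  rewrite /y -[x](mulmxKV BU) -scaler_nat scalemxAl -mulmxBl; congr (_ *m _).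
  apply/rowP => i; rewrite !mxE /fr natrB 1?ltnW//.
  have <- : c i = \sum_j x 0 j * invmx B j i by rewrite /c mxE.
  by rewrite mulrBl; lra.
have y0 : y = 0.
  apply: Le => //; rewrite yE; apply: small Km _ => i; rewrite mxE.
  have /ffunP/(_ i) := fkk'; rewrite !ffunE => /(congr1 val)/= ff.
  have trP s : (Num.truncn (m%:R * fr s))%:R <= m%:R * fr s <
      (Num.truncn (m%:R * fr s))%:R + 1.
    by rewrite natr1; apply: truncn_itv; rewrite mulr_ge0// ltW.
  rewrite -[leRHS]mul1r ler_pdivlMr// mulrC -{1}(gtr0_norm m0) -normrM mulrBr.
  have := trP (k%:R * c i); have := trP (k'%:R * c i); rewrite ff ler_norml.
  move: (m%:R * _) (m%:R * _) (Num.truncn _)%:R => p q r.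
  by move=> /andP[? ?] /andP[? ?]; apply/andP; split; lra.
have : (k - k')%:R * c i0 \is a Num.int.
  have : t = 0 by rewrite -(mulmxK BU t) -yE y0 mul0mx.
  move=> /rowP/(_ i0); rewrite !mxE /fr => /eqP; rewrite subr_eq0 => /eqP frE.
  rewrite natrB 1?ltnW// mulrBl.
  rewrite (_ : _ - _ = (Num.floor (k%:R * c i0))%:~R -
    (Num.floor (k'%:R * c i0))%:~R); last by lra.
  by rewrite rpredB ?intr_int.
have /dvdnP[q ->] : (k - k' %| (m ^ n)`!)%N.
  rewrite dvdn_fact// subn_gt0 lekk'/= leq_subLR.
  by rewrite (leq_trans (ltn_ord k : k <= _)%N)// leq_addl.
by rewrite natrM -mulrA => h; rewrite rpredM// rpred_nat.
Qed.

(* Among all full-rank families of [n] vectors of [L], one of minimal determinant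
   is a basis; the minimum exists since the determinants have bounded
   denominators. *)
Lemma lattice_basis (L : lattice R n) :
  exists2 C, C \in unitmx & lattice_set L = zlat C.
Proof.
have [B [Bfree LB]] := lattice_full_rank L.
have BU : B \in unitmx by rewrite -row_free_unit.
have [d d0 Ld] := lattice_denominator BU LB.
(* The determinant relative to [B], scaled to be an integer on families of vectors of [L]. *)
pose D A := d%:R ^+ n * \det (A *m invmx B) : R.
have Dint A : (forall i, lattice_set L (row i A)) -> D A \is a Num.int.
  move=> LA; rewrite /D -detZ; apply: det_int => i j.
  by have := Ld _ (LA i) j; rewrite -row_mul !mxE.
pose P (k : nat) := `[< (0 < k)%N /\ exists2 A, (forall i, lattice_set L (row i A)) &
  `|D A| = k%:R >].
have exP : exists k, P k.
  exists (d ^ n)%N; apply/asboolP; split; first by rewrite expn_gt0 d0.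
  by exists B => //; rewrite /D mulmxV// det1 mulr1 natrX ger0_norm// exprn_ge0.
have [k /asboolP[k0 [A LA DA]] kmin] := ex_minnP exP.
have D0 : D A != 0 by rewrite -normr_gt0 DA ltr0n.
have AU : A \in unitmx.
  by move: D0; rewrite /D det_mulmx !mulf_eq0 !negb_or unitmxE unitfE => /and3P[].
exists (invmx A); first by rewrite unitmx_inv.
apply/seteqP; split=> [x Lx i|z zi]; last first.
  by rewrite -(mulmxKV AU z); apply: lattice_comb.
(* If the coordinate [s] is not an integer, replacing row [i] of [A] by [x'] multiplies [D] by the
   fractional part of [s], against minimality. *)
apply/negP => /negP xi; pose s := (x *m invmx A) 0 i.
pose x' := x - (Num.floor s)%:~R *: row i A.
pose E : 'M[R]_n := \matrix_(j, l) (if j == i then x' *m invmx A else row j 1%:M) 0 l.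
have Erow j : row j E = if j == i then x' *m invmx A else row j 1%:M.
  by apply/rowP => l; rewrite !mxE.
have LE j : lattice_set L (row j (E *m A)).
  rewrite row_mul Erow; case: ifP => _; last by rewrite -row_mul mul1mx.
  rewrite mulmxKV//; apply: latticeB => //.
  exact: latticeMz.
have detE : \det E = s - (Num.floor s)%:~R.
  rewrite (@det_set_row i (x' *m invmx A)); first last.
  - by rewrite Erow eqxx.
  - by move=> j ji; rewrite Erow (negPf ji).
  rewrite /x' mulmxBl -scalemxAl -row_mul mulmxV//.
  by rewrite !mxE eqxx mulr1; congr (_ - _); rewrite /s mxE.
have fr0 : 0 < \det E.
  rewrite detE subr_gt0 lt_neqAle floor_le andbT.
  by apply: contra xi => /eqP sE; rewrite -/s -sE.
have fr1 : \det E < 1.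
  by rewrite detE ltrBlDl; have /andP[_] := floor_itv s; rewrite intrD.
have DE : D (E *m A) = \det E * D A.
  by rewrite /D -mulmxA det_mulmx mulrCA.
have /intrP[q qE] := Dint _ LE.
have : P `|q|%N.
  apply/asboolP; split.
    rewrite absz_gt0; apply/eqP => q0; move: qE; rewrite q0 DE => /eqP.
    by rewrite mulf_eq0 (negPf D0) gt_eqF.
  by exists (E *m A) => //; rewrite qE -intr_norm natr_absz.
move=> /kmin; rewrite -(ler_nat R) natr_absz intr_norm -qE DE normrM DA.
by rewrite gtr0_norm// -subr_ge0 -{2}(mul1r k%:R) -mulrBl pmulr_lge0 ?ltr0n// subr_ge0 leNgt fr1.
Qed.

End int_lattice.

(** * The character [e2pi] of the real line, with kernel the integers *)

Section e2pi.
Context {R : realType}.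
Implicit Types t s : R.

Lemma e2piD t s : e2pi (t + s) = e2pi t * e2pi s.
Proof.
rewrite /e2pi mulrDr cosD sinD; apply/eqP; rewrite eq_complex /=.
by rewrite eqxx/= addrC mulrC [X in _ + X]mulrC addrC !(mulrC (sin _)) eqxx.
Qed.

Lemma e2pi0 : e2pi (0 : R) = 1.
Proof. by rewrite /e2pi mulr0 cos0 sin0. Qed.

Lemma e2piN t : e2pi (- t) = (e2pi t)^*.
Proof. by rewrite /e2pi mulrN cosN sinN. Qed.

Lemma e2pi_nat (k : nat) : e2pi (k%:R : R) = 1.
Proof.
elim: k => [|k IHk]; first exact: e2pi0.
by rewrite -natr1 e2piD IHk mul1r /e2pi mulr1 mulrC mulr_natr cos2pi sin2pi.
Qed.

Lemma e2pi_int t : t \is a Num.int -> e2pi t = 1.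
Proof.
move=> /intrP[k ->]; case: k => k; first exact: e2pi_nat.
by rewrite NegzE mulrNz e2piN e2pi_nat rmorph1.
Qed.

(** For the fractional part [r], [cos (2 pi r) = 1 - 2 sin (pi r)^2], and the sine is positive on
    ]0, pi[. *)
Lemma e2pi_eq1 t : e2pi t = 1 -> t \is a Num.int.
Proof.
move=> t1; pose r := t - (Num.floor t)%:~R.
have r1 : e2pi r = 1.
  rewrite e2piD t1 mul1r e2piN e2pi_int ?rmorph1//.
have r0 : 0 <= r by rewrite subr_ge0 floor_le.
have rlt1 : r < 1.
  by rewrite ltrBlDl; have /andP[_] := floor_itv t; rewrite intrD.
suff : r = 0 by move/eqP; rewrite subr_eq0 => /eqP ->.
apply/eqP; rewrite eq_le r0 andbT leNgt; apply/negP => r_gt0.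
have : cos (2 * pi * r) = 1 by move: r1 => /(congr1 (@complex.Re R)).
rewrite (_ : 2 * pi * r = (pi * r) *+ 2); last by rewrite mulr2n; lra.
rewrite cos_mulr2n cos2sin2 => sin0.
have : 0 < sin (pi * r).
  apply: sin_gt0_pi; apply/andP; split; first by rewrite mulr_gt0// pi_gt0.
  by rewrite -[ltRHS]mulr1 ltr_pM2l// pi_gt0.
move=> s0; have : 0 < sin (pi * r) ^+ 2 by rewrite exprn_gt0.
by move: sin0; rewrite mulr2n; lra.
Qed.

Lemma normc_e2pi t : `|e2pi t| = 1.
Proof. by rewrite normc_def /= cos2Dsin2 sqrtr1. Qed.

Lemma e2pi_surj (z : R[i]) : `|z| = 1 -> exists t, z = e2pi t.
Proof.
case: z => a b; rewrite normc_def => /(congr1 (@complex.Re R))/= ab1.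
have ab : a ^+ 2 + b ^+ 2 = 1.
  by rewrite -[LHS]sqr_sqrtr ?addr_ge0 ?sqr_ge0// ab1 expr1n.
have a1 : -1 <= a <= 1.
  rewrite -ler_norml -(expr_le1 (n := 2))// -normrX ger0_norm ?sqr_ge0//.
  by rewrite -ab lerDl sqr_ge0.
pose u := acos a / (2 * pi).
have pi0 : pi != 0 :> R by rewrite gt_eqF// pi_gt0.
have uE : 2 * pi * u = acos a.
  by rewrite /u mulrC divfK// mulf_neq0// pnatr_eq0.
have sq : sin (acos a) ^+ 2 = b ^+ 2.
  by rewrite sin2cos2 acosK ?in_itv//=; lra.
have : (sin (acos a) == b) || (sin (acos a) == - b) by rewrite -eqf_sqr sq.
move=> /orP[] /eqP sE.
  by exists u; rewrite /e2pi uE acosK ?in_itv//= sE.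
by exists (- u); rewrite /e2pi mulrN uE cosN sinN acosK ?in_itv//= sE opprK.
Qed.

End e2pi.

(** * Translation invariance and fundamental domains *)

Section measure_rV.
Context {R : realType} (n : nat).
Implicit Types (x p : 'rV[R]_n) (A : set 'rV[R]_n).
Notation mu := (@lebesgue_rV R n).

Lemma measurable_box (A : 'I_n -> set (measurableTypeR R)) :
  (forall i, measurable (A i)) ->
  measurable [set x : 'rV[R]_n | forall i, A i (x 0 i)].
Proof.
move=> mA; rewrite (_ : mkset _ =
  \bigcap_(i in [set: 'I_n]) (fun x : 'rV[R]_n => x 0 i) @^-1` A i).
  apply: fin_bigcap_measurable => // i _.
  by rewrite -[X in measurable X]setTI; exact: measurable_coor.
by apply/seteqP; split => [x Ax i _|x Ax i]; exact: Ax.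
Qed.

(** The measurable structure is generated by coordinates and not by the topology; the link is that
    an open set is a countable union of cubes with rational centers and radii [1 / k.+1]. *)
Lemma open_measurable_rV (U : set 'rV[R]_n) : open U -> measurable U.
Proof.
move=> oU.
pose B (c : 'rV[rat]_n * nat) := [set x : 'rV[R]_n | forall i,
  `](ratr (c.1 0 i) - c.2.+1%:R^-1), (ratr (c.1 0 i) + c.2.+1%:R^-1)[%classic (x 0 i)].
have mB c : measurable (B c).
  by apply: (@measurable_box (fun i => `]_, _[%classic)) => i; exact: measurable_itv.
pose F c := if `[< B c `<=` U >] then B c else set0.
suff -> : U = \bigcup_c F c.
  apply: countable_bigcupT_measurable => // c; rewrite /F.
  by case: ifP => // _; exact: measurable0.
apply/seteqP; split=> [x Ux|x [c _]]; last by rewrite /F; case: asboolP => // BU /BU.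
have /nbhs_ballP[e /= e0 eU] : nbhs x U by move: oU; rewrite openE => /(_ x Ux).
pose k := Num.truncn (2 / e).
have k0 : 0 < k.+1%:R^-1 :> R by rewrite invr_gt0.
have ke : k.+1%:R^-1 * 2 < e.
  by rewrite mulrC ltr_pdivrMr// mulrC -ltr_pdivrMr//; exact: truncnS_gt.
have qP (a : R) : exists q : rat, ratr q \in `]a - k.+1%:R^-1, a + k.+1%:R^-1[.
  have : a - k.+1%:R^-1 < a + k.+1%:R^-1 by rewrite ltrBlDr -addrA ltrDl addr_gt0.
  by move=> /rat_in_itvoo[q qx]; exists q.
pose q : 'rV[rat]_n := \row_i xchoose (qP (x 0 i)).
have qx i : ratr (q 0 i) \in `]x 0 i - k.+1%:R^-1, x 0 i + k.+1%:R^-1[.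
  by rewrite mxE; exact: xchooseP (qP (x 0 i)).
exists (q, k) => //; rewrite /F asboolT.
  move=> i /=; have := qx i; rewrite !in_itv/=.
  by move: (k.+1%:R^-1) (x 0 i) => d a /andP[? ?]; apply/andP; split; lra.
move=> y By; apply: eU; split=> // i j; rewrite (ord1 i) /ball/=.
have := By j; rewrite /= in_itv/=.
have := qx j; rewrite in_itv/= ltr_norml.
move: (k.+1%:R^-1) (x 0 j) (y 0 j) ke => d a b ke /andP[? ?] /andP[? ?].
by apply/andP; split; lra.
Qed.

Lemma continuous_measurable_rV (f : 'rV[R]_n -> R) :
  (forall x, {for x, continuous f}) ->
  measurable_fun setT (f : 'rV[R]_n -> measurableTypeR R).
Proof.
move=> cf; apply: (measurability _ (RGenOInfty.measurableE R)).
move=> _ [_ [a ->] <-]; rewrite setTI; apply: open_measurable_rV.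
by apply: open_comp => // x _; exact: cf.
Qed.

Lemma measurable_coordC (C : 'M[R]_n) i :
  measurable_fun setT (fun x => (x *m C) 0 i : measurableTypeR R).
Proof.
rewrite (_ : (fun x => _) = fun x => \sum_j x 0 j * C j i); last first.
  by apply/funext => x; rewrite mxE.
apply: measurable_sum => j; apply: measurable_funM => //.
exact: measurable_coor.
Qed.

Lemma measurable_shift p : measurable_fun setT (fun x => x + p).
Proof.
apply: measurable_rVP => i.
rewrite (_ : (fun x => _) = fun x => x 0 i + p 0 i); last first.
  by apply/funext => x; rewrite mxE.
apply: measurable_funD => //; exact: measurable_coor.
Qed.

End measure_rV.

Lemma lebesgue_measure_shift {R : realType} (t : R) (A : set (measurableTypeR R)) :
  measurable A ->
  lebesgue_measure ((fun x : measurableTypeR R => x + t) @^-1` A) = lebesgue_measure A.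
Proof.
move=> mA.
have mt : measurable_fun setT (fun x : measurableTypeR R => (x + t : measurableTypeR R)).
  exact: measurable_funD.
rewrite -[LHS]/(pushforward lebesgue_measure _ A).
apply/esym/lebesgue_measure_unique => //= _ [[a b]] _ <-.
rewrite /pushforward (_ : _ @^-1` _ = `]a - t, b - t]%classic); last first.
  by apply/seteqP; split => x /=; rewrite !in_itv/= ltrBlDr lerBrDr.
by rewrite !lebesgue_measure_itv/= !lte_fin ltrD2r; case: ifP => // _; congr EFin; lra.
Qed.

(** By induction on the dimension: translation commutes with [cons_rV], and uniqueness of product
    measures leaves only rectangles to check. *)
Lemma lebesgue_rV_shift {R : realType} n (p : 'rV[R]_n) (A : set 'rV[R]_n) :
  measurable A -> lebesgue_rV n ((fun x => x + p) @^-1` A) = lebesgue_rV n A.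
Proof.
elim: n p A => [|n IHn] p A mA.
  rewrite (_ : (fun x => _) = id) ?preimage_id//.
  by apply/funext => x; apply/rowP => -[].
rewrite /= /prod_rV /pushforward.
pose q : 'rV[R]_n := \row_j p 0 (lift ord0 j).
pose p0 : R := p 0 0.
pose tau (c : measurableTypeR R * 'rV[R]_n) : measurableTypeR R * 'rV[R]_n :=
  (c.1 + p0, c.2 + q).
have mtau : measurable_fun setT tau.
  apply: measurable_fun_pair.
    by apply: measurable_funD => //; exact: measurable_fst.
  by apply: (measurableT_comp (measurable_shift q)); exact: measurable_snd.
have cE : (fun x => x + p) \o @cons_rV R n = @cons_rV R n \o tau.
  apply/funext => -[t x]; apply/rowP => i; rewrite /= mxE.
  case: (unliftP ord0 i) => [j|] ->; rewrite ?cons_rV0 ?cons_rVS//.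
  by rewrite !mxE.
have mcA : measurable (@cons_rV R n @^-1` A).
  by rewrite -[X in measurable X]setTI; exact: measurable_cons_rV.
rewrite -comp_preimage cE comp_preimage.
rewrite -[LHS]/(pushforward (lebesgue_measure \x lebesgue_rV n)%E tau _).
apply/esym; apply: product_measure_unique => // B D mB mD.
transitivity (lebesgue_measure ((fun x : measurableTypeR R => x + p0)%R @^-1` B) *
    lebesgue_rV n ((fun x => x + q)%R @^-1` D))%E.
  rewrite -product_measure1E//.
  - by rewrite -[X in measurable X]setTI; apply: measurable_funD.
  - by rewrite -[X in measurable X]setTI; exact: measurable_shift.
by congr (_ * _)%E; [exact: lebesgue_measure_shift|exact: IHn].
Qed.

(** * Integrals cut along a tiling by translates *)

Section tiling.
Context {R : realType} (n : nat).
Implicit Types (x p : 'rV[R]_n) (F L : set 'rV[R]_n).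
Notation mu := (@lebesgue_rV R n).
Local Open Scope ereal_scope.

Lemma ge0_integral_shift p (f : 'rV[R]_n -> \bar R) :
  measurable_fun setT f -> (forall x, 0 <= f x) ->
  \int[mu]_x f (x + p)%R = \int[mu]_x f x.
Proof.
move=> mf f0; have mp := measurable_shift p.
rewrite -(@ge0_integral_pushforward _ _ _ _ _ _ mp mu setT f)//.
by apply: eq_measure_integral => A mA _; exact: lebesgue_rV_shift.
Qed.

(** [fundamental_domain] for a bare set [L], so that it applies to [zlat C]. *)
Definition tiles F L : Prop :=
  measurable F /\ forall x, exists! y, F y /\ L (x - y)%R.

Lemma ge0_integral_tiling F L (f : 'rV[R]_n -> \bar R) :
  countable L -> tiles F L ->
  measurable_fun setT f -> (forall x, 0 <= f x) ->
  \int[mu]_x f x = \esum_(p in L) \int[mu]_(x in F) f (x + p)%R.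
Proof.
move=> /countable_injP[c cinj] [mF FL] mf f0.
(* The tiles are numbered through the injection [c] to get a disjoint sequence; numbers that [c]
   does not reach on [L] give empty pieces. *)
pose T k := [set x | exists2 p, L p /\ c p = k & F (x - p)%R].
have TE p : L p -> T (c p) = [set x | F (x - p)%R].
  move=> Lp; apply/seteqP; split=> [x [q [Lq]] | x Fx]; last by exists p.
  by move=> qp; rewrite (cinj _ _ (mem_set Lq) (mem_set Lp) qp).
have mT k : measurable (T k).
  have [[p [Lp <-]]|noP] := pselect (exists p, L p /\ c p = k).
    rewrite TE// -[X in measurable X]setTI; exact: (measurable_shift (- p)%R).
  rewrite (_ : T k = set0)//; apply/seteqP; split=> // x [p pk _].
  by apply: noP; exists p.
have UT : \bigcup_k T k = setT.
  apply/seteqP; split=> // x _; have [y [[Fy Ly] _]] := FL x.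
  by exists (c (x - y)%R) => //; exists (x - y)%R => //; rewrite subKr.
have tT : trivIset setT T.
  move=> i j _ _ [x [[p [Lp <-] Fp] [q [Lq <-] Fq]]]; congr c.
  have [y [_ yU]] := FL x.
  have yp : y = (x - p)%R by apply: yU; rewrite subKr.
  have yq : y = (x - q)%R by apply: yU; rewrite subKr.
  by apply/eqP; rewrite -subr_eq0 -(subKr x p) -yp yq subKr subrr.
rewrite -UT ge0_integral_bigcup//; last by rewrite UT.
rewrite nneseries_esumT; last by move=> k; exact: integral_ge0.
transitivity (\esum_(k in c @` L) \int[mu]_(x in T k) f x).
  rewrite [LHS]esum_mkcond [RHS]esum_mkcond; apply: eq_esum => k _.
  rewrite mem_setT//; case: ifPn => //; rewrite notin_setE => ck.
  rewrite (_ : T k = set0) ?integral_set0//; apply/seteqP; split=> // x [p [Lp pk] _].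
  by apply: ck; exists p.
rewrite (reindex_esum L _ c) //; last first.
  split; [by move=> p Lp; exists p|exact: cinj|by move=> _ [p Lp <-]; exists p].
apply: eq_esum => p Lp; rewrite TE// integral_mkcond [RHS]integral_mkcond.
rewrite -(ge0_integral_shift p).
- apply: eq_integral => x _; rewrite !patchE.
  rewrite (_ : ((x + p)%R \in _) = (x \in F))//.
  by apply/idP/idP => /set_mem /= h; apply/mem_set; move: h; rewrite /= addrK.
- apply/(measurable_restrictT _ _).1.
    by rewrite -[X in measurable X]setTI; exact: (measurable_shift (- p)%R).
  exact: measurable_funTS.
- by move=> x; rewrite patchE; case: ifP.
Qed.

(** Cut each domain by the translates of the other and move the pieces back by periodicity: the two
    sums have the same terms after exchanging [p] and [- p]. The constant 1 gives equality of
    measures; other [h] make it possible to integrate characters by translating the domain. *)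
Lemma ge0_integral_tiles F F' L (h : 'rV[R]_n -> \bar R) :
  countable L -> (forall p, L p -> L (- p)%R) -> tiles F L -> tiles F' L ->
  measurable_fun setT h -> (forall x, 0 <= h x) ->
  (forall p x, L p -> h (x + p)%R = h x) ->
  \int[mu]_(x in F) h x = \int[mu]_(x in F') h x.
Proof.
move=> cL LN FL F'L mh h0 hL; have [mF _] := FL; have [mF' _] := F'L.
have mhF G : measurable G -> measurable_fun setT (h \_ G).
  by move=> mG; apply/(measurable_restrictT _ _).1 => //; exact: measurable_funTS.
have hF0 G x : 0 <= (h \_ G) x by rewrite patchE; case: ifP.
rewrite integral_mkcond (ge0_integral_tiling cL F'L)//; last exact: mhF.
rewrite [RHS]integral_mkcond (ge0_integral_tiling cL FL)//; last exact: mhF.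
rewrite (reindex_esum L L -%R).
  apply: eq_esum => p Lp; rewrite integral_mkcond [RHS]integral_mkcond.
  rewrite -(ge0_integral_shift p).
  - apply: eq_integral => x _; rewrite !patchE addrK.
    by case: ifP; case: ifP => //; rewrite hL.
  - apply/(measurable_restrictT _ _).1 => //; apply: measurable_funTS.
    by apply: measurableT_comp (measurable_shift _); exact: mhF.
  - by move=> x; rewrite patchE; case: ifP.
split; first by move=> p; exact: LN.
- by move=> p q _ _ /oppr_inj.
- by move=> p Lp; exists (- p)%R; [exact: LN|rewrite opprK].
Qed.

End tiling.

(** * The centered half-open parallelepiped of a lattice *)

Section coordinate_domain.
Context {R : realType} (n : nat).
Implicit Types (x p : 'rV[R]_n) (C : 'M[R]_n).
Notation mu := (@lebesgue_rV R n).

(** Centered, so that 0 is an interior point, where the kernel of the Poisson formula will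
    concentrate; half-open, so that the translates by [zlat C] tile exactly. *)
Definition fdom C : set 'rV[R]_n :=
  [set x | forall i, - 2^-1 <= (x *m C) 0 i < 2^-1].

Lemma measurable_fdom C : measurable (fdom C).
Proof.
rewrite (_ : fdom C = \bigcap_(i in [set: 'I_n])
    (fun x => (x *m C) 0 i) @^-1` `[- 2^-1, 2^-1[%classic).
  apply: fin_bigcap_measurable => // i _.
  by rewrite -[X in measurable X]setTI; exact: measurable_coordC.
by apply/seteqP; split=> x; [move=> + i _|move=> + i] => /(_ i);
  rewrite /= ?in_itv//=; apply.
Qed.

Definition round C x : 'rV[R]_n := \row_i (Num.floor ((x *m C) 0 i + 2^-1))%:~R.

Lemma fdom_tiles C : C \in unitmx -> tiles (fdom C) (zlat C).
Proof.
move=> CU; split; first exact: measurable_fdom.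
move=> x; exists (x - round C x *m invmx C); split; first split.
- move=> i; rewrite mulmxBl mulmxKV// mxE [X in _ + X]mxE [round _ _ _ _]mxE.
  have := floor_itv ((x *m C) 0 i + 2^-1); rewrite intrD.
  by move: (x *m C) => u /andP[? ?]; apply/andP; split; lra.
- by rewrite subKr => i; rewrite mulmxKV// mxE intr_int.
move=> y [Fy Ly].
suff -> : round C x = (x - y) *m C by rewrite mulmxK// subKr.
apply/rowP => i; rewrite mxE; have /intrP[k kE] := Ly i.
rewrite kE; congr (_%:~R); apply: floor_def; rewrite intrD -kE.
have := Fy i; rewrite mulmxBl [X in X <= _ < X + _]mxE [X in _ + X <= _ < _ + X + _]mxE.
by move: (x *m C) (y *m C) => u w /andP[? ?]; apply/andP; split; lra.
Qed.

Lemma zlat_countable C : C \in unitmx -> countable (zlat C).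
Proof.
move=> CU; pose phi (z : 'rV[int]_n) : 'rV[R]_n := map_mx intr z *m invmx C.
apply: (@sub_countable _ _ _ (range phi)); last first.
  exact: sub_countable (card_image_le _ _) (countableP _).
apply: subset_card_le => x xC.
pose z : 'rV[int]_n := \row_i Num.floor ((x *m C) 0 i).
exists z => //; rewrite /phi (_ : map_mx _ _ = x *m C) ?mulmxK//.
apply/rowP => i; rewrite [LHS]mxE.
have -> : z 0 i = Num.floor ((x *m C) 0 i) by rewrite mxE.
exact: floorK (xC i).
Qed.

Lemma fdom_bounded C : C \in unitmx -> exists2 K : R, 0 <= K &
  forall x, fdom C x -> forall j, `|x 0 j| <= K.
Proof.
move=> CU; exists (\sum_i \sum_j `|invmx C i j|).
  by apply: sumr_ge0 => i _; exact: sumr_ge0.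
move=> x Fx j; rewrite -(mulmxK CU x) mxE.
apply: le_trans (ler_norm_sum _ _ _) _; apply: ler_sum => i _.
rewrite normrM (bigD1 j)//= ler_wpDr ?sumr_ge0//.
rewrite ler_piMl// ler_norml; have := Fx i.
by move: (x *m C) => u /andP[? ?]; apply/andP; split; lra.
Qed.

Lemma fdom_finite C : C \in unitmx -> mu (fdom C) \is a fin_num.
Proof.
move=> CU; have [K K0 FK] := fdom_bounded CU.
pose B := [set x : 'rV[R]_n | forall i, `[- K, K]%classic (x 0 i)].
have mB : measurable B.
  by apply: (@measurable_box _ _ (fun=> `[- K, K]%classic)) => i; exact: measurable_itv.
rewrite ge0_fin_numE//; apply: (@le_lt_trans _ _ (mu B)).
  apply: (@le_measure _ _ _ mu (fdom C) B (mem_set (measurable_fdom C)) (mem_set mB)).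
  by move=> x /FK xK i; rewrite /= in_itv/= -ler_norml.
rewrite /B.
rewrite (lebesgue_rV_box (A := fun=> `[- K, K]%classic)).
  rewrite ltey_eq; apply/orP; left.
  elim/big_ind: _ => [//|a b ha hb|i _]; first by rewrite fin_numM.
  by rewrite lebesgue_measure_itv/=; case: ifP => _; rewrite -?EFinB.
by move=> i; exact: measurable_itv.
Qed.

(** Countably many null translates would make the whole space null, whereas its measure is a product
    of infinite factors, or the empty product 1 in dimension 0. *)
Lemma fdom_gt0 C : C \in unitmx -> 0 < fine (mu (fdom C)).
Proof.
move=> CU; rewrite fine_gt0// -ge0_fin_numE// fdom_finite// andbT.
rewrite lt0e measure_ge0 andbT; apply/eqP => mu0.
have : (\int[mu]_x 1%:E)%E = 0%E :> \bar R.
  rewrite (@ge0_integral_tiling _ _ (fdom C) (zlat C))//.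
  - apply: esum1 => p _; rewrite integral_cst//; last exact: measurable_fdom.
    by rewrite mul1e; exact: mu0.
  - exact: zlat_countable.
  - exact: fdom_tiles.
rewrite integral_cst// mul1e.
have muT : mu setT = (\prod_(i < n) @lebesgue_measure R setT)%E.
  by rewrite -(lebesgue_rV_box (A := fun=> setT))//; congr (mu _); apply/seteqP.
move=> /(etrans (esym muT)) /eqP.
apply/negP; elim/big_ind: _ => // [a b a0 b0|i _].
  by rewrite mule_eq0 negb_or a0.
by have := lebesgue_measure_itv (`]-oo, +oo[%R : interval R); rewrite set_itvE/= => ->.
Qed.

End coordinate_domain.

(** * Rapidly decreasing functions *)

Section brackets.
Context {R : realType} (n : nat).
Implicit Types (x y u : 'rV[R]_n) (C : 'M[R]_n).
Notation mu := (@lebesgue_rV R n).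

Definition nrm x : R := \sum_i `|x 0 i|.

Lemma nrm_ge0 x : 0 <= nrm x.
Proof. by apply: sumr_ge0. Qed.

Lemma nrmD x y : nrm (x + y) <= nrm x + nrm y.
Proof. by rewrite -big_split; apply: ler_sum => i _; rewrite mxE ler_normD. Qed.

Lemma nrmN x : nrm (- x) = nrm x.
Proof. by apply: eq_bigr => i _; rewrite mxE normrN. Qed.

Lemma ler_coord_nrm x i : `|x 0 i| <= nrm x.
Proof. by rewrite /nrm (bigD1 i)//= lerDl sumr_ge0. Qed.

Lemma nrm1_gt0 x : 0 < 1 + nrm x.
Proof. by rewrite ltr_pwDl// nrm_ge0. Qed.

(** Bounds a power of [1 + nrm x] by a constant or by a power of one coordinate, which is what
    Schwartz seminorms and differences along an axis control. *)
Lemma nrm_cases x : (forall i, `|x 0 i| <= 1) /\ 1 + nrm x <= n.+1%:R \/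
  exists2 j, 1 < `|x 0 j| & 1 + nrm x <= n.+1%:R * `|x 0 j|.
Proof.
have nrm_le (c : R) : (forall i, `|x 0 i| <= c) -> nrm x <= n%:R * c.
  move=> xc; apply: le_trans (ler_sum _ (fun i _ => xc i)) _.
  by rewrite sumr_const card_ord mulr_natl.
have [x1|] := pselect (forall i, `|x 0 i| <= 1).
  by left; split=> //; rewrite -natr1 addrC lerD2r -[leRHS]mulr1 nrm_le.
move=> /existsNP[i0 /negP]; rewrite -ltNge => xi0.
have [j _ jmax] := @arg_maxP _ _ _ i0 xpredT (fun i => `|x 0 i|) isT.
right; exists j; first exact: lt_le_trans xi0 (jmax i0 isT).
rewrite -natr1 mulrDl mul1r addrC lerD//; first by apply: nrm_le => i; exact: jmax.
exact: le_trans (ltW xi0) (jmax i0 isT).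
Qed.

(* The exponent [2 n] makes [brk] dominated by a product of one-variable
   summable weights, see [brk_wgt]. *)
Definition brk x : R := ((1 + nrm x) ^+ (2 * n))^-1.

Lemma brk_ge0 x : 0 <= brk x.
Proof. by rewrite invr_ge0 exprn_ge0// ltW// nrm1_gt0. Qed.

(** Peetre's inequality: a translation of bounded length costs only a constant factor. *)
Lemma brk_shift (K : R) x u : 0 <= K -> nrm u <= K ->
  brk (x + u) <= (1 + K) ^+ (2 * n) * brk x.
Proof.
move=> K0 uK; have xu := nrm1_gt0 (x + u); have x1 := nrm1_gt0 x.
have K1 : 0 < 1 + K by rewrite ltr_pwDl.
rewrite /brk ler_pdivlMr ?exprn_gt0// mulrC ler_pdivrMr ?exprn_gt0// -exprMn.
apply: lerXn2r; [by rewrite nnegrE ltW|by rewrite nnegrE ltW// mulr_gt0|].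
have := nrmD (x + u) (- u); rewrite addrK nrmN => h.
have : nrm u <= K * (1 + nrm (x + u)).
  by rewrite (le_trans uK)// ler_peMr// lerDl nrm_ge0.
lra.
Qed.

(** A product in lattice coordinates, so that its sum over a cube of [zlat C] factors. *)
Definition wgt C x : R := \prod_i (1 + ((x *m C) 0 i) ^+ 2)^-1.

Lemma wgt_ge0 C x : 0 <= wgt C x.
Proof. by apply: prodr_ge0 => i _; rewrite invr_ge0 addr_ge0// sqr_ge0. Qed.

Lemma brk_wgt C : exists2 A : R, 0 <= A & forall x, brk x <= A * wgt C x.
Proof.
pose c : R := 1 + \sum_i \sum_j `|C j i|.
have c0 : 0 <= \sum_i \sum_j `|C j i| by apply: sumr_ge0 => i _; apply: sumr_ge0.
exists (c ^+ (2 * n)); first by rewrite exprn_ge0// addr_ge0.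
move=> x; have x0 := nrm1_gt0 x.
rewrite /brk -[leLHS]mul1r ler_pdivrMr ?exprn_gt0// mulrAC -exprMn.
rewrite /wgt prodfV ler_pdivlMr; last first.
  by apply: prodr_gt0 => i _; rewrite ltr_pwDl// sqr_ge0.
rewrite mul1r exprM -[leRHS](_ : \prod_(i < n) (c * (1 + nrm x)) ^+ 2 = _); last first.
  by rewrite prodr_const card_ord.
apply: ler_prod => i _; rewrite addr_ge0 ?sqr_ge0//=.
have xi : `|(x *m C) 0 i| <= (\sum_i \sum_j `|C j i|) * nrm x.
  rewrite mxE mulrC /nrm mulr_suml; apply: le_trans (ler_norm_sum _ _ _) _.
  apply: ler_sum => j _; rewrite normrM ler_wpM2l//.
  rewrite (bigD1 i)//= (bigD1 j)//= -addrA lerDl addr_ge0 ?sumr_ge0// => k _.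
  exact: sumr_ge0.
rewrite -real_normK ?num_real//.
have nx := nrm_ge0 x; have xi0 := normr_ge0 ((x *m C) 0 i).
rewrite /c; move: (\sum_i _) `|_| (nrm x) xi c0 nx xi0 => a b d; nra.
Qed.

Lemma sum_inv_sqr (m : nat) :
  \sum_(k < (2 * m).+1) (1 + (k%:R - m%:R : R) ^+ 2)^-1 <= 5.
Proof.
(* The correction [4 / m.+1] closes the induction: the two new end terms are together at most
   [4 / a - 4 / (a + 1)] with [a = m + 1]. Equality at [m = 0] gives the constant 5. *)
suff : \sum_(k < (2 * m).+1) (1 + (k%:R - m%:R : R) ^+ 2)^-1 <= 5 - 4 / m.+1%:R.
  by move=> /le_trans; apply; rewrite lerBlDr lerDl divr_ge0.
elim: m => [|m IHm].
  have -> : 4 / 1%:R = 4 :> R by rewrite divr1.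
  by rewrite muln0 big_ord1 subrr expr0n/= addr0 invr1; lra.
rewrite mulnS !addSn add0n big_ord_recl big_ord_recr /=.
rewrite (eq_bigr (fun k : 'I_(2 * m).+1 => (1 + (k%:R - m%:R) ^+ 2)^-1)); last first.
  by move=> k _; rewrite /bump/= add1n -!natr1; congr (1 + _ ^+ 2)^-1; lra.
rewrite sub0r sqrrN /bump/= add1n (_ : (2 * m).+2%:R - m.+1%:R = m.+1%:R); last first.
  by rewrite -natrB; [congr _%:R; lia|lia].
have m0 : 0 < m.+1%:R :> R by [].
have -> : m.+2%:R = m.+1%:R + 1 :> R by rewrite natr1.
move: IHm m0; move: (\sum_(_ < _) _) m.+1%:R => s a IHm a0.
have : 2 * (1 + a ^+ 2)^-1 <= 4 / a - 4 / (a + 1).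
  rewrite (_ : 4 / a - 4 / (a + 1) = 4 / (a * (a + 1))); last first.
    by field; apply/andP; split; lra.
  rewrite ler_pdivlMr ?mulr_gt0//; last lra.
  rewrite mulrAC ler_pdivrMr; last by nra.
  nra.
lra.
Qed.

(** A finite subset lies in a coordinate cube [-m, m]^n, over which the sum is a product of
    one-variable sums, each at most 5. *)
Lemma absum_wgt C : C \in unitmx -> absum (zlat C) (wgt C).
Proof.
move=> CU; exists (5 ^+ n) => X XC.
pose z x i : int := Num.floor ((x *m C) 0 i).
have zE x i : x \in X -> (x *m C) 0 i = (z x i)%:~R.
  by move=> /XC /(_ i) /floorK.
pose m := \max_(x <- X) \max_i `|z x i|%N.
have zm x i : x \in X -> (`|z x i| <= m)%N.
  move=> xX; apply: leq_trans (leq_bigmax (F := fun i => `|z x i|%N) i) _.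
  exact: (@leq_bigmax_seq _ _ _ (fun x => \max_i `|z x i|%N)).
pose iota x : {ffun 'I_n -> 'I_(2 * m).+1} := [ffun i => inord `|(z x i + m%:Z)%R|%N].
have iotaE x i : x \in X -> (iota x i)%:R - m%:R = (x *m C) 0 i.
  move=> xX; rewrite zE// ffunE inordK; last first.
    by have := zm x i xX; lia.
  rewrite -[X in X - _]/(`|(z x i + m%:Z)%R|%:Z%:~R).
  rewrite gez0_abs; first by rewrite intrD addrK.
  by have := zm x i xX; lia.
have iota_inj : {in X &, injective iota}.
  move=> x y xX yX xy; rewrite -(mulmxK CU x) -(mulmxK CU y); congr (_ *m _).
  by apply/rowP => i; rewrite -!iotaE// xy.
pose H (k : {ffun 'I_n -> 'I_(2 * m).+1}) : R :=
  \prod_i (1 + ((k i)%:R - m%:R) ^+ 2)^-1.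
have H0 k : 0 <= H k.
  by apply: prodr_ge0 => i _; rewrite invr_ge0 addr_ge0// sqr_ge0.
apply: (@le_trans _ _ (\sum_(k <- [seq iota x | x <- X]) H k)).
  rewrite big_map big_seq [leRHS]big_seq le_eqVlt; apply/orP; left; apply/eqP.
  apply: eq_bigr => x xX; rewrite ger0_norm ?wgt_ge0// /wgt /H.
  by apply: eq_bigr => i _; rewrite iotaE.
rewrite big_uniq; last by rewrite map_inj_in_uniq ?fset_uniq.
apply: (@le_trans _ _ (\sum_k H k)).
  by rewrite [leLHS]big_mkcond/=; apply: ler_sum => k _; case: ifP.
rewrite -(bigA_distr_bigA (fun i (j : 'I_(2 * m).+1) => (1 + (j%:R - m%:R) ^+ 2)^-1)).
rewrite -[5 ^+ n](_ : \prod_(i < n) (5 : R) = _); last by rewrite prodr_const card_ord.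
apply: ler_prod => i _; rewrite sum_inv_sqr andbT sumr_ge0// => j _.
by rewrite invr_ge0 addr_ge0// sqr_ge0.
Qed.

(** Exactly the decay that makes a function integrable and summable over lattices; it holds both for
    Schwartz functions and for their transforms. *)
Definition rapid (g : 'rV[R]_n -> R) : Prop :=
  exists2 A : R, 0 <= A & forall x, `|g x| <= A * brk x.

Lemma rapid_wgt C (g : 'rV[R]_n -> R) : C \in unitmx -> rapid g ->
  exists2 A : R, 0 <= A & forall x u, fdom C u -> `|g (u + x)| <= A * wgt C x.
Proof.
move=> CU [A A0 gA]; have [K K0 FK] := fdom_bounded CU.
have [B B0 bB] := brk_wgt C.
exists (A * ((1 + n%:R * K) ^+ (2 * n) * B)).
  by rewrite !mulr_ge0// exprn_ge0// addr_ge0// mulr_ge0.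
move=> x u Fu; apply: le_trans (gA _) _; rewrite -mulrA ler_wpM2l// addrC.
apply: (@le_trans _ _ ((1 + n%:R * K) ^+ (2 * n) * brk x)).
  apply: brk_shift; first by rewrite mulr_ge0.
  apply: le_trans (ler_sum _ (fun i _ => FK u Fu i)) _.
  by rewrite sumr_const card_ord mulr_natl.
by rewrite -mulrA ler_wpM2l// exprn_ge0// addr_ge0// mulr_ge0.
Qed.

Lemma rapid_absum C (g : 'rV[R]_n -> R) u : C \in unitmx -> rapid g ->
  absum (zlat C) (fun x => g (x + u)).
Proof.
move=> CU [A A0 gA]; have [B B0 bB] := brk_wgt C.
apply: absum_le (absumZ (A * ((1 + nrm u) ^+ (2 * n) * B)) (absum_wgt CU)) => x _.
apply: le_trans (gA _) _; rewrite -mulrA ler_wpM2l//.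
apply: le_trans (brk_shift _ (nrm_ge0 u) (lexx _)) _.
by rewrite -mulrA ler_wpM2l// exprn_ge0// addr_ge0// nrm_ge0.
Qed.

(** Cutting the space into unit cubes reduces integrability to the summability of [wgt] over the
    integer lattice. *)
Lemma rapid_integrable (g : 'rV[R]_n -> R) :
  measurable_fun setT (g : 'rV[R]_n -> measurableTypeR R) -> rapid g ->
  mu.-integrable setT (EFin \o g).
Proof.
move=> mg gr; have U1 : (1%:M : 'M[R]_n) \in unitmx by exact: unitmx1.
have [A A0 gA] := rapid_wgt U1 gr.
apply/integrableP; split; first exact/measurable_EFinP.
have mng : measurable_fun setT (fun x => `|(EFin \o g) x|%E).
  by apply: measurableT_comp => //; exact/measurable_EFinP.
rewrite (ge0_integral_tiling (zlat_countable U1) (fdom_tiles U1))//.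
pose V := fine (mu (fdom (1%:M : 'M[R]_n))).
have muV : mu (fdom 1%:M) = V%:E by rewrite fineK// fdom_finite.
apply: (@le_lt_trans _ _ (\esum_(p in zlat 1%:M) (A * V * wgt 1%:M p)%:E)).
  apply: le_esum => p _.
  apply: (@le_trans _ _ (\int[mu]_(x in fdom 1%:M) (A * wgt 1%:M p)%:E)%E).
    apply: ge0_le_integral => //.
    - exact: measurable_fdom.
    - apply: measurable_funTS; apply: (measurableT_comp mng); exact: measurable_shift.
    - by move=> x Fx /=; rewrite lee_fin gA.
  rewrite integral_cst; last exact: measurable_fdom.
  apply: (@le_trans _ _ ((A * wgt 1%:M p)%:E * V%:E)%E); first by rewrite -muV.
  by rewrite -EFinM lee_fin mulrAC.
rewrite -ge0_fin_numE; last first.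
  by apply: esum_ge0 => p _; rewrite lee_fin !mulr_ge0 ?wgt_ge0// fine_ge0.
apply: absum_esum; last exact: absumZ (absum_wgt U1).
by move=> p; rewrite !mulr_ge0 ?wgt_ge0// fine_ge0.
Qed.

Lemma brk_rapid : rapid brk.
Proof. by exists 1 => // x; rewrite mul1r ger0_norm// brk_ge0. Qed.

Lemma measurable_nrm : measurable_fun setT (nrm : 'rV[R]_n -> measurableTypeR R).
Proof.
apply: measurable_sum => i; apply: measurableT_comp => //; exact: measurable_coor.
Qed.

Lemma measurable_brk : measurable_fun setT (brk : 'rV[R]_n -> measurableTypeR R).
Proof.
rewrite (_ : brk = (fun t : R => ((1 + `|t|) ^+ (2 * n))^-1) \o nrm); last first.
  by apply/funext => x; rewrite /brk/= ger0_norm// nrm_ge0.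
apply: measurableT_comp measurable_nrm; apply: continuous_measurable_fun => t.
apply: cvgV; first by rewrite expf_neq0// gt_eqF// ltr_pwDl.
apply: (@continuous_comp _ _ _ (fun t : R => 1 + `|t|) (fun t => t ^+ (2 * n))).
  by apply: cvgD; [exact: cvg_cst|exact: norm_continuous].
exact: exprn_continuous.
Qed.

End brackets.

Section schwartz.
Context {R : realType} (n : nat).
Implicit Types (f g : 'rV[R]_n -> R) (x y : 'rV[R]_n).
Notation mu := (@lebesgue_rV R n).

Lemma schwartz_partials f s : schwartz f -> schwartz (partials s f).
Proof.
move=> [df bf]; have E s' : partials s' (partials s f) = partials (s' ++ s) f.
  by rewrite /partials foldr_cat.
by split=> [s' x|s' a]; rewrite E//; exact: bf.
Qed.

Lemma schwartz_continuous f : schwartz f -> forall x, {for x, continuous f}.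
Proof. by move=> [/(_ [::]) df _] x; apply: differentiable_continuous; exact: df. Qed.

Lemma schwartz_measurable f : schwartz f ->
  measurable_fun setT (f : 'rV[R]_n -> measurableTypeR R).
Proof. by move=> /schwartz_continuous; exact: continuous_measurable_rV. Qed.

Lemma schwartz_rapid f : schwartz f -> rapid f.
Proof.
move=> [_ /(_ [::]) bf]; pose k := (2 * n)%N.
have [M0 fM0] := bf (fun=> 0%N).
have fM j : exists M : R, forall x, `|x 0 j| ^+ k * `|f x| <= M.
  have [M fM] := bf (fun i => if i == j then k else 0%N); exists M => x.
  apply: le_trans (fM x); rewrite normrM (bigD1 j)//= eqxx big1 => [|i /negPf ->].
    by rewrite mulr1 normrX.
  by rewrite expr0.
(* One bound is fixed for each coordinate so that the bounds can be added up. *)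
pose M j := xget 0 [set M : R | forall x, `|x 0 j| ^+ k * `|f x| <= M].
have {}fM j x : `|x 0 j| ^+ k * `|f x| <= M j.
  rewrite /M; case: xgetP => [M1 -> /(_ x)//|noM].
  by have [M1 fM1] := fM j; have := noM M1.
have {}fM0 x : `|f x| <= M0.
  by have := fM0 x; rewrite big1 ?mul1r// => i _; rewrite expr0.
have M00 : 0 <= M0 by apply: le_trans (fM0 0).
have Mj0 j : 0 <= M j by apply: le_trans (fM j 0); rewrite mulr_ge0// exprn_ge0.
exists (n.+1%:R ^+ k * (M0 + \sum_j M j)).
  by rewrite mulr_ge0 ?exprn_ge0// addr_ge0// sumr_ge0.
move=> x; have x1 := nrm1_gt0 x; rewrite /brk ler_pdivlMr ?exprn_gt0// -/k mulrC.
have [[_ xn]|[j xj xn]] := nrm_cases x.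
  apply: (@le_trans _ _ (n.+1%:R ^+ k * M0)).
    apply: ler_pM => //; first by rewrite exprn_ge0// ltW.
    by apply: lerXn2r => //; rewrite nnegrE// ltW.
  by rewrite ler_wpM2l ?exprn_ge0// lerDl sumr_ge0.
apply: (@le_trans _ _ ((n.+1%:R * `|x 0 j|) ^+ k * `|f x|)).
  by rewrite ler_wpM2r//; apply: lerXn2r => //; rewrite nnegrE ?mulr_ge0// ltW.
rewrite exprMn -mulrA ler_wpM2l ?exprn_ge0//; apply: le_trans (fM j x) _.
by rewrite (bigD1 j)//= addrCA lerDl addr_ge0// sumr_ge0.
Qed.

End schwartz.

(** * Decay of the Fourier transform *)

Section phase.
Context {R : realType}.
Implicit Types t s : R.

Definition ph t : R := cos (2 * pi * t).

Lemma Re_e2pi t : complex.Re (e2pi t) = ph t. Proof. by []. Qed.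

Lemma Im_e2pi t : complex.Im (e2pi t) = ph (t - 4^-1).
Proof.
rewrite /ph /e2pi/= (_ : 2 * pi * (t - 4^-1) = 2 * pi * t - pi / 2); last by lra.
by rewrite cosB cos_pihalf sin_pihalf mulr0 add0r mulr1.
Qed.

Lemma ph_le1 t : `|ph t| <= 1.
Proof. by rewrite ler_norml cos_geN1 cos_le1. Qed.

Lemma phDint t s : s \is a Num.int -> ph (t + s) = ph t.
Proof. by move=> /e2pi_int s1; rewrite -!Re_e2pi e2piD s1 mulr1. Qed.

Lemma phD2 t : ph (t + 2^-1) = - ph t.
Proof. by rewrite /ph (_ : 2 * pi * (t + 2^-1) = 2 * pi * t + pi) ?cosDpi//; lra. Qed.

Lemma phN t : ph (- t) = ph t.
Proof. by rewrite /ph mulrN cosN. Qed.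

Lemma continuous_ph : continuous (ph : R -> R).
Proof.
move=> t; apply: (@continuous_comp _ _ _ (fun t => 2 * pi * t) cos).
  by apply: cvgM; [exact: cvg_cst|exact: cvg_id].
exact: continuous_cos.
Qed.

End phase.

Section oscillatory.
Context {R : realType} (n : nat).
Implicit Types (f g : 'rV[R]_n -> R) (x y h : 'rV[R]_n).
Notation mu := (@lebesgue_rV R n).
Notation mfun g := (measurable_fun setT (g : 'rV[R]_n -> measurableTypeR R)).

Lemma measurable_dotp y : mfun (fun x => dotp x y).
Proof.
apply: measurable_sum => i; apply: measurable_funM => //; exact: measurable_coor.
Qed.

Lemma measurable_ph y (t : R) : mfun (fun x => ph (dotp x y + t)).
Proof.
apply: (measurableT_comp (continuous_measurable_fun (@continuous_ph R))).
by apply: measurable_funD => //; exact: measurable_dotp.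
Qed.

Lemma measurable_mul_ph g y t : mfun g -> mfun (fun x => g x * ph (dotp x y + t)).
Proof. by move=> mg; apply: measurable_funM => //; exact: measurable_ph. Qed.

Lemma rapid_mul_ph g y t : rapid g -> rapid (fun x => g x * ph (dotp x y + t)).
Proof.
move=> [A A0 gA]; exists A => // x; rewrite normrM; apply: le_trans (gA x).
by rewrite ler_piMr// ph_le1.
Qed.

(* [fourier f y] is [osc f y 0 +i* osc f y 4^-1]: with the phase as a parameter,
   real and imaginary parts are treated together. *)
Definition osc f y (t : R) : R :=
  Rintegral mu setT (fun x => f x * ph (dotp x y + t)).

Lemma Rintegral_shift h g : mfun g ->
  Rintegral mu setT (fun x => g (x + h)) = Rintegral mu setT g.
Proof.
move=> mg; rewrite /Rintegral; congr fine; rewrite integralE [RHS]integralE.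
have mEg : measurable_fun setT (EFin \o g) by exact/measurable_EFinP.
congr (_ - _)%E.
  rewrite -(@ge0_integral_shift _ _ h (fun x => ((EFin \o g)^\+ x)%E)) //.
    by apply: eq_integral => x _; rewrite !funeposE.
  exact: (measurable_funepos mEg).
rewrite -(@ge0_integral_shift _ _ h (fun x => ((EFin \o g)^\- x)%E)) //.
  by apply: eq_integral => x _; rewrite !funenegE.
exact: (measurable_funeneg mEg).
Qed.

Lemma osc_shift f h y t : mfun f ->
  osc (fun x => f (x + h)) y t = osc f y (t - dotp h y).
Proof.
move=> mf; rewrite /osc -[RHS](Rintegral_shift h); last exact: measurable_mul_ph.
by congr (Rintegral _ _ _); apply/funext => x; rewrite dotpDl; congr (_ * ph _); lra.
Qed.

Definition bint : R := Rintegral mu setT (@brk R n).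

Lemma bint_ge0 : 0 <= bint.
Proof. by apply: Rintegral_ge0 => x _; exact: brk_ge0. Qed.

Lemma norm_Rintegral_brk (A : R) g : mfun g -> (forall x, `|g x| <= A * brk x) ->
  `|Rintegral mu setT g| <= A * bint.
Proof.
move=> mg gA; have gr : rapid g.
  by exists `|A| => // x; rewrite (le_trans (gA x))// ler_wpM2r ?brk_ge0 ?ler_norm.
have ig := rapid_integrable mg gr.
have ib := rapid_integrable (@measurable_brk R n) (@brk_rapid R n).
apply: le_trans (le_normr_Rintegral _ ig) _ => //.
rewrite /bint -RintegralZl//; apply: le_Rintegral => //.
  exact: (integrable_norm ig).
exact: (integrableZl _ A ib).
Qed.

Lemma osc_bound (A : R) f y t : mfun f -> (forall x, `|f x| <= A * brk x) ->
  `|osc f y t| <= A * bint.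
Proof.
move=> mf fA; apply: norm_Rintegral_brk; first exact: measurable_mul_ph.
by move=> x; rewrite normrM (le_trans _ (fA x))// ler_piMr// ph_le1.
Qed.

Definition fdiff h f : 'rV[R]_n -> R := fun x => f (x + h) - f x.

Lemma fdiff_measurable h f : mfun f -> mfun (fdiff h f).
Proof.
move=> mf; apply: measurable_funB => //.
by apply: (measurableT_comp mf); exact: measurable_shift.
Qed.

Lemma fdiff_rapid h f : rapid f -> rapid (fdiff h f).
Proof.
move=> [A A0 fA]; exists (A * (1 + nrm h) ^+ (2 * n) + A).
  by rewrite addr_ge0// mulr_ge0// exprn_ge0// ltW// nrm1_gt0.
move=> x; apply: le_trans (ler_normB _ _) _; rewrite mulrDl lerD//.
apply: le_trans (fA _) _; rewrite -mulrA ler_wpM2l//.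
by apply: brk_shift => //; exact: nrm_ge0.
Qed.

Lemma osc_fdiff h f y t : mfun f -> rapid f -> dotp h y = 2^-1 ->
  osc (fdiff h f) y t = - 2 * osc f y t.
Proof.
move=> mf rf hy; have mfh : mfun (fun x => f (x + h)).
  by apply: (measurableT_comp mf); exact: measurable_shift.
have rfh : rapid (fun x => f (x + h)).
  have [A A0 fA] := rf; exists (A * (1 + nrm h) ^+ (2 * n)).
    by rewrite mulr_ge0// exprn_ge0// ltW// nrm1_gt0.
  move=> x; apply: le_trans (fA _) _; rewrite -mulrA ler_wpM2l//.
  by apply: brk_shift => //; exact: nrm_ge0.
have -> : osc (fdiff h f) y t = osc (fun x => f (x + h)) y t - osc f y t.
  rewrite /osc -RintegralB//; first by apply: eq_Rintegral => x _; rewrite mulrBl.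
  - by apply: rapid_integrable; [exact: measurable_mul_ph|exact: rapid_mul_ph].
  - by apply: rapid_integrable; [exact: measurable_mul_ph|exact: rapid_mul_ph].
rewrite osc_shift// hy.
have -> : osc f y (t - 2^-1) = - 1 * osc f y t.
  rewrite /osc -RintegralZl//; last first.
    by apply: rapid_integrable; [exact: measurable_mul_ph|exact: rapid_mul_ph].
  apply: eq_Rintegral => x _; have := phD2 (dotp x y + (t - 2^-1)).
  by rewrite -addrA subrK => ->; rewrite mulN1r mulrN opprK.
lra.
Qed.

Lemma osc_fdiff_iter k h f y t : mfun f -> rapid f -> dotp h y = 2^-1 ->
  osc (iter k (fdiff h) f) y t = (- 2) ^+ k * osc f y t.
Proof.
move=> mf rf hy; elim: k => [|k IHk]; first by rewrite expr0 mul1r.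
have [mk rk] : mfun (iter k (fdiff h) f) /\ rapid (iter k (fdiff h) f).
  by elim: k {IHk} => [//|k [mk rk]]; split; [exact: fdiff_measurable|exact: fdiff_rapid].
by rewrite iterS osc_fdiff// IHk exprS mulrA.
Qed.

Lemma is_derive_shift_rV x h v f (d : R) :
  is_derive (x + h) v f d -> is_derive x v (fun y => f (y + h)) d.
Proof.
have E : (fun t : R => t^-1 *: (((fun y => f (y + h)) \o shift x) (t *: v) - f (x + h))) =
    (fun t : R => t^-1 *: ((f \o shift (x + h)) (t *: v) - f (x + h))).
  by apply/funext => t /=; rewrite addrA.
move=> [df fd]; split; first by rewrite /derivable E.
by rewrite /derive E.
Qed.

Lemma is_derive_line x v f (t d : R) :
  is_derive (x + t *: v) v f d -> is_derive t 1 (fun s : R => f (x + s *: v)) d.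
Proof.
have E : (fun r : R => r^-1 *: (((fun s : R => f (x + s *: v)) \o shift t) (r *: 1) -
      f (x + t *: v))) =
    (fun r : R => r^-1 *: ((f \o shift (x + t *: v)) (r *: v) - f (x + t *: v))).
  by apply/funext => r /=; rewrite scalerDl addrCA /GRing.scale/= mulr1.
move=> [df fd]; split; first by rewrite /derivable E.
by rewrite /derive E.
Qed.

(** The bound on [t] keeps the intermediate point within the reach of [brk_shift], for either sign
    of the step. *)
Lemma line_MVT v f g x (s : R) : (forall x, is_derive x v f (g x)) ->
  exists2 t : R, `|t| <= `|s| & f (x + s *: v) - f x = s * g (x + t *: v).
Proof.
move=> fg; pose phi (t : R) := f (x + t *: v).
have dphi (t : R) : is_derive t 1 phi (g (x + t *: v)) by exact: is_derive_line.
have cphi a b : {within `[a, b], continuous phi}.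
  apply: derivable_within_continuous => t _; exact: (@ex_derive _ _ _ _ _ _ _ (dphi t)).
have phi0 : phi 0 = f x by rewrite /phi scale0r addr0.
have [s0|s0|->] := ltgtP s 0; last first.
- by exists 0 => //; rewrite scale0r addr0 subrr mul0r.
- have [c] := MVT s0 (fun t _ => dphi t) (cphi 0 s).
  rewrite in_itv/= phi0 subr0 => /andP[c0 cs] E; exists c.
    by rewrite !gtr0_norm// ltW.
  by rewrite [LHS]E mulrC.
have [c] := MVT s0 (fun t _ => dphi t) (cphi s 0).
rewrite in_itv/= phi0 sub0r => /andP[c0 cs] E; exists c.
  by rewrite !ltr0_norm// lerN2 ltW.
by rewrite -opprB [X in - X]E mulrN opprK mulrC.
Qed.

Lemma is_derive_fdiff_iter k h j f x : schwartz f ->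
  is_derive x (delta_mx 0 j) (iter k (fdiff h) f)
    (iter k (fdiff h) ('D_(delta_mx 0 j) f) x).
Proof.
move=> [df _]; elim: k x => [|k IHk] x /=.
  by apply: DeriveDef => //; apply: diff_derivable; exact: (df [::]).
by apply: is_deriveB => //; exact: is_derive_shift_rV.
Qed.

Lemma nrm_delta (s : R) (j : 'I_n) : nrm (s *: delta_mx 0 j : 'rV[R]_n) = `|s|.
Proof.
rewrite /nrm (bigD1 j)//= big1 => [|i ij]; first by rewrite !mxE !eqxx mulr1 addr0.
by rewrite !mxE (negPf ij) andbF mulr0 normr0.
Qed.

(** The mean value theorem turns one difference into a factor [s] times a derivative, which commutes
    with the remaining differences; hence the induction runs over all Schwartz [f]. The intermediate
    points move by at most 1, whence the constant [(1 + 1) ^+ (2 * n)]. *)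
Lemma fdiff_iter_bound k j f : schwartz f -> exists2 A : R, 0 <= A &
  forall s x, `|s| <= 1 ->
    `|iter k (fdiff (s *: delta_mx 0 j)) f x| <= `|s| ^+ k * A * brk x.
Proof.
elim: k f => [|k IHk] f Sf.
  have [A A0 fA] := schwartz_rapid Sf; exists A => // s x _.
  by rewrite expr0 mul1r; exact: fA.
have [A A0 DA] := IHk _ (schwartz_partials [:: j] Sf).
exists (A * (1 + 1) ^+ (2 * n)); first by rewrite mulr_ge0// exprn_ge0.
move=> s x s1; rewrite iterS /fdiff.
have [t ts ->] := line_MVT x s (fun x => is_derive_fdiff_iter k (s *: delta_mx 0 j) j x Sf).
rewrite normrM exprS -!mulrA ler_wpM2l//; apply: le_trans (DA s _ s1) _.
rewrite -mulrA ler_wpM2l ?exprn_ge0// ler_wpM2l//.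
by apply: brk_shift => //; rewrite nrm_delta (le_trans ts).
Qed.

(* A difference of step [h] with [<h, y> = 1/2] multiplies the transform by [-2].
   Iterating it [2 n] times along a coordinate axis, with [h] of size
   [1 / (2 |y_j|)], trades derivatives of [f] for powers of [|y_j|] without any
   integration by parts. *)
Lemma osc_decay f : schwartz f -> exists2 A : R, 0 <= A &
  forall y t, `|osc f y t| <= A * brk y.
Proof.
move=> Sf; pose k := (2 * n)%N.
have mf := schwartz_measurable Sf; have rf := schwartz_rapid Sf.
have [A0 A00 fA0] := rf.
have /choice[A AP] j : exists A : R, 0 <= A /\ forall s x, `|s| <= 1 ->
    `|iter k (fdiff (s *: delta_mx 0 j)) f x| <= `|s| ^+ k * A * brk x.
  by have [A ? ?] := fdiff_iter_bound k j Sf; exists A.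
have b0 := bint_ge0.
have Aj0 j : 0 <= A j by have [] := AP j.
exists (n.+1%:R ^+ k * ((A0 + \sum_j A j) * bint)).
  by rewrite !mulr_ge0 ?exprn_ge0// addr_ge0// sumr_ge0.
move=> y t; have y1 := nrm1_gt0 y.
rewrite /brk ler_pdivlMr ?exprn_gt0// -/k mulrC.
have [[_ yn]|[j yj yn]] := nrm_cases y.
  apply: ler_pM => //; first by rewrite exprn_ge0// ltW.
    by apply: lerXn2r => //; rewrite nnegrE// ltW.
  apply: le_trans (osc_bound _ _ mf fA0) _; rewrite ler_wpM2r// lerDl.
  exact: sumr_ge0.
have yj0 : 0 < `|y 0 j| by apply: lt_trans yj.
apply: (@le_trans _ _ ((n.+1%:R * `|y 0 j|) ^+ k * `|osc f y t|)).
  by rewrite ler_wpM2r//; apply: lerXn2r => //; rewrite nnegrE ?mulr_ge0// ltW.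
rewrite exprMn -mulrA ler_wpM2l ?exprn_ge0//.
pose s := (2 * y 0 j)^-1.
have sE : `|s| = (2 * `|y 0 j|)^-1 by rewrite /s normfV normrM ger0_norm.
have s1 : `|s| <= 1.
  by rewrite sE invf_le1 ?mulr_gt0//; lra.
have hy : dotp (s *: delta_mx 0 j) y = 2^-1.
  rewrite /dotp (bigD1 j)//= big1 => [|i ij].
    rewrite !mxE !eqxx mulr1 addr0 /s invfM -mulrA mulVf ?mulr1//.
    by rewrite -normr_gt0.
  by rewrite !mxE (negPf ij) andbF mulr0 mul0r.
have := osc_fdiff_iter k t mf rf hy.
have mk : mfun (iter k (fdiff (s *: delta_mx 0 j)) f).
  by elim: (k) => [//|m mm]; exact: fdiff_measurable.
have := osc_bound y t mk (fun x => (AP j).2 s x s1).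
move=> /[swap] ->; rewrite normrM normrX normrN (@ger0_norm _ 2)// => bnd.
have sy : `|y 0 j| ^+ k * `|s| ^+ k <= 1.
  rewrite -exprMn exprn_ile1 ?mulr_ge0//.
  rewrite sE ler_pdivrMr ?mulr_gt0// mul1r; lra.
have bnd' : `|osc f y t| <= `|s| ^+ k * A j * bint.
  apply: le_trans bnd; rewrite ler_peMl//; apply: exprn_ege1; lra.
apply: (@le_trans _ _ (`|y 0 j| ^+ k * (`|s| ^+ k * A j * bint))).
  by rewrite ler_wpM2l// exprn_ge0.
rewrite !mulrA -(mulrA _ (A j)) -[leRHS]mul1r; apply: ler_pM => //.
  by rewrite mulr_ge0// exprn_ge0.
by rewrite ler_wpM2r// (bigD1 j)//= addrCA lerDl addr_ge0// sumr_ge0.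
Qed.

Lemma osc_rapid f t : schwartz f -> rapid (fun y => osc f y t).
Proof. by move=> /osc_decay[A A0 fA]; exists A. Qed.

End oscillatory.

(** * Poisson summation *)

Section kernel.
Context {R : realType}.
Implicit Types (t u : R) (m k : nat).

(** The mean of [cos (pi u) ^+ (2 * m)] is ['C(2 * m, m) / 4 ^ m], so normalizing it costs at most a
    factor [2 m + 1], which geometric decay away from the integers absorbs. *)
Lemma leq_central_bin m : (4 ^ m <= (2 * m).+1 * 'C(2 * m, m))%N.
Proof.
elim: m => [//|m IHm].
have h1 : ((2 * m).+2 * 'C((2 * m).+1, m) = m.+1 * 'C((2 * m).+2, m.+1))%N.
  exact: (mul_bin_diag (2 * m).+2 m).
have h2 : ((2 * m).+1 * 'C(2 * m, m) = m.+1 * 'C((2 * m).+1, m))%N.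
  by have := mul_bin_down (2 * m).+1 m => ->; congr muln; lia.
rewrite expnS (_ : (2 * m.+1)%N = (2 * m).+2); last by lia.
move: IHm h1 h2; move: ('C(_, m.+1)) ('C((2 * m).+1, m)) ('C(2 * m, m)) (4 ^ m)%N.
by move=> a b c d; nia.
Qed.

Definition cbin m : R := 'C(2 * m, m)%:R.

Lemma cbin_gt0 m : 0 < cbin m.
Proof. by rewrite ltr0n bin_gt0; lia. Qed.

Definition rbin m k : R := 'C(2 * m, m + k)%:R / cbin m.

Lemma rbin0 m : rbin m 0 = 1.
Proof. by rewrite /rbin addn0 divff// gt_eqF// cbin_gt0. Qed.

Lemma rbin_ge0 m k : 0 <= rbin m k.
Proof. by rewrite divr_ge0// ltW// cbin_gt0. Qed.

(** The ratio of consecutive binomials is [(m - k) / (m + k + 1)]; in this form it shows both that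
    the coefficients decrease in [k] and that they tend to 1 with [m]. Both sides vanish for
    [k > m]. *)
Lemma rbinS m k : rbin m k.+1 = rbin m k * (1 - (2 * k + 1)%:R * harmonic (k + m)%N).
Proof.
have := mul_bin_left (2 * m) (m + k); rewrite addnS => /(congr1 (fun i => i%:R : R)).
rewrite /rbin !natrM /harmonic /= (addnS m k) (addnC m k) => h.
have c0 := cbin_gt0 m; have k0 : 0 < (k + m).+1%:R :> R by [].
rewrite mulrAC; congr (_ / _).
apply: (mulfI (lt0r_neq0 k0)); rewrite h [RHS]mulrCA.
rewrite mulrC mulrBr mulr1 mulrCA divff ?mulr1 ?gt_eqF//.
have [km|mk] := leqP k m.
  congr (_ * _); rewrite -natrB; last by lia.
  by congr (_%:R); lia.
by rewrite bin_small ?mul0r//; lia.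
Qed.

Lemma rbin_le1 m k : rbin m k <= 1.
Proof.
elim: k => [|k IHk]; first by rewrite rbin0.
apply: le_trans IHk; rewrite rbinS ler_piMr ?rbin_ge0// lerBlDr lerDl.
by rewrite mulr_ge0// /harmonic/= invr_ge0.
Qed.

Lemma rbin_cvg k : rbin m k @[m --> \oo] --> (1 : R).
Proof.
elim: k => [|k IHk].
  rewrite (_ : (fun m => _) = cst 1); first exact: cvg_cst.
  by apply/funext => m; rewrite rbin0.
rewrite (_ : (fun m => _) = fun m => rbin m k * (1 - (2 * k + 1)%:R * harmonic (m + k)%N)).
  suff : rbin m k * (1 - (2 * k + 1)%:R * harmonic (m + k)%N) @[m --> \oo] -->
      (1 * (1 - (2 * k + 1)%:R * 0) : R) by rewrite mulr0 subr0 mulr1.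
  apply: cvgM => //; apply: cvgB; first exact: cvg_cst.
  apply: cvgM; first exact: cvg_cst.
  by rewrite (cvg_shiftn k (@harmonic R)); exact: cvg_harmonic.
by apply/funext => m; rewrite rbinS (addnC m k).
Qed.

(* [cos^(2 m)], normalized to have mean [1]: a trigonometric polynomial which
   concentrates at the integers, and whose coefficients [rbin] lie in [0, 1] and
   tend to [1]. *)
Definition qker m u : R := 4 ^+ m / cbin m * cos (pi * u) ^+ (2 * m).

Lemma qker_ge0 m u : 0 <= qker m u.
Proof.
have c0 := cbin_gt0 m.
rewrite /qker exprM; apply: mulr_ge0; last by rewrite exprn_ge0// sqr_ge0.
by rewrite divr_ge0 ?exprn_ge0// ltW.
Qed.

Lemma qker_le m u : qker m u <= (2 * m).+1%:R * cos (pi * u) ^+ (2 * m).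
Proof.
rewrite ler_wpM2r//; first by rewrite exprM exprn_ge0// sqr_ge0.
rewrite ler_pdivrMr ?cbin_gt0// -natrX -natrM ler_nat.
exact: leq_central_bin.
Qed.

Lemma qker_le_nat m u : qker m u <= (2 * m).+1%:R.
Proof.
apply: le_trans (qker_le _ _) _.
by rewrite ler_piMr// exprM exprn_ile1 ?sqr_ge0// -(cos2Dsin2 (pi * u)) lerDl sqr_ge0.
Qed.

Lemma e2piMn u k : e2pi (u * k%:R) = e2pi u ^+ k.
Proof.
elim: k => [|k IHk]; first by rewrite mulr0 e2pi0.
by rewrite -natr1 mulrDr mulr1 e2piD IHk exprSr.
Qed.

Lemma e2pi_sum (I : Type) (r : seq I) (F : I -> R) :
  e2pi (\sum_(i <- r) F i) = \prod_(i <- r) e2pi (F i).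
Proof. by rewrite (big_morph e2pi (@e2piD R) (@e2pi0 R)). Qed.

(** Binomial expansion of the [m]-th power of [e2pi (- u) * (1 + e2pi u) ^+ 2 = 4 cos (pi u)^2]. *)
Lemma qkerE m u : \sum_(j < (2 * m).+1) ('C(2 * m, j)%:R / cbin m)%:C *
  e2pi (u * (j%:R - m%:R)) = (qker m u)%:C.
Proof.
have c0 := cbin_gt0 m.
transitivity ((cbin m)^-1%:C * (e2pi (- u) ^+ m * (1 + e2pi u) ^+ (2 * m))).
  rewrite exprDn !mulr_sumr; apply: eq_bigr => j _.
  have -> : e2pi (u * (j%:R - m%:R)) = e2pi u ^+ j * e2pi (- u) ^+ m.
    by rewrite mulrBr e2piD e2piMn -mulNr e2piMn.
  by rewrite expr1n mul1r -[in RHS]mulr_natr rmorphM /= rmorph_nat; ring.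
rewrite exprM -exprMn.
have -> : e2pi (- u) * (1 + e2pi u) ^+ 2 = (4 * cos (pi * u) ^+ 2)%:C.
  have -> : e2pi (- u) * (1 + e2pi u) ^+ 2 =
      e2pi (- u) + (e2pi (- u) * e2pi u) *+ 2 + (e2pi (- u) * e2pi u) * e2pi u.
    by ring.
  rewrite -e2piD addNr e2pi0 mul1r.
  apply/eqP; rewrite eq_complex /= mulrN cosN sinN.
  rewrite (_ : 2 * pi * u = (pi * u) *+ 2); last by rewrite mulr2n; lra.
  by rewrite cos_mulr2n !mulr2n; apply/andP; split; apply/eqP; lra.
rewrite -rmorphXn -rmorphM; congr (_%:C).
by rewrite /qker exprMn -exprM mulrA [RHS]mulrAC [in RHS]mulrC mulrA mulrAC.
Qed.

(** Induction on the degree: one of the two factors [Num.sqrt r ^+ m] of [r ^+ m] absorbs a single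
    power of [2 m + 1] by Bernoulli's inequality, the other the remaining powers. *)
Lemma poly_geometric_bound (k : nat) (r : R) : 0 <= r < 1 ->
  exists B : R, forall m, (2 * m).+1%:R ^+ k * r ^+ m <= B.
Proof.
elim: k r => [|k IHk] r /andP[r0 r1].
  by exists 1 => m; rewrite expr0 mul1r exprn_ile1// ltW.
have s0 : 0 <= Num.sqrt r by exact: sqrtr_ge0.
have s1 : Num.sqrt r < 1 by rewrite -[ltRHS]sqrtr1 ltr_sqrt.
have [|B HB] := IHk (Num.sqrt r); first by rewrite s0.
have B0 : 0 <= B by apply: le_trans (HB 0%N); rewrite mulr_ge0// exprn_ge0.
(* The maximum with [2^-1] keeps [s] invertible when [r = 0]. *)
pose s := Num.max (Num.sqrt r) 2^-1.
have s_gt0 : 0 < s by rewrite lt_max invr_gt0 ltr0n orbT.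
have s_lt1 : s < 1 by rewrite gt_max s1 invf_lt1//; lra.
pose h := s^-1 - 1; have h0 : 0 < h by rewrite subr_gt0 invf_gt1.
exists (B * (2 * h^-1 + 1)) => m.
have -> : r ^+ m = Num.sqrt r ^+ m * Num.sqrt r ^+ m.
  by rewrite -exprMn -expr2 sqr_sqrtr.
rewrite exprSr mulrACA; apply: ler_pM; rewrite ?mulr_ge0 ?exprn_ge0//.
apply: (@le_trans _ _ ((2 * m).+1%:R * s ^+ m)).
  rewrite ler_wpM2l//; apply: lerXn2r; rewrite ?nnegrE ?(ltW s_gt0)//.
  by rewrite /s le_max lexx.
have bern : 1 + m%:R * h <= s^-1 ^+ m.
  elim: (m) => [|i IHi]; first by rewrite mul0r addr0 expr0.
  rewrite exprSr -natr1.
  have : (1 + i%:R * h) * (1 + h) <= s^-1 ^+ i * s^-1.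
    rewrite (_ : s^-1 = 1 + h) in IHi *; last by rewrite /h addrC subrK.
    by rewrite ler_wpM2r// addr_ge0// ltW.
  apply: le_trans; have : 0 <= i%:R * h * h by rewrite !mulr_ge0// ltW.
  by lra.
have sm : 0 < s ^+ m by rewrite exprn_gt0.
have mh : m%:R * h * s ^+ m <= 1.
  rewrite -ler_pdivlMr// mul1r -exprVn; apply: le_trans bern; lra.
have sm1 : s ^+ m <= 1 by rewrite exprn_ile1// ltW.
rewrite -natr1 natrM mulrDl mul1r lerD// -mulrA ler_wpM2l//.
by rewrite -[leRHS]mul1r ler_pdivlMr// mulrAC.
Qed.

Lemma poly_geometric_cvg (k : nat) (r : R) : 0 <= r < 1 ->
  (2 * m).+1%:R ^+ k * r ^+ m @[m --> \oo] --> (0 : R).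
Proof.
move=> /andP[r0 r1].
have s0 : 0 <= Num.sqrt r by exact: sqrtr_ge0.
have s1 : Num.sqrt r < 1 by rewrite -[ltRHS]sqrtr1 ltr_sqrt.
have [|B HB] := @poly_geometric_bound k (Num.sqrt r); first by rewrite s0.
have : B * Num.sqrt r ^+ m @[m --> \oo] --> B * 0.
  by apply: cvgM; [exact: cvg_cst|apply: cvg_expr; rewrite ger0_norm].
rewrite mulr0; apply: squeeze_cvgr; last exact: cvg_cst.
apply: nearW => m; rewrite mulr_ge0 ?exprn_ge0//=.
have -> : r ^+ m = Num.sqrt r ^+ m * Num.sqrt r ^+ m.
  by rewrite -exprMn -expr2 sqr_sqrtr.
by rewrite mulrA ler_wpM2r// exprn_ge0.
Qed.

Lemma cos_pi_lt1 (d : R) : 0 < d -> d <= 2^-1 -> 0 <= cos (pi * d) ^+ 2 < 1.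
Proof.
move=> d0 d1; rewrite sqr_ge0/= cos2sin2 ltrBlDr ltrDl exprn_gt0//.
have p0 := pi_gt0 R; apply: sin_gt0_pi; rewrite mulr_gt0//=.
by rewrite -[ltRHS]mulr1 ltr_pM2l//; lra.
Qed.

Lemma cos_pi_le (d u : R) : 0 < d -> d <= `|u| -> `|u| <= 2^-1 ->
  cos (pi * u) ^+ 2 <= cos (pi * d) ^+ 2.
Proof.
move=> d0 du u1; have p0 := pi_gt0 R.
have -> : cos (pi * u) = cos (pi * `|u|).
  by case: (ger0P u) => // _; rewrite mulrN cosN.
have pu : pi * `|u| <= pi / 2 by rewrite ler_pM2l.
have pd : pi * d <= pi * `|u| by rewrite ler_pM2l.
have pd0 : 0 < pi * d by rewrite mulr_gt0.
apply: lerXn2r; rewrite ?nnegrE.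
- by apply: cos_ge0_pihalf; apply/andP; split; lra.
- by apply: cos_ge0_pihalf; apply/andP; split; lra.
by rewrite leNgt ltr_cos ?in_itv/= -?leNgt//; apply/andP; split; lra.
Qed.

Lemma qker_tail m (d u : R) : 0 < d -> d <= `|u| -> `|u| <= 2^-1 ->
  qker m u <= (2 * m).+1%:R * (cos (pi * d) ^+ 2) ^+ m.
Proof.
move=> d0 du u1; apply: le_trans (qker_le _ _) _; rewrite ler_wpM2l// exprM.
by apply: lerXn2r; rewrite ?nnegrE ?sqr_ge0//; exact: cos_pi_le du u1.
Qed.

(** [cos (pi u)] changes sign under odd translations; the even exponent restores the period 1. *)
Lemma qkerDint m u (k : R) : k \is a Num.int -> qker m (u + k) = qker m u.
Proof.
move=> ki; rewrite /qker; congr (_ * _); rewrite !exprM; congr (_ ^+ _).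
have E (t : R) : cos (pi * t) ^+ 2 = (1 + ph t) / 2.
  rewrite /ph (_ : 2 * pi * t = (pi * t) *+ 2); last by rewrite mulr2n; lra.
  by rewrite cos_mulr2n mulr2n; lra.
by rewrite !E phDint.
Qed.

End kernel.

(** * Characters and the product kernel on a fundamental domain *)

Section domain_integral.
Context {R : realType} (n : nat).
Implicit Types (f g h : 'rV[R]_n -> R) (x y u w : 'rV[R]_n).
Notation mu := (@lebesgue_rV R n).
Notation mfun g := (measurable_fun setT (g : 'rV[R]_n -> measurableTypeR R)).

Lemma Rintegral_sumr (A : set 'rV[R]_n) (I : Type) (r : seq I) (c : I -> R)
    (g : I -> 'rV[R]_n -> R) : measurable A ->
  (forall i, mu.-integrable A (EFin \o g i)) ->
  Rintegral mu A (fun x => \sum_(i <- r) c i * g i x) =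
  \sum_(i <- r) c i * Rintegral mu A (g i).
Proof.
move=> mA ig.
suff [] : mu.-integrable A (EFin \o (fun x => \sum_(i <- r) c i * g i x)) /\
    Rintegral mu A (fun x => \sum_(i <- r) c i * g i x) =
    \sum_(i <- r) c i * Rintegral mu A (g i) by [].
elim: r => [|i r [IHi IHe]].
  rewrite big_nil; split.
    rewrite (_ : _ \o _ = cst 0%E); first exact: integrable0.
    by apply/funext => x /=; rewrite big_nil.
  rewrite -[RHS](mul0r (fine (mu A))) -Rintegral_cst//.
  by apply: eq_Rintegral => x _; rewrite big_nil.
have ici : mu.-integrable A (EFin \o (fun x => c i * g i x)).
  exact: (integrableZl mA (c i) (ig i)).
rewrite big_cons -IHe -RintegralZl// -RintegralD//; split.
  have := integrableD mA ici IHi; apply: eq_integrable => // x _.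
  by rewrite /= big_cons EFinD.
by apply: eq_Rintegral => x _; rewrite big_cons.
Qed.

Variable D : 'M[R]_n.
Hypothesis DU : D \in unitmx.
Notation F := (fdom D).
Notation E := ((invmx D)^T).

Definition fvol : R := fine (mu F).

Lemma fvol_gt0 : 0 < fvol. Proof. exact: fdom_gt0. Qed.

Lemma fvolE : mu F = fvol%:E. Proof. by rewrite fineK// fdom_finite. Qed.

Let mF : measurable F. Proof. exact: measurable_fdom. Qed.

Lemma fdom_integrable g (K : R) : mfun g -> (forall u, F u -> `|g u| <= K) ->
  mu.-integrable F (EFin \o g).
Proof.
move=> mg gK; apply/integrableP; split.
  by apply/measurable_EFinP; exact: measurable_funTS.
apply: (@le_lt_trans _ _ (\int[mu]_(x in F) K%:E)%E).
  apply: ge0_le_integral => //.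
  apply: measurableT_comp => //; apply/measurable_EFinP; exact: measurable_funTS.
by rewrite integral_cst//; change (K%:E * mu F < +oo)%E; rewrite fvolE -EFinM ltry.
Qed.

Lemma le_norm_fdom g h (K : R) : mfun g -> mfun h ->
  (forall u, F u -> `|g u| <= h u) -> (forall u, F u -> h u <= K) ->
  `|Rintegral mu F g| <= Rintegral mu F h.
Proof.
move=> mg mh gh hK.
have ig : mu.-integrable F (EFin \o g).
  by apply: (@fdom_integrable _ K) => // u Fu; apply: le_trans (hK u Fu); exact: gh.
have ih : mu.-integrable F (EFin \o h).
  apply: (@fdom_integrable _ K) => // u Fu; rewrite ger0_norm ?hK//.
  by apply: le_trans (gh u Fu).
apply: le_trans (le_normr_Rintegral mF ig) _.
apply: le_Rintegral => //; exact: (integrable_norm ig).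
Qed.

Lemma Rintegral_fdom_cst (c : R) : Rintegral mu F (fun=> c) = c * fvol.
Proof. by rewrite Rintegral_cst. Qed.

Lemma measurable_shift_fun g p : mfun g -> mfun (fun u => g (u + p)).
Proof. by move=> mg; apply: (measurableT_comp mg); exact: measurable_shift. Qed.

Lemma fdom_shift_bound g : mfun g -> rapid g -> exists2 A : R, 0 <= A &
  forall p, mu.-integrable F (EFin \o (fun u => g (u + p))) /\
    `|Rintegral mu F (fun u => g (u + p))| <= A * wgt D p.
Proof.
move=> mg rg; have [A A0 gA] := rapid_wgt DU rg.
exists (A * fvol); first by rewrite mulr_ge0// ltW// fvol_gt0.
move=> p; have mgp := measurable_shift_fun p mg; split.
  by apply: (fdom_integrable mgp) => u Fu; exact: gA.
rewrite mulrAC -Rintegral_fdom_cst.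
by apply: (@le_norm_fdom _ _ (A * wgt D p)) => // u Fu; exact: gA.
Qed.

Lemma Rintegral_tiling g : mfun g -> rapid g ->
  absum (zlat D) (fun p => Rintegral mu F (fun u => g (u + p))) /\
  Rintegral mu setT g = Rsum (zlat D) (fun p => Rintegral mu F (fun u => g (u + p))).
Proof.
have pos h : mfun h -> rapid h -> (forall x, 0 <= h x) ->
    absum (zlat D) (fun p => Rintegral mu F (fun u => h (u + p))) /\
    Rintegral mu setT h =
    Rsum (zlat D) (fun p => Rintegral mu F (fun u => h (u + p))).
  move=> mh rh h0; have [A A0 hA] := fdom_shift_bound mh rh.
  have ah : absum (zlat D) (fun p => Rintegral mu F (fun u => h (u + p))).
    by apply: absum_le (absumZ A (absum_wgt DU)) => p _; have [] := hA p.
  split=> //; apply/esym; apply: has_sumE => //.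
  rewrite /Rintegral (ge0_integral_tiling (zlat_countable DU) (fdom_tiles DU)).
  - rewrite (eq_esum (b := fun p => (Rintegral mu F (fun u => h (u + p)))%:E)).
      by apply: ge0_has_sum => // p; apply: Rintegral_ge0 => u _; exact: h0.
    by move=> p _; rewrite fineK//; apply: integrable_fin_num => //; have [] := hA p.
  - exact/measurable_EFinP.
  - by move=> x; rewrite lee_fin.
move=> mg rg.
have mn : mfun (fun x => `|g x|) by apply: measurableT_comp.
have rn : rapid (fun x => `|g x|).
  by have [A A0 gA] := rg; exists A => // x; rewrite normr_id.
(* A signed [g] is the difference of the nonnegative functions [|g| + g] and [|g|]. *)
have ms : mfun (fun x => `|g x| + g x) by apply: measurable_funD.
have rs : rapid (fun x => `|g x| + g x).
  have [A A0 gA] := rg; exists (A + A); first by rewrite addr_ge0.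
  move=> x; apply: le_trans (ler_normD _ _) _.
  by rewrite normr_id mulrDl lerD// gA.
have [an En] := pos _ mn rn (fun x => normr_ge0 _).
have [|as_ Es] := pos _ ms rs.
  by move=> x; rewrite -lerBlDr sub0r -normrN ler_norm.
have gE x : g x = (`|g x| + g x) - `|g x| by rewrite addrAC subrr add0r.
have pE p : Rintegral mu F (fun u => g (u + p)) =
    Rintegral mu F (fun u => `|g (u + p)| + g (u + p)) +
    (-1) * Rintegral mu F (fun u => `|g (u + p)|).
  rewrite mulN1r -RintegralB//.
  - by apply: eq_Rintegral => u _; exact: gE.
  - by have [A A0 sA] := fdom_shift_bound ms rs; have [] := sA p.
  - by have [A A0 nA] := fdom_shift_bound mn rn; have [] := nA p.
split.
  by rewrite (funext pE); apply: absumD => //; exact: absumZ.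
rewrite (funext pE) RsumD//; last exact: absumZ.
rewrite RsumZ// -Es -En mulN1r -RintegralB//; last 2 first.
- exact: rapid_integrable.
- exact: rapid_integrable.
by apply: eq_Rintegral => u _; exact: gE.
Qed.

Lemma dotp_int p y : zlat D p -> zlat E y -> dotp p y \is a Num.int.
Proof. by move=> Dp; rewrite -dual_zlat// => /(_ p Dp). Qed.

(* Shifting by [s] with [<s, y> = 1/2] changes the sign of the integrand and maps
   the domain to another fundamental domain. *)
Lemma Rintegral_fdom_ph y t : zlat E y -> y != 0 ->
  Rintegral mu F (fun u => ph (dotp u y + t)) = 0.
Proof.
move=> Ey y0.
have [i yi] : exists i, y 0 i != 0.
  apply/existsP; apply: contraR y0; rewrite negb_exists => /forallP y0.
  by apply/eqP/rowP => i; rewrite mxE; apply/eqP; have := y0 i; rewrite negbK.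
pose s : 'rV[R]_n := (2 * y 0 i)^-1 *: delta_mx 0 i.
have sy : dotp s y = 2^-1.
  rewrite /dotp (bigD1 i)//= big1 => [|j ij].
    by rewrite !mxE !eqxx mulr1 addr0 invfM -mulrA mulVf ?mulr1.
  by rewrite !mxE (negPf ij) andbF mulr0 mul0r.
(* Adding 1 makes the integrand nonnegative, as the comparison of the two tilings requires. *)
pose h x : \bar R := (1 + ph (dotp x y + t))%:E.
have mphi t' : mfun (fun x => ph (dotp x y + t')) by exact: measurable_ph.
have mh : measurable_fun setT h.
  by apply/measurable_EFinP; apply: measurable_funD => //; exact: mphi.
have h0 x : (0 <= h x)%E.
  by rewrite lee_fin; have := ph_le1 (dotp x y + t); rewrite ler_norml => /andP[]; lra.
have hp p x : zlat D p -> h (x + p) = h x.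
  move=> Dp; rewrite /h dotpDl; congr (1 + _)%:E.
  by rewrite addrAC (phDint _ (dotp_int Dp Ey)).
have Ts : tiles [set x | F (x - s)] (zlat D).
  have [_ FD] := fdom_tiles DU; split.
    by rewrite -[X in measurable X]setTI; exact: (measurable_shift (- s)).
  move=> x; have [z [[Fz Lz] zU]] := FD (x - s).
  exists (z + s); split; first by split; rewrite /= ?addrK// opprD addrCA addrC.
  move=> z' /= [Fz' Lz']; rewrite (zU (z' - s)) ?subrK//; split=> //.
  by rewrite opprB addrA subrK.
have := ge0_integral_tiles (zlat_countable DU) (@zlatN _ _ D) (fdom_tiles DU) Ts mh h0 hp.
rewrite [X in _ = X](_ : _ = \int[mu]_(x in F) h (x + s)%R)%E; last first.
  rewrite integral_mkcond [RHS]integral_mkcond -(ge0_integral_shift s).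
  - apply: eq_integral => x _; rewrite !patchE.
    rewrite (_ : ((x + s)%R \in _) = (x \in F))//.
    by apply/idP/idP => /set_mem /= xF; apply/mem_set; move: xF; rewrite /= addrK.
  - apply/(measurable_restrictT _ _).1; first by case: Ts.
    exact: measurable_funTS.
  - by move=> x; rewrite patchE; case: ifP.
move=> /(congr1 fine).
have iph t' : mu.-integrable F (EFin \o (fun u => ph (dotp u y + t'))).
  by apply: (@fdom_integrable _ 1) => // u _; exact: ph_le1.
have ic : mu.-integrable F (EFin \o (fun=> 1 : R)).
  by apply: (@fdom_integrable _ 1) => // u _; rewrite normr1.
rewrite -[X in X = _]/(Rintegral mu F (fun x => 1 + ph (dotp x y + t))).
rewrite -[X in _ = X]/(Rintegral mu F (fun x => 1 + ph (dotp (x + s) y + t))).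
rewrite RintegralD// [X in _ = X](_ : _ =
   Rintegral mu F (fun x => 1 - ph (dotp x y + t))).
  by rewrite RintegralB//; lra.
apply: eq_Rintegral => u _; rewrite dotpDl sy -[in RHS]phD2.
by congr (1 + ph _); lra.
Qed.

Definition Qker m x : R := \prod_i qker m ((x *m D) 0 i).

Lemma Qker_ge0 m x : 0 <= Qker m x.
Proof. by apply: prodr_ge0 => i _; exact: qker_ge0. Qed.

Lemma Qker_le m x : Qker m x <= (2 * m).+1%:R ^+ n.
Proof.
rewrite -[leRHS](_ : \prod_(i < n) (2 * m).+1%:R = _); last first.
  by rewrite prodr_const card_ord.
by apply: ler_prod => i _; rewrite qker_ge0 qker_le_nat.
Qed.

Lemma measurable_Qker m : mfun (Qker m).
Proof.
apply: measurable_prod => i _.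
apply: (@measurableT_comp _ _ _ _ _ _ (qker m : measurableTypeR R -> measurableTypeR R)).
  apply: continuous_measurable_fun => t; apply: cvgM; first exact: cvg_cst.
  apply: (@continuous_comp _ _ _ (fun t : R => cos (pi * t)) (fun t => t ^+ (2 * m))).
    apply: (@continuous_comp _ _ _ (fun t : R => pi * t) cos).
      by apply: cvgM; [exact: cvg_cst|exact: cvg_id].
    exact: continuous_cos.
  exact: exprn_continuous.
exact: measurable_coordC.
Qed.

Lemma Qker_periodic m x p : zlat D p -> Qker m (x + p) = Qker m x.
Proof.
by move=> Dp; apply: eq_bigr => i _; rewrite mulmxDl mxE qkerDint//; exact: Dp.
Qed.

Notation J m := {ffun 'I_n -> 'I_(2 * m).+1}.

(** The frequencies of the trigonometric polynomial [Qker]: the points of [zlat E] with all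
    coordinates in [-m, m]. *)
Definition node m (c : J m) : 'rV[R]_n := (\row_i ((c i)%:R - m%:R)) *m D^T.

Definition coef m (c : J m) : R := \prod_i ('C(2 * m, c i)%:R / cbin m).

(** The product over coordinates of [qkerE], multiplied by [e2pi t]; as the kernel is real, taking
    real parts gives the formula for every phase. *)
Lemma Qker_expand m x t :
  \sum_(c : J m) coef c * ph (dotp x (node c) + t) = Qker m x * ph t.
Proof.
pose S := \sum_(c : J m) (coef c)%:C * e2pi (dotp x (node c) + t).
have ReM (a : R) (z : R[i]) : complex.Re (a%:C * z) = a * complex.Re z.
  by case: z => b c /=; rewrite mul0r subr0.
have -> : \sum_(c : J m) coef c * ph (dotp x (node c) + t) = complex.Re S.
  rewrite /S (big_morph (@complex.Re R) (id1 := 0) (op1 := +%R))//.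
    by apply: eq_bigr => c _; rewrite ReM.
  by move=> [? ?] [? ?].
rewrite -(Re_e2pi t) -ReM; congr complex.Re; rewrite /S.
have dE c : dotp x (@node m c) = \sum_i (x *m D) 0 i * ((c i)%:R - m%:R).
  rewrite dotpE /node trmx_mul trmxK mulmxA mxE; apply: eq_bigr => i _.
  by rewrite [X in _ * X]mxE [X in _ * X]mxE.
transitivity ((\prod_i \sum_(j < (2 * m).+1) (('C(2 * m, j)%:R / cbin m)%:C *
    e2pi ((x *m D) 0 i * (j%:R - m%:R)))) * e2pi t).
  rewrite bigA_distr_bigA/= mulr_suml; apply: eq_bigr => c _.
  by rewrite e2piD dE e2pi_sum mulrA /coef rmorph_prod -big_split.
by under eq_bigr do rewrite qkerE; rewrite /Qker rmorph_prod.
Qed.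

Definition zc y i : int := Num.floor ((y *m E) 0 i).

(** The coefficients of [Qker] extended to the whole dual lattice, zero outside the cube of nodes:
    [m] then occurs in the terms and not in the range of summation, as dominated convergence
    needs. *)
Definition alpha m y : R := \prod_i rbin m (absz (zc y i)).

Lemma alpha_ge0 m y : 0 <= alpha m y.
Proof. by apply: prodr_ge0 => i _; exact: rbin_ge0. Qed.

Lemma alpha_le1 m y : alpha m y <= 1.
Proof.
rewrite -[leRHS](_ : \prod_(i < n) (1 : R) = _); last by rewrite big1.
by apply: ler_prod => i _; rewrite rbin_ge0 rbin_le1.
Qed.

Lemma alpha_cvg y : alpha m y @[m --> \oo] --> (1 : R).
Proof.
rewrite /alpha; elim: (index_enum _) => [|i r IHr].
  rewrite (_ : (fun m => _) = cst 1); first exact: cvg_cst.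
  by apply/funext => m; rewrite big_nil.
suff : rbin m (absz (zc y i)) *
     \prod_(j <- r) rbin m (absz (zc y j)) @[m --> \oo] --> (1 * 1 : R).
  rewrite mulr1 (_ : (fun m => rbin m _ * _) =
    fun m => \prod_(j <- i :: r) rbin m (absz (zc y j)))//.
  by apply/funext => m; rewrite big_cons.
by apply: cvgM => //; exact: rbin_cvg.
Qed.

Lemma node_coord m (c : J m) : node c *m E = \row_i ((c i)%:R - m%:R).
Proof. by rewrite /node -mulmxA -trmx_mul mulVmx// trmx1 mulmx1. Qed.

Lemma node_inj m : injective (@node m).
Proof.
move=> c c' /(congr1 (fun y => y *m E)); rewrite !node_coord => /rowP cc'.
apply/ffunP => i; apply/val_inj; have := cc' i; rewrite !mxE => /addIr /eqP.
by rewrite eqr_nat => /eqP.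
Qed.

Lemma coef_alpha m (c : J m) : coef c = alpha m (node c).
Proof.
apply: eq_bigr => i _; rewrite /zc node_coord mxE /rbin; congr (_%:R / _).
have -> : (c i)%:R - m%:R = ((c i)%:Z - m%:Z)%:~R :> R by rewrite intrD intrN.
rewrite intrKfloor; have := ltn_ord (c i) => ci.
have [mc|cm] := leqP m (c i).
  by congr ('C(_, _)); lia.
by rewrite -(@bin_sub (2 * m) (c i)); [congr ('C(_, _)); lia|lia].
Qed.

Lemma sum_node m (G : 'rV[R]_n -> R) :
  \sum_(c : J m) coef c * G (node c) = Rsum (zlat E) (fun y => alpha m y * G y).
Proof.
pose X := [fset node c | c in [fset c : J m | true]%fset]%fset.
rewrite (@Rsum_supp _ _ _ [set` X]) ?Rsum_fset.
- rewrite big_imfset /=; last by move=> c c' _ _; exact: node_inj.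
  rewrite [RHS](perm_big (index_enum (J m))) /=; last first.
    apply: uniq_perm; rewrite ?fset_uniq ?index_enum_uniq// => c.
    by rewrite mem_index_enum !inE.
  by apply: eq_bigr => c _; rewrite coef_alpha.
- move=> y /= /imfsetP[c _ ->] i; rewrite node_coord mxE rpredB// rpred_nat//.
- move=> y Ey yX; rewrite /alpha.
  have [zm|] := pselect (forall i, (absz (zc y i) <= m)%N).
    case: yX; apply/imfsetP.
    exists [ffun i => inord (absz (zc y i + m%:Z))]; first by rewrite inE.
    apply: (can_inj (mulmxK (unitmx_invT DU))); rewrite node_coord.
    apply/rowP => i; rewrite [RHS]mxE ffunE.
    have zi := zm i; rewrite inordK; last by move: zi; lia.
    rewrite -[X in X - _]/((absz (zc y i + m%:Z))%:Z%:~R).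
    rewrite gez0_abs; last by move: zi; lia.
    by rewrite intrD addrK floorK//; exact: Ey.
  move=> /existsNP[i /negP]; rewrite -ltnNge => mi.
  rewrite (bigD1 i)//= (_ : rbin m _ = 0) ?mul0r//.
  by rewrite /rbin bin_small ?mul0r//; move: mi; lia.
Qed.

(** Only the zero frequency [c0] contributes; its coefficient is 1 by the normalization, and every
    other character integrates to 0. *)
Lemma Rintegral_Qker m : Rintegral mu F (Qker m) = fvol.
Proof.
pose c0 : J m := [ffun=> inord m].
have c0E i : c0 i = m :> nat by rewrite ffunE inordK//; lia.
transitivity (Rintegral mu F (fun u => \sum_(c : J m) coef c * ph (dotp u (node c) + 0))).
  apply: eq_Rintegral => u _; rewrite Qker_expand -[X in ph X](mulr0n (1 : R)).
  by rewrite /ph mulr0 cos0 mulr1.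
rewrite (@Rintegral_sumr F)//; last first.
  by move=> c; apply: (@fdom_integrable _ 1); [exact: measurable_ph|move=> u _; exact: ph_le1].
rewrite (bigD1 c0)//= big1 => [|c cc0].
  rewrite addr0 (_ : coef c0 = 1) ?mul1r.
    rewrite (_ : node c0 = 0); last first.
      rewrite /node (_ : \row_i _ = 0) ?mul0mx//; apply/rowP => i.
      by rewrite !mxE c0E subrr.
    rewrite -[RHS]mul1r -Rintegral_fdom_cst; apply: eq_Rintegral => u _.
    by rewrite dotp0r addr0 /ph mulr0 cos0.
  by rewrite /coef big1// => i _; rewrite c0E divff// gt_eqF// cbin_gt0.
rewrite Rintegral_fdom_ph ?mulr0//.
  by move=> i; rewrite node_coord mxE rpredB// rpred_nat.
apply: contra cc0 => /eqP /(congr1 (fun y => y *m E)).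
rewrite node_coord mul0mx => /rowP c0'.
apply/eqP/ffunP => i; apply/val_inj; rewrite /= c0E; have := c0' i.
by rewrite !mxE => /eqP; rewrite subr_eq0 eqr_nat => /eqP.
Qed.

End domain_integral.

(** * The kernel as an approximate identity, and the summation formula *)

Section poisson.
Context {R : realType} (n : nat).
Implicit Types (f g h : 'rV[R]_n -> R) (x y u w p : 'rV[R]_n).
Notation mu := (@lebesgue_rV R n).
Notation mfun g := (measurable_fun setT (g : 'rV[R]_n -> measurableTypeR R)).
Variable D : 'M[R]_n.
Hypothesis DU : D \in unitmx.
Notation F := (fdom D).
Notation E := ((invmx D)^T).

Lemma continuous_dotp w x : {for x, continuous (fun x => dotp x w)}.
Proof.
rewrite /prop_for /continuous_at /dotp; elim: (index_enum _) => [|i r IHr].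
  rewrite (_ : (fun x : 'rV[R]_n => _) = fun=> 0); last first.
    by apply/funext => z; rewrite big_nil.
  by rewrite big_nil; apply: cvg_cst; exact: (nbhs_filter x).
rewrite (_ : (fun z : 'rV[R]_n => \sum_(j <- i :: r) z 0 j * w 0 j) =
  fun z => z 0 i * w 0 i + \sum_(j <- r) z 0 j * w 0 j); last first.
  by apply/funext => z; rewrite big_cons.
rewrite big_cons; apply: (cvgD _ IHr).
exact: (cvgM (@coord_continuous R 1 n 0 i x) (cvg_cst (w 0 i))).
Qed.

Lemma fdom_coord u i : F u -> `|(u *m D) 0 i| <= 2^-1.
Proof. by move=> /(_ i) /andP[? /ltW ?]; rewrite ler_norml; apply/andP. Qed.

Lemma coord_nbhs0 (U : set 'rV[R]_n) : nbhs (0 : 'rV[R]_n) U ->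
  exists2 d : R, 0 < d <= 2^-1 & forall u, (forall i, `|(u *m D) 0 i| < d) -> U u.
Proof.
move=> /nbhs_ballP[e /= e0 eU].
pose K : R := \sum_i \sum_j `|invmx D i j| + 1.
have K0 : 0 < K by rewrite ltr_wpDl// sumr_ge0// => i _; rewrite sumr_ge0.
exists (Num.min 2^-1 (e / K)).
  by rewrite lt_min invr_gt0 ltr0n divr_gt0//= ge_min lexx.
move=> u ud; apply: eU; split=> // i j; rewrite (ord1 i) /ball/= mxE sub0r normrN.
rewrite -(mulmxK DU u) mxE; apply: le_lt_trans (ler_norm_sum _ _ _) _.
apply: (@le_lt_trans _ _ (\sum_i (e / K) * `|invmx D i j|)).
  apply: ler_sum => k _; rewrite normrM ler_wpM2r//.
  by have := ud k; rewrite lt_min => /andP[_ /ltW].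
rewrite -mulr_sumr mulrAC ltr_pdivrMr// ltr_pM2l// /K ltr_pwDr//.
by apply: ler_sum => k _; rewrite (bigD1 j)//= lerDl sumr_ge0.
Qed.

(** One coordinate away from the integers supplies the geometric factor; each of the others costs at
    most [2 m + 1]. *)
Lemma Qker_tail m (d : R) u : 0 < d -> F u -> (exists i, d <= `|(u *m D) 0 i|) ->
  Qker D m u <= (2 * m).+1%:R ^+ n * (cos (pi * d) ^+ 2) ^+ m.
Proof.
move=> d0 Fu [i di]; rewrite /Qker (bigD1 i)//=.
have -> : (2 * m).+1%:R ^+ n =
    (2 * m).+1%:R * \prod_(j < n | j != i) (2 * m).+1%:R :> R.
  rewrite -[LHS](_ : \prod_(j < n) (2 * m).+1%:R = _); first by rewrite (bigD1 i).
  by rewrite prodr_const card_ord.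
rewrite [leRHS]mulrAC; apply: ler_pM.
- exact: qker_ge0.
- by apply: prodr_ge0 => j _; exact: qker_ge0.
- by apply: qker_tail => //; exact: fdom_coord.
by apply: ler_prod => j _; rewrite qker_ge0 qker_le_nat.
Qed.

Lemma kernel_approx g (M : R) : mfun g -> {for 0, continuous g} ->
  (forall u, F u -> `|g u| <= M) ->
  Rintegral mu F (fun u => g u * Qker D m u) @[m --> \oo] --> fvol D * g 0.
Proof.
move=> mg cg gM; have V0 := fvol_gt0 DU.
have F0 : F 0 by move=> i; rewrite mul0mx mxE; apply/andP; split; lra.
have M0 : 0 <= M by apply: le_trans (gM 0 F0).
have mQ := measurable_Qker D.
apply/cvgrPdist_le => e e0.
(* The cube where [g] varies by at most [e'] contributes at most [e' * fvol D = e / 2], since the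
   kernel has mass [fvol D]; elsewhere [|g u - g 0| <= 2 M] is multiplied by the tail [eta], which
   tends to 0. *)
pose e' := e / (2 * fvol D); have e'0 : 0 < e' by rewrite divr_gt0// mulr_gt0.
have [d /andP[d0 d2] gd] : exists2 d : R, 0 < d <= 2^-1 &
    forall u, (forall i, `|(u *m D) 0 i| < d) -> `|g 0 - g u| <= e'.
  by apply: coord_nbhs0; move/cvgrPdist_le : cg; apply.
have rho := cos_pi_lt1 d0 d2.
pose eta m : R := (2 * m).+1%:R ^+ n * (cos (pi * d) ^+ 2) ^+ m.
have eta0 m : 0 <= eta m by rewrite mulr_ge0// exprn_ge0//; case/andP: rho.
have eta2 m : 0 <= 2 * M * eta m by apply: mulr_ge0 (eta0 m); exact: mulr_ge0.
have etac : 2 * M * eta m * fvol D @[m --> \oo] --> (0 : R).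
  rewrite -[X in _ --> X](mul0r (fvol D)); apply: cvgM; last exact: cvg_cst.
  rewrite -[X in _ --> X](mulr0 (2 * M)); apply: cvgM; first exact: cvg_cst.
  exact: poly_geometric_cvg.
have e20 : 0 < e / 2 by rewrite divr_gt0.
move/cvgrPdist_le : etac => /(_ _ e20); apply: filterS => m.
rewrite sub0r normrN ger0_norm; last first.
  exact: mulr_ge0 (eta2 m) (ltW V0).
move=> etam.
have mg0 : mfun (fun u => (g u - g 0) * Qker D m u).
  apply: measurable_funM; last exact: mQ.
  exact: (measurable_funB mg (measurable_cst (g 0))).
have bQ u : `|Qker D m u| <= (2 * m).+1%:R ^+ n.
  by rewrite ger0_norm ?Qker_ge0// Qker_le.
have iQ : mu.-integrable F (EFin \o Qker D m) by apply: (fdom_integrable DU (mQ m)).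
have igQ : mu.-integrable F (EFin \o (fun u => g u * Qker D m u)).
  apply: (@fdom_integrable _ _ _ DU _ (M * (2 * m).+1%:R ^+ n)).
    exact: (measurable_funM mg (mQ m)).
  by move=> u Fu; rewrite normrM ler_pM// gM.
have -> : fvol D * g 0 - Rintegral mu F (fun u => g u * Qker D m u) =
    - Rintegral mu F (fun u => (g u - g 0) * Qker D m u).
  have -> : Rintegral mu F (fun u => (g u - g 0) * Qker D m u) =
      Rintegral mu F (fun u => g u * Qker D m u) - g 0 * Rintegral mu F (Qker D m).
    rewrite -RintegralZl//; last exact: measurable_fdom.
    rewrite -RintegralB//; last 2 first.
    - exact: measurable_fdom.
    - exact: (integrableZl (measurable_fdom D) (g 0) iQ).
    by apply: eq_Rintegral => u _; rewrite mulrBl.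
  by rewrite Rintegral_Qker//; lra.
rewrite normrN.
have mh : mfun (fun u => e' * Qker D m u + 2 * M * eta m).
  exact: (measurable_funD (measurable_funM (measurable_cst e') (mQ m))
    (measurable_cst (2 * M * eta m))).
apply: le_trans (le_norm_fdom DU (K := e' * (2 * m).+1%:R ^+ n + 2 * M * eta m) mg0 mh _ _) _.
- move=> u Fu; rewrite normrM (ger0_norm (Qker_ge0 _ _ _)).
  have Q0 := Qker_ge0 D m u.
  have [ud|] := pselect (forall i, `|(u *m D) 0 i| < d).
    apply: (@le_trans _ _ (e' * Qker D m u)); first by rewrite ler_wpM2r// distrC gd.
    by rewrite lerDl.
  move=> /existsNP[i /negP]; rewrite -leNgt => di.
  apply: (@le_trans _ _ (2 * M * eta m)); last by rewrite lerDr mulr_ge0// ltW.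
  apply: ler_pM => //; last by apply: Qker_tail => //; exists i.
  apply: le_trans (ler_normB _ _) _; have := gM u Fu; have := gM 0 F0; lra.
- by move=> u Fu; rewrite lerD2r ler_wpM2l ?(ltW e'0)// Qker_le.
rewrite RintegralD//; last 3 first.
- exact: measurable_fdom.
- exact: (integrableZl (measurable_fdom D) e' iQ).
- apply: (@fdom_integrable _ _ _ DU _ (2 * M * eta m)) => // u _.
  by rewrite ger0_norm.
rewrite (RintegralZl _ (measurable_fdom D) iQ) Rintegral_Qker// Rintegral_fdom_cst.
have -> : e' * fvol D = e / 2.
  by rewrite /e' invfM mulrA -mulrA mulVf ?mulr1// gt_eqF.
lra.
Qed.

(* Expand [Qker] in [\int f(x) ph(<x, w> + t) Qker m x dx]: this gives the dual
   sum damped by [alpha m].  Cutting the integral into translates of [F] and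
   using the periodicity of [Qker] gives the sum over [zlat D] smoothed by
   [Qker].  Then [m] tends to infinity on both sides, by dominated convergence. *)
Lemma poisson f w t : schwartz f ->
  Rsum (zlat E) (fun y => osc f (y + w) t) =
  fvol D * Rsum (zlat D) (fun x => f x * ph (dotp x w + t)).
Proof.
move=> Sf; have mf := schwartz_measurable Sf; have rf := schwartz_rapid Sf.
have V0 := fvol_gt0 DU.
pose g x := f x * ph (dotp x w + t).
have mg : mfun g by exact: measurable_mul_ph.
have rg : rapid g by exact: rapid_mul_ph.
have cg x : {for x, continuous g}.
  have cf := @schwartz_continuous _ _ f Sf x.
  suff cp : {for x, continuous (fun x => ph (dotp x w + t))} by exact: (cvgM cf cp).
  apply: (@continuous_comp _ _ _ (fun x => dotp x w + t) (@ph R)); last first.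
    exact: continuous_ph.
  have cd : {for x, continuous (fun x => dotp x w)} by exact: continuous_dotp.
  exact: (cvgD cd (cvg_cst t)).
have [A A0 gA] := rapid_wgt DU rg.
have chain m : Rsum (zlat E) (fun y => alpha D m y * osc f (y + w) t) =
    Rsum (zlat D) (fun p => Rintegral mu F (fun u => g (u + p) * Qker D m u)).
  rewrite -(sum_node DU m (fun y => osc f (y + w) t)).
  pose G (c : {ffun 'I_n -> 'I_(2 * m).+1}) x := f x * ph (dotp x (node D c + w) + t).
  have iG c : mu.-integrable setT (EFin \o G c).
    by apply: rapid_integrable; [exact: measurable_mul_ph|exact: rapid_mul_ph].
  rewrite -[LHS](Rintegral_sumr (index_enum _) (@coef R n m) (@measurableT _ _) iG).
  have E1 x : \sum_c (coef c : R) * G c x = g x * Qker D m x.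
    rewrite /g -mulrA [_ * Qker _ _ _]mulrC -Qker_expand mulr_sumr.
    apply: eq_bigr => c _; rewrite mulrCA; congr (_ * (_ * ph _)).
    by rewrite dotpDr addrA.
  under eq_Rintegral do rewrite E1.
  have mgQ : mfun (fun x => g x * Qker D m x).
    exact: (measurable_funM mg (measurable_Qker D m)).
  have rgQ : rapid (fun x => g x * Qker D m x).
    have [B B0 gB] := rg; exists (B * (2 * m).+1%:R ^+ n).
      by rewrite mulr_ge0// exprn_ge0.
    move=> x; rewrite normrM mulrAC ler_pM// ger0_norm ?Qker_ge0//.
    exact: Qker_le.
  rewrite (Rintegral_tiling DU mgQ rgQ).2; apply: eq_Rsum => p Dp.
  by apply: eq_Rintegral => u _; rewrite Qker_periodic.
have lim1 : Rsum (zlat E) (fun y => alpha D m y * osc f (y + w) t) @[m --> \oo] -->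
    Rsum (zlat E) (fun y => osc f (y + w) t).
  apply: (@Rsum_cvg _ _ _ _ _ (fun y => `|osc f (y + w) t|)).
  - move=> m y _; rewrite normrM ler_piMl// ger0_norm ?alpha_ge0//; exact: alpha_le1.
  - apply: absum_norm.
    exact: (@rapid_absum _ _ E (fun y => osc f y t) w (unitmx_invT DU) (osc_rapid t Sf)).
  - move=> y _; rewrite -[X in _ --> X]mul1r; apply: cvgM; last exact: cvg_cst.
    exact: alpha_cvg.
have lim2 : Rsum (zlat D) (fun p => Rintegral mu F (fun u => g (u + p) * Qker D m u))
    @[m --> \oo] --> Rsum (zlat D) (fun p => fvol D * g p).
  apply: (@Rsum_cvg _ _ _ _ _ (fun p => A * fvol D * wgt D p)).
  (* The mass of [Qker] is the same for all [m], which makes the dominating family independent of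
     [m]. *)
  - move=> m p Dp; rewrite mulrAC -(Rintegral_Qker DU m).
    have iQ : mu.-integrable F (EFin \o Qker D m).
      apply: (@fdom_integrable _ _ _ DU _ ((2 * m).+1%:R ^+ n)).
        exact: measurable_Qker.
      by move=> u _; rewrite ger0_norm ?Qker_ge0// Qker_le.
    rewrite -RintegralZl//; last exact: measurable_fdom.
    apply: (@le_norm_fdom _ _ _ DU _ _ (A * wgt D p * (2 * m).+1%:R ^+ n)).
    + exact: (measurable_funM (measurable_shift_fun p mg) (measurable_Qker D m)).
    + exact: (measurable_funM (measurable_cst (A * wgt D p)) (measurable_Qker D m)).
    + move=> u Fu; rewrite normrM (ger0_norm (Qker_ge0 _ _ _)).
      by rewrite ler_wpM2r ?Qker_ge0// gA.
    + by move=> u _; rewrite ler_wpM2l ?Qker_le// mulr_ge0// wgt_ge0.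
  - exact/absumZ/absum_wgt.
  - move=> p Dp; rewrite -[X in g X]add0r.
    apply: (@kernel_approx (fun u => g (u + p)) (A * wgt D p)).
    + exact: measurable_shift_fun.
    + by have := cg p; rewrite continuous_shift.
    + by move=> u Fu; exact: gA.
rewrite -RsumZ//; last first.
  have := rapid_absum 0 DU rg; apply: absum_ext => x _; by rewrite addr0.
apply: (cvg_unique _ lim1) => //.
by rewrite (funext chain).
Qed.

End poisson.

(** * Gaussians separate points *)

Section gauss.
Context {R : realType} (n : nat).
Implicit Types (f g p q : 'rV[R]_n -> R) (x a : 'rV[R]_n).

(** Polynomials as functions, presented by generators: induction then gives closure under
    differentiation and polynomial growth, the two facts that make a Gaussian a Schwartz
    function. *)
Inductive polyfun : ('rV[R]_n -> R) -> Prop :=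
| polyfun_cst (c : R) : polyfun (fun=> c)
| polyfun_coord j : polyfun (fun x => x 0 j)
| polyfun_add p q : polyfun p -> polyfun q -> polyfun (fun x => p x + q x)
| polyfun_mul p q : polyfun p -> polyfun q -> polyfun (fun x => p x * q x).

Lemma polyfun_sum (I : Type) (r : seq I) (p : I -> 'rV[R]_n -> R) :
  (forall i, polyfun (p i)) -> polyfun (fun x => \sum_(i <- r) p i x).
Proof.
move=> pp; elim: r => [|i r IHr].
  rewrite (_ : (fun x => _) = fun=> 0); first exact: polyfun_cst.
  by apply/funext => x; rewrite big_nil.
rewrite (_ : (fun x => _) = fun x => p i x + \sum_(j <- r) p j x).
  exact: polyfun_add.
by apply/funext => x; rewrite big_cons.
Qed.

Lemma polyfun_prod (I : Type) (r : seq I) (p : I -> 'rV[R]_n -> R) :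
  (forall i, polyfun (p i)) -> polyfun (fun x => \prod_(i <- r) p i x).
Proof.
move=> pp; elim: r => [|i r IHr].
  rewrite (_ : (fun x => _) = fun=> 1); first exact: polyfun_cst.
  by apply/funext => x; rewrite big_nil.
rewrite (_ : (fun x => _) = fun x => p i x * \prod_(j <- r) p j x).
  exact: polyfun_mul.
by apply/funext => x; rewrite big_cons.
Qed.

Lemma polyfun_exp p k : polyfun p -> polyfun (fun x => p x ^+ k).
Proof.
move=> pp; rewrite (_ : (fun x => _) = fun x => \prod_(i <- iota 0 k) p x).
  exact: polyfun_prod.
by apply/funext => x; rewrite big_const_seq count_predT size_iota iter_mulr_1.
Qed.

Lemma polyfun_diff p x : polyfun p -> differentiable p x.
Proof.
elim=> [c|j|{}p q _ dp _ dq|{}p q _ dp _ dq].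
- exact: differentiable_cst.
- exact: differentiable_coord.
- exact: differentiableD.
- exact: differentiableM.
Qed.

Lemma derive_coord (v x : 'rV[R]_n) j : 'D_v (fun x => x 0 j) x = v 0 j.
Proof.
apply: cvg_lim => //; apply: cvg_near_cst; near=> h.
rewrite /= !mxE addrK /GRing.scale/= mulrA mulVf ?mul1r//.
by near: h; exact: nbhs_dnbhs_neq.
Unshelve. all: end_near. Qed.

Lemma polyfun_derive p i : polyfun p ->
  exists2 q, polyfun q & forall x, 'D_(delta_mx 0 i) p x = q x.
Proof.
elim=> [c|j|{}p q pp [p' pp' dp] qq [q' qq' dq]|{}p q pp [p' pp' dp] qq [q' qq' dq]].
- by exists (fun=> 0); [exact: polyfun_cst|move=> x; exact: derive_cst].
- by exists (fun=> (delta_mx 0 i : 'rV[R]_n) 0 j);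
    [exact: polyfun_cst|move=> x; exact: derive_coord].
- exists (fun x => p' x + q' x); first exact: polyfun_add.
  move=> x; rewrite -dp -dq.
  by apply: deriveD; apply: diff_derivable; exact: polyfun_diff.
- exists (fun x => p x * q' x + q x * p' x).
    by apply: polyfun_add; exact: polyfun_mul.
  move=> x; rewrite -dp -dq.
  by apply: deriveM; apply: diff_derivable; exact: polyfun_diff.
Qed.

Lemma polyfun_growth p : polyfun p -> exists C k, 0 <= C /\
  forall x, `|p x| <= C * (1 + nrm x) ^+ k.
Proof.
have mono x k l : (k <= l)%N -> (1 + nrm x) ^+ k <= (1 + nrm x) ^+ l.
  by move=> kl; apply: ler_weXn2l => //; rewrite lerDl nrm_ge0.
have pos x k : 0 <= (1 + nrm x) ^+ k by rewrite exprn_ge0// ltW// nrm1_gt0.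
elim=> [c|j|{}p q _ [C [k [C0 pC]]] _ [C' [k' [C'0 qC]]]|
          {}p q _ [C [k [C0 pC]]] _ [C' [k' [C'0 qC]]]].
- by exists `|c|, 0%N; split=> // x; rewrite expr0 mulr1.
- exists 1, 1%N; split=> // x; rewrite expr1 mul1r.
  by apply: le_trans (ler_coord_nrm x j) _; rewrite lerDr.
- exists (C + C'), (maxn k k'); split; first exact: addr_ge0.
  move=> x; apply: le_trans (ler_normD _ _) _; rewrite mulrDl lerD//.
    by apply: le_trans (pC x) _; rewrite ler_wpM2l// mono// leq_maxl.
  by apply: le_trans (qC x) _; rewrite ler_wpM2l// mono// leq_maxr.
- exists (C * C'), (k + k')%N; split; first exact: mulr_ge0.
  by move=> x; rewrite normrM exprD mulrACA ler_pM.
Qed.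

Definition sqdist a x : R := \sum_i (x 0 i - a 0 i) ^+ 2.

Lemma sqdist_ge0 a x : 0 <= sqdist a x.
Proof. by apply: sumr_ge0 => i _; exact: sqr_ge0. Qed.

Lemma polyfun_sqdist c a : polyfun (fun x => c * sqdist a x).
Proof.
apply: polyfun_mul; first exact: polyfun_cst.
apply: polyfun_sum => i; apply: (polyfun_exp 2); apply: polyfun_add.
  exact: polyfun_coord.
exact: polyfun_cst.
Qed.

Definition gauss c a x : R := expR (- c * sqdist a x).

Lemma gauss_diff c a x : differentiable (gauss c a) x.
Proof.
apply: (@differentiable_comp _ _ _ _ (fun x => - c * sqdist a x) expR).
  exact/polyfun_diff/polyfun_sqdist.
exact/derivable1_diffP/derivable_expR.
Qed.

Lemma gauss_derive c a i : exists2 q, polyfun q &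
  forall x, 'D_(delta_mx 0 i) (gauss c a) x = q x * gauss c a x.
Proof.
have [q qq dq] := polyfun_derive i (polyfun_sqdist (- c) a); exists q => // x.
have dp : differentiable (fun x => - c * sqdist a x) x.
  exact/polyfun_diff/polyfun_sqdist.
have de : differentiable (expR : R -> R) (- c * sqdist a x).
  exact/derivable1_diffP/derivable_expR.
rewrite deriveE; last exact: gauss_diff.
rewrite (@diff_comp _ _ _ _ (fun x => - c * sqdist a x) expR)//= -(deriveE _ dp) dq.
by rewrite diff1E// derive1E derive_val.
Qed.

(** Writing the Gaussian as the inverse of a [k.+1]-st power and using [expR s >= 1 + s] in each
    factor reduces the claim to a linear bound of [nrm] by [sqdist]. *)
Lemma gauss_bound c a k : 0 < c -> exists2 C : R, 0 <= C &
  forall x, (1 + nrm x) ^+ k * gauss c a x <= C.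
Proof.
(* [K] is chosen so that [K * (1 + c S / k.+1)] dominates [1 + nrm a + n + S], where [S] is the
   squared distance: the two arguments of the maximum treat the constant and the linear term. *)
move=> c0; pose K := Num.max (1 + nrm a + n%:R) (k.+1%:R / c).
have B0 : 0 <= 1 + nrm a + n%:R by rewrite addr_ge0// ltW// nrm1_gt0.
have K0 : 0 <= K by rewrite le_max B0.
exists (K ^+ k.+1); first by rewrite exprn_ge0.
move=> x; have S0 := sqdist_ge0 a x; have x1 := nrm1_gt0 x.
have e0 : 0 < gauss c a x by exact: expR_gt0.
apply: (@le_trans _ _ ((1 + nrm x) ^+ k.+1 * gauss c a x)).
  by rewrite ler_pM2r// ler_weXn2l// lerDl nrm_ge0.
have k0 : 0 < k.+1%:R :> R by [].
have -> : gauss c a x = (expR (c * sqdist a x / k.+1%:R) ^+ k.+1)^-1.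
  by rewrite -expRM_natr divfK ?gt_eqF// -expRN /gauss mulNr.
rewrite ler_pdivrMr ?exprn_gt0 ?expR_gt0// -exprMn.
apply: lerXn2r; first by rewrite nnegrE ltW.
  by rewrite nnegrE mulr_ge0// expR_ge0.
apply: (@le_trans _ _ (K * (1 + c * sqdist a x / k.+1%:R))); last first.
  by rewrite ler_wpM2l// expR_ge1Dx.
have xS : nrm x <= nrm a + (n%:R + sqdist a x).
  have := nrmD (x - a) a; rewrite subrK addrC => /le_trans; apply; rewrite lerD2l.
  have -> : n%:R = \sum_(i < n) (1 : R) by rewrite sumr_const card_ord.
  rewrite -big_split; apply: ler_sum => i _; rewrite !mxE /=.
  rewrite -[X in _ <= 1 + X]real_normK ?num_real//.
  by have := normr_ge0 (x 0 i - a 0 i); move: `|_| => t; nra.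
rewrite mulrDr mulr1.
apply: (@le_trans _ _ (1 + nrm a + n%:R + sqdist a x)).
  by rewrite -!addrA lerD2l.
apply: lerD; first by rewrite /K le_max lexx.
have Kk : k.+1%:R / c <= K by rewrite /K le_max lexx orbT.
rewrite !mulrA ler_pdivlMr// mulrC ler_wpM2r//.
by rewrite -ler_pdivrMr.
Qed.

Lemma gauss_partials c a s : exists2 q, polyfun q &
  partials s (gauss c a) = fun x => q x * gauss c a x.
Proof.
elim: s => [|i s [q qq sE]].
  by exists (fun=> 1); [exact: polyfun_cst|apply/funext => x; rewrite mul1r].
have [q' qq' dq] := polyfun_derive i qq.
have [r rr dr] := gauss_derive c a i.
exists (fun x => q x * r x + q' x).
  by apply: polyfun_add => //; exact: polyfun_mul.
apply/funext => x; rewrite /= sE.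
transitivity (q x *: 'D_(delta_mx 0 i) (gauss c a) x +
    gauss c a x *: 'D_(delta_mx 0 i) q x).
  apply: deriveM; apply: diff_derivable; first exact: polyfun_diff.
  exact: gauss_diff.
by rewrite dq dr /GRing.scale/=; ring.
Qed.

Lemma gauss_schwartz c a : 0 < c -> schwartz (gauss c a).
Proof.
move=> c0; split=> [s x|s b]; have [q qq ->] := gauss_partials c a s.
  apply: differentiableM; [exact: polyfun_diff|exact: gauss_diff].
have /polyfun_growth[C [k [C0 hC]]] :
    polyfun (fun x => \prod_(i < n) x 0 i ^+ b i * q x).
  apply: polyfun_mul => //; apply: polyfun_prod => i; apply: polyfun_exp.
  exact: polyfun_coord.
have [B B0 hB] := gauss_bound a k c0.
exists (C * B) => x; rewrite mulrA normrM (ger0_norm (expR_ge0 _)).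
apply: (@le_trans _ _ (C * (1 + nrm x) ^+ k * gauss c a x)).
  by rewrite ler_wpM2r ?expR_ge0.
by rewrite -mulrA ler_wpM2l.
Qed.

(** The test functions are powers of one Gaussian that is 1 at [a] and less than 1 elsewhere, so
    they tend to the indicator of [a] and all lie below the first one, which dominates. *)
Lemma gauss_separates (A : set 'rV[R]_n) (c : 'rV[R]_n -> R) a :
  (forall f, schwartz f -> absum A f) -> A a ->
  (exists B : R, forall x, `|c x| <= B) ->
  (forall f, schwartz f -> Rsum A (fun x => f x * c x) = 0) -> c a = 0.
Proof.
move=> Aab Aa [B cB] f0.
pose f m := gauss m.+1%:R a.
have Sf m : schwartz (f m) by exact: gauss_schwartz.
have fE m x : f m x = f 0%N x ^+ m.+1.
  by rewrite /f /gauss -expRM_natl mulN1r mulrN mulNr.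
have f0_le1 x : 0 <= f 0%N x <= 1.
  by rewrite expR_ge0/= -expR0 ler_expR mulN1r lerNl oppr0 sqdist_ge0.
have lim : Rsum A (fun x => f m x * c x) @[m --> \oo] -->
    Rsum A (fun x => (x == a)%:R * c x).
  apply: (@Rsum_cvg _ _ _ _ _ (fun x => B * f 0%N x)).
  - move=> m x _; rewrite normrM mulrC; have /andP[x0 x1] := f0_le1 x.
    apply: ler_pM => //; rewrite fE ger0_norm ?exprn_ge0//.
    by rewrite exprS ler_piMr// exprn_ile1.
  - exact/absumZ/Aab.
  - move=> x _; apply: cvgM; last exact: cvg_cst.
    have /andP[x0 x1] := f0_le1 x.
    have [->|xa] := eqVneq x a.
      rewrite (_ : (fun m => _) = cst 1); first exact: cvg_cst.
      apply/funext => m; rewrite /f /gauss /sqdist big1 ?mulr0 ?expR0//.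
      by move=> i _; rewrite subrr expr0n.
    rewrite (_ : (fun m => _) = fun m => f 0%N x ^+ m.+1); last exact/funext.
    rewrite (cvg_shiftS (fun m => f 0%N x ^+ m)); apply: cvg_expr.
    rewrite ger0_norm// /f /gauss expR_lt1 mulN1r oppr_lt0 lt_neqAle sqdist_ge0 andbT.
    rewrite eq_sym; apply: contra xa => /eqP S0; apply/eqP/rowP => i.
    apply/eqP; rewrite -subr_eq0 -sqrf_eq0.
    have /psumr_eq0P : forall i : 'I_n, true -> 0 <= (x 0 i - a 0 i) ^+ 2.
      by move=> j _; exact: sqr_ge0.
    by move=> /(_ S0) /(_ i isT) ->.
have -> : c a = Rsum A (fun x => (x == a)%:R * c x).
  rewrite (@Rsum_supp _ _ _ [set` [fset a]%fset]).
  - by rewrite Rsum_fset big_seq_fset1 eqxx mul1r.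
  - by move=> x /=; rewrite inE => /eqP ->.
  - by move=> x _ /=; rewrite inE => /negP /negPf ->; rewrite mul0r.
apply/esym; apply: (cvg_unique _ _ lim) => //.
rewrite (_ : (fun m => _) = cst 0); first exact: cvg_cst.
by apply/funext => m; rewrite f0.
Qed.

End gauss.

(** * Difference multisets and finite Fourier transforms *)

Section finite_duality.
Context (V : zmodType).

Definition diff_count (N : nat) (v : 'I_N -> V) (x : V) : nat :=
  #|[pred jk : 'I_N * 'I_N | x == v jk.1 - v jk.2]|.

Lemma diff_countE (A : nzRingType) (N : nat) (v : 'I_N -> V) x :
  (diff_count v x)%:R = \sum_j \sum_k (x == v j - v k)%:R :> A.
Proof.
rewrite /diff_count -sum1_card natr_sum pair_bigA /= big_mkcond/=.
by apply: eq_bigr => -[j k] _ /=; rewrite inE/=; case: eqP.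
Qed.

Lemma sum_eq_inj (A : nzRingType) (N : nat) (v : 'I_N -> V) j : injective v ->
  \sum_k (v j == v k)%:R = 1 :> A.
Proof.
move=> vinj; rewrite (bigD1 j)//= eqxx big1 ?addr0// => k kj.
by rewrite (inj_eq vinj) eq_sym (negPf kj).
Qed.

Lemma diff_count0 (A : nzRingType) (N : nat) (v : 'I_N -> V) : injective v ->
  (diff_count v 0)%:R = N%:R :> A.
Proof.
move=> vinj; rewrite diff_countE -[N in RHS]card_ord -sumr_const.
apply: eq_bigr => j _; rewrite -[RHS](sum_eq_inj _ j vinj); apply: eq_bigr => k _.
by rewrite eq_sym subr_eq0.
Qed.

End finite_duality.

(** * The transfer from (1) to (1') for an abstract pairing, usable in both directions *)

Section duality_transfer.
Context {R : realType} (V W : zmodType).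
Variables (G : set V) (H : set W) (b : V -> W -> R[i]).
Variables (N M : nat) (v : 'I_N -> V) (w : 'I_M -> W).
Hypothesis finH : finite_set H.
Hypotheses (G0 : G 0) (GB : forall x y, G x -> G y -> G (x - y)).
Hypotheses (HB : forall x y, H x -> H y -> H (x - y)).
Hypotheses (bBl : forall x x' y, G x -> G x' -> H y -> b (x - x') y = b x y * (b x' y)^*).
Hypotheses (bBr : forall x y y', G x -> H y -> H y' -> b x (y - y') = b x y * (b x y')^*).
Hypothesis orthH : forall x, G x ->
  \sum_(y <- fset_set H) b x y = (x == 0)%:R * #|` fset_set H|%:R.
Hypotheses (Gv : forall j, G (v j)) (Hw : forall j, H (w j)).
Hypotheses (vinj : injective v) (N0 : (0 < N)%N) (M0 : (0 < M)%N).

Let M0r : M%:R != 0 :> R[i]. Proof. by rewrite pnatr_eq0 -lt0n. Qed.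
Let N0r : N%:R != 0 :> R[i]. Proof. by rewrite pnatr_eq0 -lt0n. Qed.

Definition sqmean (I : nat) (z : 'I_I -> R[i]) : R[i] :=
  `|I%:R^-1 * \sum_j z j| ^+ 2.

Lemma sqmeanE (I : nat) (z : 'I_I -> R[i]) :
  sqmean z = I%:R^-2 * \sum_j \sum_k z j * (z k)^*.
Proof.
rewrite /sqmean normCK rmorphM /= rmorph_sum fmorphV rmorph_nat mulrACA -expr2 exprVn.
by congr (_ * _); rewrite mulr_suml; apply: eq_bigr => j _; rewrite mulr_sumr.
Qed.

Let sum_delta (g : W -> R[i]) d : H d ->
  \sum_(y <- fset_set H) (y == d)%:R * g y = g d.
Proof.
move=> Hd; have dH : d \in fset_set H by rewrite in_fset_set//; exact: mem_set.
rewrite (bigD1_seq _ dH (fset_uniq _))/= eqxx mul1r big1 ?addr0// => y /negPf ->.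
by rewrite mul0r.
Qed.

(* Multiply the hypothesis by the conjugate of [b x y] and sum over [y]. *)
Lemma duality_transfer : (forall y, H y -> b 0 y = 1) ->
  (forall y, H y -> sqmean (fun j => b (v j) y) = M%:R^-1 * (diff_count w y)%:R) ->
  (forall x, G x -> sqmean (fun j => b x (w j)) = N%:R^-1 * (diff_count v x)%:R) /\
  #|` fset_set H| = (N * M)%N.
Proof.
move=> b0y C1.
have inH (P : W -> Prop) : (forall y, H y -> P y) -> forall y, y \in fset_set H -> P y.
  by move=> HP y; rewrite in_fset_set// => /set_mem; exact: HP.
have key x : G x -> N%:R^-2 * (#|` fset_set H|%:R * (diff_count v x)%:R) =
    M%:R * sqmean (fun j => b x (w j)).
  move=> Gx.
  transitivity (\sum_(y <- fset_set H) sqmean (fun j => b (v j) y) * (b x y)^*).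
    (* By orthogonality, the sum of [b (v j - v k - x) y] over [H] detects whether
       [x = v j - v k]. *)
    transitivity (\sum_(y <- fset_set H) N%:R^-2 * \sum_j \sum_k b (v j - v k - x) y).
      rewrite -mulr_sumr exchange_big/= diff_countE mulr_sumr; congr (_ * _).
      apply: eq_bigr => j _; rewrite exchange_big/= mulr_sumr; apply: eq_bigr => k _.
      rewrite orthH; last by apply: (GB (GB _ _)).
      by rewrite subr_eq0 eq_sym mulrC.
    apply: eq_big_seq; apply: inH => y Hy.
    rewrite sqmeanE -mulrA mulr_suml; congr (_ * _); apply: eq_bigr => j _.
    rewrite mulr_suml; apply: eq_bigr => k _.
    by rewrite bBl//; [rewrite bBl|exact: GB].
  transitivity (\sum_(y <- fset_set H) M%:R^-1 *
      \sum_j \sum_k (y == w j - w k)%:R * (b x y)^*).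
    apply: eq_big_seq; apply: inH => y Hy; rewrite C1// diff_countE -mulrA.
    by congr (_ * _); rewrite mulr_suml; apply: eq_bigr => j _; rewrite mulr_suml.
  rewrite sqmeanE mulrA [in RHS]expr2 invfM mulrA divff// mul1r -mulr_sumr.
  congr (_ * _); rewrite exchange_big/= [RHS]exchange_big/=.
  apply: eq_bigr => j _; rewrite exchange_big/=; apply: eq_bigr => k _.
  rewrite (sum_delta (fun y => (b x y)^*)); last exact: HB.
  by rewrite bBr// rmorphM /= conjcK mulrC.
have s0 : sqmean (fun j => b 0 (w j)) = 1.
  rewrite /sqmean (eq_bigr (fun=> 1)) => [|j _]; last exact: b0y.
  by rewrite sumr_const card_ord mulVf// normr1 expr1n.
have cardH : #|` fset_set H|%:R = N%:R * M%:R :> R[i].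
  have := key 0 G0; rewrite s0 mulr1 diff_count0// => <-.
  by field.
split; last by apply/eqP; rewrite -(eqr_nat R[i]) natrM cardH.
by move=> x Gx; apply: (mulfI M0r); rewrite -key// cardH; field.
Qed.

End duality_transfer.

Lemma powR_3half {R : realType} (x : R) : 0 < x -> x `^ (3 / 2) = x * Num.sqrt x.
Proof.
move=> x0; rewrite (_ : 3 / 2 = 1 + 2^-1); last by lra.
by rewrite powRD ?gt_eqF ?implybT// powRr1 ?(ltW x0)// powR12_sqrt// ltW.
Qed.

Lemma conjM_conj {R : realType} (y z : R[i]) : (y * z^*)^* = z * y^*.
Proof. by rewrite rmorphM /= conjcK mulrC. Qed.

(** * Condition (1') against condition (2) *)

Section dft_form.
Context {R : realType} (V W : zmodType).
Variables (G : set V) (b : V -> W -> R[i]).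
Variables (N M : nat) (v : 'I_N -> V) (w : 'I_M -> W).
Hypotheses (finG : finite_set G) (G0 : G 0).
Hypotheses (Gv : forall j k, G (v j - v k)).
Hypotheses (bBw : forall x j k, G x -> b x (w j - w k) = b x (w j) * (b x (w k))^*).
Hypothesis bw0 : forall j, b 0 (w j) = 1.
Hypotheses (vinj : injective v) (N0 : (0 < N)%N) (M0 : (0 < M)%N).

Let g : R := #|` fset_set G|%:R.

Let sum_dft (f : V -> R[i]) : \sum_j \sum_k dft G b f (w j - w k) =
  (Num.sqrt g)^-1%:C * (M%:R ^+ 2 *
    \sum_(x <- fset_set G) f x * sqmean (fun j => b x (w j))).
Proof.
rewrite /dft -/g.
under eq_bigr do rewrite -mulr_sumr.
rewrite -mulr_sumr; congr (_ * _).
transitivity (\sum_j \sum_k \sum_(x <- fset_set G) f x * (b x (w j) * (b x (w k))^*)^*).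
  apply: eq_bigr => j _; apply: eq_bigr => k _; rewrite fsbig_finite//.
  by apply: eq_big_seq => x; rewrite in_fset_set// => /set_mem Gx; rewrite bBw.
transitivity (\sum_j \sum_(x <- fset_set G) \sum_k f x * (b x (w j) * (b x (w k))^*)^*).
  by apply: eq_bigr => j _; rewrite exchange_big.
rewrite exchange_big mulr_sumr/=; apply: eq_bigr => x _.
have M0r : M%:R != 0 :> R[i] by rewrite pnatr_eq0 -lt0n.
rewrite sqmeanE mulrCA (mulrA (M%:R ^+ 2)) divff ?expf_neq0// mul1r.
rewrite exchange_big mulr_sumr/=; apply: eq_bigr => j _.
rewrite mulr_sumr; apply: eq_bigr => k _.
by congr (_ * _); exact: conjM_conj.
Qed.

Let sum_count (f : V -> R[i]) : \sum_j \sum_k f (v j - v k) =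
  \sum_(x <- fset_set G) f x * (diff_count v x)%:R.
Proof.
under [RHS]eq_bigr do rewrite diff_countE mulr_sumr.
rewrite [RHS]exchange_big/=; apply: eq_bigr => j _.
under [RHS]eq_bigr do rewrite mulr_sumr.
rewrite [RHS]exchange_big/=; apply: eq_bigr => k _.
have dG : v j - v k \in fset_set G by rewrite in_fset_set//; exact: mem_set.
rewrite (bigD1_seq _ dG (fset_uniq _))/= eqxx mulr1 big1 ?addr0// => y /negPf ->.
by rewrite mulr0.
Qed.

Let sqmean_at0 : sqmean (fun j => b 0 (w j)) = 1.
Proof.
have M0r : M%:R != 0 :> R[i] by rewrite pnatr_eq0 -lt0n.
rewrite /sqmean (eq_bigr (fun=> 1)) => [|j _]; last exact: bw0.
by rewrite sumr_const card_ord mulVf// normr1 expr1n.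
Qed.

Lemma sqmean_dft :
  (forall x, G x -> sqmean (fun j => b x (w j)) = N%:R^-1 * (diff_count v x)%:R) ->
  #|` fset_set G| = (N * M)%N ->
  forall f : V -> R[i],
    ((N%:R `^ (3 / 2))^-1)%:C * \sum_j \sum_k f (v j - v k) =
    ((M%:R `^ (3 / 2))^-1)%:C * \sum_j \sum_k dft G b f (w j - w k).
Proof.
move=> C1 cardG f; rewrite sum_dft sum_count.
have N0r : 0 < N%:R :> R by rewrite ltr0n.
have M0r : 0 < M%:R :> R by rewrite ltr0n.
have -> : \sum_(x <- fset_set G) f x * sqmean (fun j => b x (w j)) =
    (N%:R^-1)%:C * \sum_(x <- fset_set G) f x * (diff_count v x)%:R.
  rewrite mulr_sumr; apply: eq_big_seq => x; rewrite in_fset_set// => /set_mem Gx.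
  by rewrite C1// mulrCA fmorphV rmorph_nat.
rewrite -(rmorph_nat (real_complex R) M) -rmorphXn !mulrA -!rmorphM/=; congr (_%:C * _).
(* With [|G| = N M] the constants match: [N^(-3/2) = M^(-3/2) (N M)^(-1/2) M^2 N^(-1)], an identity
   of rational functions in the square roots of [N] and [M]. *)
rewrite !powR_3half// /g cardG natrM sqrtrM ?ler0n//.
have sN : Num.sqrt N%:R ^+ 2 = N%:R :> R by rewrite sqr_sqrtr.
have sM : Num.sqrt M%:R ^+ 2 = M%:R :> R by rewrite sqr_sqrtr.
have sN0 : Num.sqrt N%:R != 0 :> R by rewrite gt_eqF// sqrtr_gt0.
have sM0 : Num.sqrt M%:R != 0 :> R by rewrite gt_eqF// sqrtr_gt0.
rewrite -sN -sM !sqrtr_sqr !ger0_norm ?sqrtr_ge0//.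
by field; rewrite sN0 sM0.
Qed.

Lemma dft_sqmean :
  (forall f : V -> R[i],
    ((N%:R `^ (3 / 2))^-1)%:C * \sum_j \sum_k f (v j - v k) =
    ((M%:R `^ (3 / 2))^-1)%:C * \sum_j \sum_k dft G b f (w j - w k)) ->
  forall x, G x -> sqmean (fun j => b x (w j)) = N%:R^-1 * (diff_count v x)%:R.
Proof.
move=> C2.
have delta (h : V -> R[i]) x : G x -> \sum_(y <- fset_set G) (y == x)%:R * h y = h x.
  move=> Gx; have xG : x \in fset_set G by rewrite in_fset_set//; exact: mem_set.
  rewrite (bigD1_seq _ xG (fset_uniq _))/= eqxx mul1r big1 ?addr0// => y /negPf ->.
  by rewrite mul0r.
pose a : R[i] := ((N%:R `^ (3 / 2))^-1)%:C.
pose c : R[i] := ((M%:R `^ (3 / 2))^-1)%:C * ((Num.sqrt g)^-1%:C * M%:R ^+ 2).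
have E x : G x -> a * (diff_count v x)%:R = c * sqmean (fun j => b x (w j)).
  move=> Gx; have := C2 (fun y => (y == x)%:R).
  rewrite sum_dft (sum_count (fun y => (y == x)%:R)) (delta (fun y => (diff_count v y)%:R) x Gx).
  by rewrite (delta (fun y => sqmean (fun j => b y (w j))) x Gx) /a /c !mulrA.
have a0 : a != 0.
  by rewrite /a fmorphV invr_eq0 fmorph_eq0 gt_eqF// powR_gt0// ltr0n.
have N0r : N%:R != 0 :> R[i] by rewrite pnatr_eq0 -lt0n.
move=> x Gx; have := E 0 G0; rewrite sqmean_at0 mulr1 diff_count0// => cE.
have := E x Gx; rewrite -cE -mulrA => /(mulfI a0) ->.
by rewrite mulKf.
Qed.

End dft_form.

(** * The finite group [M^*/L] *)

Section torus_group.
Context {R : realType} (n : nat) (L M : lattice R n).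
Hypothesis LM : lattice_set L `<=` dual M.
Notation G := (torus_image L (dual M)).
Notation H := (torus_image M (dual L)).
Notation piL := (\pi_(torus L)).
Notation piM := (\pi_(torus M)).
Notation b := (torus_pairing L M).

Lemma pi_eq (K : lattice R n) (x y : 'rV[R]_n) :
  (\pi_(torus K) x = \pi_(torus K) y) <-> lattice_set K (x - y).
Proof.
split=> [/eqP|/lattice_inP Kxy]; first by rewrite -Quotient.idealrBE => /lattice_inP.
by apply/eqP; rewrite -Quotient.idealrBE.
Qed.

Lemma piB (K : lattice R n) x y :
  \pi_(torus K) (x - y) = \pi_(torus K) x - \pi_(torus K) y.
Proof. by rewrite raddfB. Qed.

Lemma pi0 (K : lattice R n) : \pi_(torus K) 0 = 0.
Proof. by rewrite raddf0. Qed.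

Lemma repr_pi (K : lattice R n) x : lattice_set K (repr (\pi_(torus K) x) - x).
Proof. by apply/pi_eq; rewrite reprK. Qed.

Lemma dualB (A : set 'rV[R]_n) x y : dual A x -> dual A y -> dual A (x - y).
Proof. by move=> Ax Ay z Az; rewrite dotpBr rpredB//; [exact: Ax|exact: Ay]. Qed.

Lemma dual_0 (A : set 'rV[R]_n) : dual A 0.
Proof. by move=> z Az; rewrite dotp0r. Qed.

Lemma dualD (A : set 'rV[R]_n) x y : dual A x -> dual A y -> dual A (x + y).
Proof. by move=> Ax Ay z Az; rewrite dotpDr rpredD//; [exact: Ax|exact: Ay]. Qed.

(** Other representatives differ by [l] in [L] and [m] in [M], which adds [dotp l y], [dotp x m] and
    [dotp l m] to the exponent; all are integers, the last by [LM]. *)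
Lemma torus_pairingE x y : dual M x -> dual L y -> b (piL x) (piM y) = e2pi (dotp x y).
Proof.
move=> dx dy; rewrite /torus_pairing.
have Lx := repr_pi L x; have My := repr_pi M y.
rewrite -[repr (piL x)](subrK x) -[repr (piM y)](subrK y).
move: (repr _ - x) (repr _ - y) Lx My => l m Ll Mm.
rewrite dotpDl !dotpDr !e2piD.
have lm : dotp l m \is a Num.int by rewrite dotpC; exact: LM.
have ly : dotp l y \is a Num.int by exact: dy.
have xm : dotp x m \is a Num.int by rewrite dotpC; exact: dx.
by rewrite (e2pi_int lm) (e2pi_int ly) (e2pi_int xm) !mul1r.
Qed.

Lemma torus_pairing_sym (x : torus L) (y : torus M) :
  torus_pairing M L y x = b x y.
Proof. by rewrite /torus_pairing dotpC. Qed.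

Lemma torus_image0 (K K' : lattice R n) : torus_image K (dual K') 0.
Proof. by exists 0; [exact: dual_0|exact: pi0]. Qed.

Lemma torus_imageB (K K' : lattice R n) x y : torus_image K (dual K') x ->
  torus_image K (dual K') y -> torus_image K (dual K') (x - y).
Proof.
by move=> [x' dx <-] [y' dy <-]; exists (x' - y'); [exact: dualB|exact: piB].
Qed.

Lemma pairingBl x x' y : G x -> G x' -> H y -> b (x - x') y = b x y * (b x' y)^*.
Proof.
move=> [u du <-] [u' du' <-] [z dz <-]; rewrite -piB !torus_pairingE//; last exact: dualB.
by rewrite dotpBl e2piD e2piN.
Qed.

Lemma pairingBr x y y' : G x -> H y -> H y' -> b x (y - y') = b x y * (b x y')^*.
Proof.
move=> [u du <-] [z dz <-] [z' dz' <-]; rewrite -piB !torus_pairingE//; last exact: dualB.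
by rewrite dotpBr e2piD e2piN.
Qed.

Lemma pairing0l y : H y -> b 0 y = 1.
Proof.
by move=> [z dz <-]; rewrite -(pi0 L) torus_pairingE ?dotp0l ?e2pi0//; exact: dual_0.
Qed.

Lemma pairing0r x : G x -> b x 0 = 1.
Proof.
by move=> [z dz <-]; rewrite -(pi0 M) torus_pairingE ?dotp0r ?e2pi0//; exact: dual_0.
Qed.

Lemma dual_lattice : exists2 D, D \in unitmx & dual M = zlat D /\
  lattice_set M = zlat (invmx D)^T.
Proof.
have [B BU ME] := lattice_basis M.
exists (invmx B)^T; first exact: unitmx_invT.
rewrite ME dual_zlat//; split=> //.
by rewrite -dual_zlat ?unitmx_invT// -dual_zlat// dualK.
Qed.

Lemma dual_dual_lattice x : dual (dual M) x -> lattice_set M x.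
Proof. by have [B BU ->] := lattice_basis M; rewrite dualK. Qed.

(** Every class has a representative in the bounded domain of [L], and there the integer coordinates
    of points of [dual M] are bounded. *)
Lemma torus_image_finite : finite_set G.
Proof.
have [D DU [dE _]] := dual_lattice; have [C CU LE] := lattice_basis L.
have [K K0 FK] := fdom_bounded CU.
pose B := \sum_i \sum_j K * `|D j i|.
pose N := (Num.truncn B).+1.
pose phi (k : {ffun 'I_n -> 'I_(2 * N).+1}) : torus L :=
  piL ((\row_i ((k i)%:R - N%:R)) *m invmx D).
apply: (@sub_finite_set _ _ (range phi)); last exact: finite_image.
move=> _ [x dx <-].
pose u := x - round C x *m invmx C.
have Lr : lattice_set L (round C x *m invmx C).
  by rewrite LE => i; rewrite mulmxKV// mxE intr_int.
have Fu : fdom C u.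
  have [_ /(_ x)[y [[Fy Ly] _]]] := fdom_tiles CU.
  move=> i; rewrite mulmxBl mulmxKV// mxE [X in _ + X]mxE [round _ _ _ _]mxE.
  have := floor_itv ((x *m C) 0 i + 2^-1); rewrite intrD.
  by move: (x *m C) => z /andP[? ?]; apply/andP; split; lra.
have du : dual M u by apply: dualB => //; exact: LM.
have -> : piL x = piL u by apply/pi_eq; rewrite subKr.
have uB i : `|(u *m D) 0 i| <= B.
  rewrite mxE; apply: le_trans (ler_norm_sum _ _ _) _.
  apply: (@le_trans _ _ (\sum_j K * `|D j i|)).
    by apply: ler_sum => j _; rewrite normrM ler_wpM2r// FK.
  rewrite [leRHS](bigD1 i)//= lerDl; apply: sumr_ge0 => j _; apply: sumr_ge0 => l _.
  exact: mulr_ge0.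
pose z i : int := Num.floor ((u *m D) 0 i).
have zE i : (u *m D) 0 i = (z i)%:~R.
  by rewrite /z floorK//; move: du; rewrite dE; apply.
have zN i : (absz (z i) <= N)%N.
  rewrite -(ler_nat R) natr_absz intr_norm -zE (le_trans (uB i))//.
  by rewrite ltW// truncnS_gt.
exists [ffun i => inord (absz (z i + N%:Z))] => //.
rewrite /phi; congr (piL _); rewrite -[RHS](mulmxK DU); congr (_ *m _).
apply/rowP => i; rewrite zE [LHS]mxE ffunE; have zi := zN i.
rewrite inordK; last by move: zi; lia.
rewrite -[X in X - _]/((absz (z i + N%:Z))%:Z%:~R).
rewrite gez0_abs; last by move: zi; lia.
by rewrite intrD addrK.
Qed.

(** A trivial pairing means integral inner products with all of [dual M], and the bidual of [M] is
    [M]. *)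
Lemma pairing_nondegenerate y : H y -> (forall x, G x -> b x y = 1) -> y = 0.
Proof.
move=> [z dz <-] bz; rewrite -(pi0 M); apply/pi_eq; rewrite subr0.
apply: dual_dual_lattice => x dx; apply: e2pi_eq1.
by rewrite -torus_pairingE// bz//; exists x.
Qed.

Lemma pairing_orthogonal y : H y ->
  \sum_(x <- fset_set G) b x y = (y == 0)%:R * #|` fset_set G|%:R.
Proof.
move=> Hy; have finG := torus_image_finite.
have inG x : x \in fset_set G -> G x by rewrite in_fset_set// => /set_mem.
have [->|y0] := eqVneq y 0.
  rewrite mul1r (eq_big_seq (fun=> 1)) => [|x /inG Gx]; last exact: pairing0r.
  by rewrite big_const_seq count_predT iter_addr_0.
rewrite mul0r.
have [x0 Gx0 bx0] : exists2 x0, G x0 & b x0 y != 1.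
  apply: contrapT => nox; move/eqP: y0; apply; apply: pairing_nondegenerate => // x Gx.
  by apply: contrapT => /eqP bx; apply: nox; exists x.
pose S := \sum_(x <- fset_set G) b x y.
have SE : S = S * (b x0 y)^*.
  rewrite {1}/S -fsbig_finite// (reindex_fsbig (fun x => x - x0) G G); last first.
    split.
    - by move=> x Gx; exact: torus_imageB.
    - by move=> x x' _ _ /addIr.
    - move=> x Gx; exists (x + x0); last by rewrite addrK.
      rewrite -[x0]opprK -[- x0]sub0r; apply: torus_imageB => //.
      by apply: torus_imageB => //; exact: torus_image0.
  rewrite /S -fsbig_finite// mulr_fsuml; apply: eq_fsbigr => x /set_mem Gx.
  by rewrite pairingBl.
have : S * (1 - (b x0 y)^*) = 0 by rewrite mulrBr mulr1 -SE subrr.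
move/eqP; rewrite mulf_eq0 => /orP[/eqP//|].
rewrite subr_eq0 => /eqP/(congr1 (fun z : R[i] => z^*)).
by rewrite conjcK rmorph1 => b1; rewrite -b1 eqxx in bx0.
Qed.

(** The analogue of [lattice_comb] for any set closed under subtraction; it extends an identity
    between characters from a basis to the whole lattice. *)
Lemma zspan_ind (S : set 'rV[R]_n) (A : 'M[R]_n) (z : 'rV[R]_n) : S 0 ->
  (forall x y, S x -> S y -> S (x - y)) -> (forall i, S (row i A)) ->
  (forall i, z 0 i \is a Num.int) -> S (z *m A).
Proof.
move=> S0 SB SA zi.
have SN x : S x -> S (- x) by rewrite -sub0r; exact: SB.
have SD x y : S x -> S y -> S (x + y) by move=> Sx Sy; rewrite -(opprK y); apply/SB/SN.
rewrite mulmx_sum_row; elim/big_ind: _ => // i _; have /intrP[k ->] := zi i.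
rewrite scaler_int; have Sn (m : nat) : S (row i A *+ m).
  by elim: m => [|m IHm]; rewrite ?mulr0n// mulrS; exact: SD.
by case: k => k; rewrite ?NegzE ?mulrNz -pmulrn//; exact/SN/Sn.
Qed.

Lemma pairing_identifies_dual : identifies_dual G H b.
Proof.
split.
- move=> y Hy; split=> [x Gx|x x' Gx Gx'].
    by move: Gx Hy => [u du <-] [z dz <-]; rewrite torus_pairingE// normc_e2pi.
  move: Gx Gx' Hy => [u du <-] [u' du' <-] [z dz <-].
  by rewrite -raddfD !torus_pairingE//; [rewrite dotpDl e2piD|exact: dualD].
- move=> x y z [u du <-] [v dv <-] [w dw <-].
  by rewrite -raddfD !torus_pairingE//; [rewrite dotpDr e2piD|exact: dualD].
move=> chi [chi1 chiD].
have [D DU [dE ME]] := dual_lattice.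
have rowD i : dual M (row i (invmx D)).
  by rewrite dE => j; rewrite -row_mul mulVmx// !mxE rpred_nat.
have Gpi x : dual M x -> G (piL x) by move=> dx; exists x.
have /choice[th thE] i : exists t, chi (piL (row i (invmx D))) = e2pi t.
  by apply: e2pi_surj; apply/chi1/Gpi.
(* The vector whose inner products with the basis [row i (invmx D)] of [dual M] are the phases
   [th i] of [chi]. Then [chi] and the exponential agree on [dual M], and triviality on [L] puts [y]
   in [dual L]. *)
pose y := (\row_i th i) *m D^T.
have chi_n0 x : dual M x -> chi (piL x) != 0.
  by move=> dx; rewrite -normr_gt0 chi1 ?ltr01//; exact: Gpi.
have chi0 : chi (piL 0) = 1.
  have d0 : dual M 0 by exact: dual_0.
  apply: (mulfI (chi_n0 0 d0)); rewrite mulr1 -chiD; try exact: Gpi.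
  by rewrite -raddfD addr0.
have chiE x : dual M x -> chi (piL x) = e2pi (dotp x y).
  move=> dx; suff [] : (dual M `&` [set x | chi (piL x) = e2pi (dotp x y)]) x by [].
  rewrite -(mulmxK DU x); apply: zspan_ind.
  - by split; [exact: dual_0|rewrite /= chi0 dotp0l e2pi0].
  - move=> u v [du /= cu] [dv /= cv]; split; first exact: dualB.
    have := chi_n0 v dv => cv0; apply: (mulIf cv0) => /=.
    rewrite -chiD; try (apply: Gpi => //; exact: dualB).
    by rewrite -raddfD subrK cu cv -e2piD dotpBl subrK.
  - move=> i; split; first exact: rowD.
    rewrite /= thE; congr e2pi; rewrite dotpE /y trmx_mul trmxK mulmxA -row_mul mulVmx//.
    by rewrite row1 -rowE !mxE.
  - by move: dx; rewrite dE.
have dy : dual L y.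
  move=> x Lx; apply: e2pi_eq1; rewrite -chiE; last exact: LM.
  by rewrite -chi0; congr chi; apply/pi_eq; rewrite subr0.
exists (piM y); split.
  split; first by exists y.
  by move=> _ [u du <-]; rewrite torus_pairingE// chiE.
move=> _ [[z dz <-] bz]; apply/pi_eq; apply: dual_dual_lattice => x dx.
apply: e2pi_eq1; rewrite dotpBr e2piD -chiE// (bz (piL x)); last exact: Gpi.
by rewrite torus_pairingE// -e2piD subrr e2pi0.
Qed.

Lemma fundamental_domain_measure F F' : fundamental_domain L F ->
  fundamental_domain L F' -> lebesgue_rV n F = lebesgue_rV n F'.
Proof.
move=> FL F'L; have [C CU LE] := lattice_basis L.
have := @ge0_integral_tiles R n F F' (zlat C) (fun=> 1%E) (zlat_countable CU)
  (@zlatN _ _ C).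
rewrite -LE => /(_ FL F'L (measurable_cst _) (fun _ => lee01) (fun _ _ _ => erefl)).
by rewrite !integral_cst ?mul1e//; [case: F'L|case: FL].
Qed.

(* The translates of [fdom D] by representatives of [G] form a fundamental domain
   of [L]. *)
Lemma covol_index D : D \in unitmx -> dual M = zlat D ->
  covol L = #|` fset_set G|%:R * fvol D.
Proof.
move=> DU dE; have finG := torus_image_finite.
have [mF FD] := fdom_tiles DU.
pose T (g : torus L) := [set x : 'rV[R]_n | fdom D (x - repr g)].
pose Fu := \bigcup_(g in G) T g.
have dr g : G g -> dual M (repr g).
  by move=> [x dx <-]; rewrite -[repr _](subrK x); apply: dualD => //; apply/LM/repr_pi.
have mT g : measurable (T g).
  by rewrite -[X in measurable X]setTI; exact: (measurable_shift (- repr g)).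
have FuL : fundamental_domain L Fu.
  split; first exact: fin_bigcup_measurable.
  move=> x; have [z [[Fz Dz] zU]] := FD x.
  have dxz : dual M (x - z) by rewrite dE.
  (* [x - z] lies in [dual M], and its class modulo [L] selects the translate of [fdom D] that
     contains the representative of [x]. *)
  exists (z + repr (piL (x - z))); split.
    split; first by exists (piL (x - z)); [exists (x - z)|rewrite /T /= addrK].
    rewrite opprD addrA -opprB; apply/lattice_inP; rewrite rpredN; apply/lattice_inP.
    exact: repr_pi.
  move=> y [[g Gg Ty] Lxy].
  have yz : z = y - repr g.
    apply: zU; split=> //; rewrite -dE opprB addrA addrAC.
    by apply: dualD; [exact: LM|exact: dr].
  have gE : g = piL (x - z).
    rewrite -[g]reprK; apply/pi_eq; rewrite yz.
    rewrite opprB addrA [repr g + _]addrC subrK -opprB.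
    by apply/lattice_inP; rewrite rpredN; apply/lattice_inP.
  by rewrite -gE yz subrK.
rewrite /covol (@fundamental_domain_measure _ Fu)//; last first.
  exact: (getPex (ex_intro _ Fu FuL)).
rewrite measure_fin_bigcup//; last first.
  move=> g g' Gg Gg' [x [Tx Tx']].
  have [z [_ zU]] := FD x.
  have e1 : z = x - repr g by apply: zU; split=> //; rewrite subKr -dE; exact: dr.
  have e2 : z = x - repr g' by apply: zU; split=> //; rewrite subKr -dE; exact: dr.
  by rewrite -[g]reprK -[g']reprK; congr (piL _); rewrite -(subKr x (repr g)) -e1 e2 subKr.
have muT g : lebesgue_rV n (T g) = (fvol D)%:E.
  by rewrite -fvolE//; exact: (lebesgue_rV_shift (- repr g) mF).
rewrite (eq_fsbigr (fun=> (fvol D)%:E)) => [|g _]; last exact: muT.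
rewrite fsbig_finite//=; under eq_bigr do rewrite -[fvol D]/(cst (fvol D) 0%N).
rewrite sumEFin /= big_const_seq count_predT iter_addr_0.
by rewrite mulr_natl.
Qed.

End torus_group.

(** * Formal duality *)

Lemma complex_sum (R : realType) (I : Type) (r : seq I) (a b : I -> R) :
  \sum_(i <- r) (a i +i* b i) = (\sum_(i <- r) a i) +i* (\sum_(i <- r) b i).
Proof.
elim: r => [|i r IHr]; first by rewrite !big_nil.
by rewrite !big_cons IHr.
Qed.

Lemma sum_antisym (R : realType) (m : nat) (a : 'I_m -> 'I_m -> R) :
  (forall j k, a k j = - a j k) -> \sum_j \sum_k a j k = 0.
Proof.
move=> aN; have : \sum_j \sum_k a j k = - \sum_j \sum_k a j k.
  rewrite {1}exchange_big /= -sumrN; apply: eq_bigr => j _.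
  by rewrite -sumrN; apply: eq_bigr => k _.
by move=> s; lra.
Qed.

Lemma fourierE (R : realType) n (f : 'rV[R]_n -> R) y :
  fourier f y = osc f y 0 +i* osc f y 4^-1.
Proof.
rewrite /fourier /Cintegral /osc; congr (_ +i* _); congr (Rintegral _ _ _);
  apply/funext => x /=.
- by rewrite mul0r subr0 addr0 -[in RHS]phN.
- by rewrite mul0r addr0 -[sin _]/(complex.Im (e2pi _)) Im_e2pi -opprD phN.
Qed.

(** * Average pair sums as weighted sums over the dual lattice *)

Section pair_sums.
Context {R : realType} (n : nat) (P Q : periodic_config R n).
Notation L := (underlying P).
Notation K := (underlying Q).
Notation N := (ntrans P).
Notation M := (ntrans Q).
Notation piL := (\pi_(torus L)).
Notation piK := (\pi_(torus K)).
Notation G := (torus_image L (dual K)).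
Hypothesis LK : lattice_set L `<=` dual K.
Hypothesis Pv : forall j, dual K (trans P j).
Hypothesis Qw : forall j, dual L (trans Q j).

Let v j : torus L := piL (trans P j).
Let w j : torus K := piK (trans Q j).

(** The squared modulus of [sum_j e2pi (dotp x w_j)] in real form: the sines of the pairs [(j, k)]
    and [(k, j)] cancel. *)
Definition cosum (x : 'rV[R]_n) : R :=
  \sum_j \sum_k ph (dotp x (trans Q j - trans Q k)).

Let absum_mul f (c : 'rV[R]_n -> R) (B : R) : schwartz f -> (forall x, `|c x| <= B) ->
  absum (dual K) (fun x => f x * c x).
Proof.
move=> Sf cB; have [D DU [-> _]] := dual_lattice K.
have /absum_norm/(absumZ B) := rapid_absum 0 DU (schwartz_rapid Sf).
apply: absum_le => x _; rewrite addr0 normrM mulrC ler_wpM2r//.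
Qed.

(** Each translate [L + v_j - v_k] is a fibre of [piL] inside [dual K], so the sums over [L] merge
    into one sum over [dual K] that counts multiplicities. *)
Lemma avg_pair_sum_schwartz f : schwartz f ->
  avg_pair_sum (fun x => (f x)%:C) P =
  (N%:R^-1 * Rsum (dual K) (fun x => f x * (diff_count v (piL x))%:R))%:C.
Proof.
move=> Sf; rewrite /avg_pair_sum.
have LE j k : Csum L (fun x => (f (x + trans P j - trans P k))%:C) =
    (Rsum (dual K) (fun x => f x * (piL x == v j - v k)%:R))%:C.
  rewrite /Csum /= Rsum0; congr (_ +i* _).
  pose B := [set x | lattice_set L (x - (trans P j - trans P k))].
  have piE x : (piL x == v j - v k) = `[< B x >].
    rewrite /v -piB; apply/eqP/asboolP => [/pi_eq//|Bx]; exact/pi_eq.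
  rewrite [RHS](@Rsum_supp _ _ _ B); last 2 first.
  - move=> x Bx; rewrite -(subrK (trans P j - trans P k) x); apply: dualD.
      exact: LK.
    exact: dualB.
  - by move=> x _ nBx; rewrite piE asboolF ?mulr0.
  rewrite [RHS](eq_Rsum (h := f)) => [|x Bx]; last by rewrite piE asboolT ?mulr1.
  rewrite (@reindex_Rsum _ _ _ L B (fun x => x + trans P j - trans P k))//.
  split.
  - by move=> x Lx; rewrite /B /= -[x + _ - _]addrA addrK.
  - by move=> x y _ _ /addIr/addIr.
  - by move=> x Bx; exists (x - (trans P j - trans P k)) => //; rewrite -addrA subrK.
under eq_bigr do under eq_bigr do rewrite LE.
rewrite -(rmorph_nat (real_complex R)) -fmorphV rmorphM/=; congr (_ * _).
under eq_bigr do rewrite -rmorph_sum.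
rewrite -rmorph_sum/=; congr (_%:C).
have Ajk j k : absum (dual K) (fun x => f x * (piL x == v j - v k)%:R).
  by apply: (@absum_mul _ _ 1) => // x; case: eqP => _; rewrite ?normr1 ?normr0.
under eq_bigr do rewrite -Rsum_big//.
rewrite -Rsum_big; last by move=> j; exact: absum_big.
apply: eq_Rsum => x _; rewrite diff_countE mulr_sumr.
by apply: eq_bigr => j _; rewrite mulr_sumr.
Qed.

(** [poisson] with shift [w_j - w_k], at phase 0 for the real parts and [4^-1] for the imaginary
    parts; the latter are antisymmetric in [(j, k)] and vanish in the double sum. *)
Lemma avg_pair_sum_fourier f D : schwartz f -> D \in unitmx ->
  dual K = zlat D -> lattice_set K = zlat (invmx D)^T ->
  avg_pair_sum (fourier f) Q =
  (M%:R^-1 * (fvol D * Rsum (dual K) (fun x => f x * cosum x)))%:C.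
Proof.
move=> Sf DU dE KE; rewrite /avg_pair_sum.
pose S t j k :=
  Rsum (dual K) (fun x => f x * ph (dotp x (trans Q j - trans Q k) + t)).
have CE j k : Csum K (fun y => fourier f (y + trans Q j - trans Q k)) =
    fvol D * S 0 j k +i* (fvol D * S 4^-1 j k).
  rewrite /S dE -!(poisson DU _ _ Sf) /Csum KE.
  by congr (_ +i* _); apply: eq_Rsum => y _; rewrite fourierE addrA.
under eq_bigr do under eq_bigr do rewrite CE.
under eq_bigr do rewrite complex_sum.
rewrite complex_sum [X in _ +i* X]sum_antisym; last first.
  move=> j k; rewrite -mulrN; congr (_ * _); rewrite -mulN1r -RsumZ; last first.
    by apply: absum_mul => // x; exact: ph_le1.
  apply: eq_Rsum => x _; rewrite mulN1r -mulrN; congr (_ * _).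
  rewrite -[in RHS]phN -phD2; apply: congr1; rewrite -[trans Q k - _]opprB dotpNr; lra.
rewrite -(rmorph_nat (real_complex R)) -fmorphV [RHS]rmorphM/=; congr (_ * _).
congr (_ +i* _); under eq_bigr do rewrite -mulr_sumr.
rewrite -mulr_sumr; congr (_ * _).
have Ajk j k : absum (dual K)
    (fun x => f x * ph (dotp x (trans Q j - trans Q k) + 0)).
  by apply: absum_mul => // x; exact: ph_le1.
under eq_bigr do rewrite -Rsum_big//.
rewrite -Rsum_big; last by move=> j; exact: absum_big.
apply: eq_Rsum => x _; rewrite mulr_sumr; apply: eq_bigr => j _.
by rewrite mulr_sumr; apply: eq_bigr => k _; rewrite addr0.
Qed.

Lemma sqmean_cosum x : dual K x ->
  sqmean (fun j => torus_pairing L K (piL x) (w j)) = (M%:R ^- 2 * cosum x)%:C.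
Proof.
move=> dx; rewrite sqmeanE.
have bE j k : torus_pairing L K (piL x) (w j) *
    (torus_pairing L K (piL x) (w k))^* =
    ph (dotp x (trans Q j - trans Q k)) +i*
    ph (dotp x (trans Q j - trans Q k) - 4^-1).
  rewrite /w !torus_pairingE//.
  transitivity (e2pi (dotp x (trans Q j)) * e2pi (- dotp x (trans Q k))).
    by rewrite e2piN.
  rewrite -e2piD -dotpBr.
  by rewrite -Im_e2pi -Re_e2pi; case: (e2pi _).
under eq_bigr do under eq_bigr do rewrite bE.
under eq_bigr do rewrite complex_sum.
rewrite complex_sum [X in _ +i* X]sum_antisym; last first.
  move=> j k; rewrite -phD2 -[RHS]phN; apply: congr1.
  by rewrite -[trans Q k - _]opprB dotpNr; lra.
by rewrite rmorphM/= fmorphV rmorphXn/= rmorph_nat.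
Qed.

Let N0 : N%:R != 0 :> R. Proof. by rewrite pnatr_eq0 -lt0n ntrans_gt0. Qed.
Let M0 : M%:R != 0 :> R. Proof. by rewrite pnatr_eq0 -lt0n ntrans_gt0. Qed.

(** By [covol_index], [density P * fvol D] equals [N / |G|]: the covolumes cancel and only
    combinatorial weights remain. *)
Lemma formally_dual_Rsum : formally_dual P Q <-> forall f, schwartz f ->
  Rsum (dual K) (fun x => f x * (N%:R^-1 * (diff_count v (piL x))%:R -
    N%:R / (#|` fset_set G|%:R * M%:R) * cosum x)) = 0.
Proof.
have [D DU [dE KE]] := dual_lattice K.
have V0 : fvol D != 0 by rewrite gt_eqF// fvol_gt0.
have G0 : #|` fset_set G|%:R != 0 :> R.
  rewrite pnatr_eq0 cardfs_eq0; apply/eqP => /(congr1 (fun X => 0 \in X)).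
  rewrite in_fset0 in_fset_set ?mem_set//; first exact: torus_image0.
  exact: torus_image_finite.
have bA : exists B : R, forall x, `|(diff_count v (piL x))%:R| <= B.
  exists (N * N)%:R => x; rewrite ger0_norm// ler_nat.
  by rewrite (leq_trans (max_card _))// card_prod !card_ord.
have bB : exists B : R, forall x, `|cosum x| <= B.
  exists (\sum_(j < M) \sum_(k < M) 1) => x.
  rewrite (le_trans (ler_norm_sum _ _ _))//; apply: ler_sum => j _.
  by rewrite (le_trans (ler_norm_sum _ _ _))//; apply: ler_sum => k _; exact: ph_le1.
have [B1 hB1] := bA; have [B2 hB2] := bB.
have E f : schwartz f -> Rsum (dual K) (fun x => f x *
      (N%:R^-1 * (diff_count v (piL x))%:R -
       N%:R / (#|` fset_set G|%:R * M%:R) * cosum x)) =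
    N%:R^-1 * Rsum (dual K) (fun x => f x * (diff_count v (piL x))%:R) -
    density P * (M%:R^-1 * (fvol D * Rsum (dual K) (fun x => f x * cosum x))).
  move=> Sf; have A1 := absum_mul Sf hB1; have A2 := absum_mul Sf hB2.
  rewrite /density (covol_index LK DU dE).
  rewrite [RHS](_ : _ = N%:R^-1 * Rsum (dual K) (fun x => f x * (diff_count v (piL x))%:R) +
    (- (N%:R / (#|` fset_set G|%:R * M%:R))) * Rsum (dual K) (fun x => f x * cosum x));
    last by field; rewrite V0 G0 M0 N0.
  rewrite -!RsumZ// -RsumD; try exact: absumZ.
  by apply: eq_Rsum => x _; ring.
split=> PQ f Sf; have := PQ f Sf; rewrite E//.
  rewrite avg_pair_sum_schwartz// (avg_pair_sum_fourier Sf DU dE KE) -rmorphM.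
  by move=> /complexI ->; rewrite subrr.
rewrite avg_pair_sum_schwartz// (avg_pair_sum_fourier Sf DU dE KE) -rmorphM.
by move/eqP; rewrite subr_eq0 => /eqP ->.
Qed.

Lemma formally_dual_sqmean : formally_dual P Q <->
  (forall x, G x -> sqmean (fun j => torus_pairing L K x (w j)) =
    N%:R^-1 * (diff_count v x)%:R) /\ #|` fset_set G| = (N * M)%N.
Proof.
have vinj : injective v by move=> j k /pi_eq; exact: trans_distinct.
have [D DU [dE KE]] := dual_lattice K.
apply: (iff_trans formally_dual_Rsum); split=> [PQ|[sq GE] f Sf].
  have c0 x : dual K x -> N%:R^-1 * (diff_count v (piL x))%:R =
      N%:R / (#|` fset_set G|%:R * M%:R) * cosum x.
    move=> dx; apply/eqP; rewrite -subr_eq0; apply/eqP.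
    pose c x := N%:R^-1 * (diff_count v (piL x))%:R -
      N%:R / (#|` fset_set G|%:R * M%:R) * cosum x.
    rewrite -[LHS]/(c x); apply: gauss_separates dx _ PQ.
      move=> f Sf; rewrite dE.
      by have := rapid_absum 0 DU (schwartz_rapid Sf); apply: absum_ext => y _; rewrite addr0.
    exists (N%:R^-1 * (N * N)%:R +
      `|N%:R / (#|` fset_set G|%:R * M%:R)| * \sum_(j < M) \sum_(k < M) 1) => y.
    rewrite (le_trans (ler_normB _ _))// lerD//.
      rewrite ger0_norm ?mulr_ge0 ?invr_ge0// ler_wpM2l ?invr_ge0// ler_nat.
      by rewrite (leq_trans (max_card _))// card_prod !card_ord.
    rewrite normrM ler_wpM2l// (le_trans (ler_norm_sum _ _ _))//; apply: ler_sum => j _.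
    by rewrite (le_trans (ler_norm_sum _ _ _))//; apply: ler_sum => k _; exact: ph_le1.
  have GE : #|` fset_set G| = (N * M)%N.
    have d0 : (diff_count v (piL 0))%:R = N%:R :> R by rewrite pi0; exact: diff_count0.
    have := c0 0 (@dual_0 _ _ _); rewrite d0 mulVf//.
    rewrite /cosum; under eq_bigr do under eq_bigr do rewrite dotp0l.
    have -> : \sum_(j < M) \sum_(k < M) ph (0 : R) = M%:R * M%:R.
      rewrite /ph mulr0 cos0; under eq_bigr do rewrite sumr_const card_ord.
      by rewrite sumr_const card_ord mulr_natr.
    (* With [|G| = 0] the inverse would be 0 by convention and the equation would read [1 = 0]. *)
    have [->|G0] := eqVneq (#|` fset_set G|%:R : R) 0.
      by rewrite mul0r invr0 mulr0 mul0r => /eqP; rewrite oner_eq0.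
    move=> e; apply/eqP; rewrite -(eqr_nat R) natrM; apply/eqP.
    rewrite -[LHS]mulr1 [X in _ * X = _]e; field.
    by rewrite G0 M0.
  split=> // _ [x dx <-]; rewrite sqmean_cosum//.
  rewrite -(rmorph_nat (real_complex R) N) -(rmorph_nat (real_complex R) (diff_count _ _)).
  rewrite -fmorphV -rmorphM/= c0// GE natrM; congr (_%:C); field.
  by rewrite M0 N0.
have := sq; rewrite (eq_Rsum (h := fun=> 0)) ?Rsum0// => x dx.
have /sq : G (piL x) by exists x.
rewrite sqmean_cosum//.
rewrite -(rmorph_nat (real_complex R) N) -(rmorph_nat (real_complex R) (diff_count _ _)).
rewrite -fmorphV -rmorphM/= => /complexI <-; rewrite GE natrM.
by field; rewrite M0 N0.
Qed.

End pair_sums.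

Theorem theorem2p8 (R : realType) (n : nat) (P Q : periodic_config R n) :
  let Lambda := underlying P in
  let Gamma := underlying Q in
  let N := ntrans P in
  let M := ntrans Q in
  config_set P 0 -> config_set Q 0 ->
  [set x - y | x in config_set P & y in config_set P] `<=` dual Gamma ->
  [set x - y | x in config_set Q & y in config_set Q] `<=` dual Lambda ->
  let G : set (torus Lambda) := torus_image Lambda (dual Gamma) in
  let Ghat : set (torus Gamma) := torus_image Gamma (dual Lambda) in
  let pairing : torus Lambda -> torus Gamma -> R[i] :=
    torus_pairing Lambda Gamma in
  let v (j : 'I_N) : torus Lambda := \pi_(torus Lambda) (trans P j) in
  let w (j : 'I_M) : torus Gamma := \pi_(torus Gamma) (trans Q j) in
  let condition1 :=
    forall y, Ghat y ->
      `|N%:R^-1 * \sum_(j < N) pairing (v j) y| ^+ 2 =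
      M%:R^-1 * #|[pred jk : 'I_M * 'I_M | y == w jk.1 - w jk.2]|%:R in
  let condition2 :=
    forall f : torus Lambda -> R[i],
      ((N%:R `^ (3 / 2))^-1)%:C * \sum_(j < N) \sum_(k < N) f (v j - v k) =
      ((M%:R `^ (3 / 2))^-1)%:C *
        \sum_(j < M) \sum_(k < M) dft G pairing f (w j - w k) in
  [/\ lattice_set Lambda `<=` config_set P /\ config_set P `<=` dual Gamma,
      lattice_set Gamma `<=` config_set Q /\ config_set Q `<=` dual Lambda,
      [/\ finite_set G,
          forall x y, dual Gamma x -> dual Lambda y ->
            pairing (\pi_(torus Lambda) x) (\pi_(torus Gamma) y)
            = e2pi (dotp x y) &
          identifies_dual G Ghat pairing],
      formally_dual P Q <-> condition1 &
      condition1 <-> condition2].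
Proof.
move=> Lambda Gamma N M P0 Q0 PP QQ G Ghat pairing v w condition1 condition2.
have PdG : config_set P `<=` dual Gamma.
  by move=> x Px; apply: PP; exists x => //; exists 0 => //; rewrite subr0.
have QdL : config_set Q `<=` dual Lambda.
  by move=> x Qx; apply: QQ; exists x => //; exists 0 => //; rewrite subr0.
have LP : lattice_set Lambda `<=` config_set P.
  (* The translate with index [j] contains 0, so it is [Lambda] itself. *)
  move=> x Lx; have [j Lj] := P0; exists j.
  by have := latticeB Lj (latticeB (lattice0 _) Lx); rewrite !sub0r opprK addrC.
have GQ : lattice_set Gamma `<=` config_set Q.
  move=> x Gx; have [j Gj] := Q0; exists j.
  by have := latticeB Gj (latticeB (lattice0 _) Gx); rewrite !sub0r opprK addrC.
have LK : lattice_set Lambda `<=` dual Gamma by move=> x /LP/PdG.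
have KL : lattice_set Gamma `<=` dual Lambda by move=> x /GQ/QdL.
have Pv j : dual Gamma (trans P j).
  by apply: PdG; exists j; rewrite subrr; exact: lattice0.
have Qw j : dual Lambda (trans Q j).
  by apply: QdL; exists j; rewrite subrr; exact: lattice0.
have vinj : injective v by move=> j k /pi_eq; exact: trans_distinct.
have winj : injective w by move=> j k /pi_eq; exact: trans_distinct.
have Gv j : G (v j) by exists (trans P j).
have Hw j : Ghat (w j) by exists (trans Q j).
have N0 : (0 < N)%N by exact: ntrans_gt0.
have M0 : (0 < M)%N by exact: ntrans_gt0.
have finG : finite_set G by exact: torus_image_finite.
have finH : finite_set Ghat by exact: torus_image_finite.
pose C' := forall x, G x -> sqmean (fun j => pairing x (w j)) =
  N%:R^-1 * (diff_count v x)%:R.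
pose b' := torus_pairing Gamma Lambda.
have bb' y x : b' y x = pairing x y by exact: torus_pairing_sym.
have C1 : condition1 -> C'.
  move=> c1; apply: proj1 (duality_transfer finH _ _ _ _ _ _ Gv Hw vinj N0 M0 _ c1).
  - exact: torus_image0.
  - exact: torus_imageB.
  - exact: torus_imageB.
  - exact: pairingBl.
  - exact: pairingBr.
  - move=> x Gx; under eq_bigr do rewrite -bb'.
    exact: (pairing_orthogonal KL Gx).
  - by move=> y Hy; exact: pairing0l.
(* In this direction the group summed over is [G], so its order comes out here; starting from
   [condition1] it is reached by way of [C']. *)
have C2 : C' -> condition1 /\ #|` fset_set G| = (M * N)%N.
  move=> c'; have c1' x : G x -> sqmean (fun j => b' (w j) x) =
      N%:R^-1 * (diff_count v x)%:R.
    by move=> Gx; rewrite -c'//; congr sqmean; apply/funext => j; exact: bb'.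
  have [|||||||c1 GE] := duality_transfer (b := b') finG _ _ _ _ _ _ Hw Gv winj M0 N0 _ c1'.
  - exact: torus_image0.
  - exact: torus_imageB.
  - exact: torus_imageB.
  - exact: pairingBl.
  - exact: pairingBr.
  - move=> y Hy; under eq_bigr do rewrite bb'.
    exact: (pairing_orthogonal LK Hy).
  - by move=> y Hy; exact: pairing0l.
  split=> // y Hy; rewrite -[RHS](c1 y Hy).
  by congr (sqmean _); apply/funext => j; exact: esym (bb' _ _).
split=> //.
- split=> //; first by move=> x y dx dy; exact: torus_pairingE.
  exact: pairing_identifies_dual.
- apply: (iff_trans (formally_dual_sqmean LK Pv Qw)); split.
    by move=> [c' _]; have [] := C2 c'.
  by move=> c1; have c' := C1 c1; split=> //; have [_ ->] := C2 c'; exact: mulnC.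
- have Gvv j k : G (v j - v k) by exact: torus_imageB (Gv j) (Gv k).
  have bBw x j k : G x -> pairing x (w j - w k) = pairing x (w j) * (pairing x (w k))^*.
    by move=> Gx; exact: (pairingBr LK Gx (Hw j) (Hw k)).
  split=> [c1|c2].
    have c' := C1 c1; have [_ GE] := C2 c'.
    by apply: (sqmean_dft finG Gvv bBw N0 M0 c'); rewrite GE mulnC.
  apply: proj1 (C2 _) => x Gx.
  apply: (dft_sqmean finG _ Gvv bBw _ vinj N0 M0 c2 Gx).
    exact: torus_image0.
  by move=> j; exact: (pairing0l LK (Hw j)).
Qed.
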